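(* Let $X$ be an approximately self-similar compact metric space which verifies the following two hypotheses: 1. there exists a constant $K_\ell\ge1$ such that every connected component of $X$ is $K_\ell$-linearly connected; 2. there exists a constant $K_s\ge1$ such that for all $0<r\le\mathrm{diam}\,X$ there exists a covering $\mathcal W_r$ of $X$ by open and closed sets such that for every $W\in\mathcal W_r$ one has $\mathrm{dist}(W,X\setminus W)\ge r/K_s$ and there exists a connected component $Y$ of $X$ with $Y\subset W\subset V_r(Y)$. Suppose that the diameter of the connected components of $X$ tends to zero, i.e. for all $\delta>0$ there are only finitely many connected components of $X$ of diameter greater than or equal to $\delta$. Then $$\dim_{AR}X=\sup\{\dim_{AR}Y:Y\text{ connected component of }X\}.$$
   Context: $X$ is approximately self-similar if there exist $c_0>0$ and $L_0\ge1$ such that for any $0<r\le\mathrm{diam}\,X$ and any $x\in X$ there exist an open set $U\subset X$ with $\mathrm{diam}\,U\ge c_0$ and an $L_0$-bi-Lipschitz homeomorphism $\phi:(B(x,r),d/r)\to(U,d)$. As a standing assumption, $X$ is compact, doubling and uniformly perfect. $B(x,r)$ is the open ball; $V_r(A)=\bigcup_{x\in A}B(x,r)$; $\mathrm{dist}(A,C)=\inf\{d(x,y):x\in A,y\in C\}$ ($+\infty$ if one set is empty). A connected metric space $Y$ is $K$-linearly connected if for all $r\in(0,\mathrm{diam}\,Y]$ and all $x,y\in Y$ with $d(x,y)\le r$, $\inf\{\mathrm{diam}\,J:J\subset Y\text{ connected},\,x,y\in J\}\le Kr$. A distance $\theta$ on a space $Y$ is Ahlfors regular of dimension $q>0$ if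 there are a Radon measure $\mu$ and $K\ge1$ with $K^{-1}\le\mu(B_r)/r^q\le K$ for every $\theta$-ball of radius $0<r\le\mathrm{diam}_\theta Y$. $\dim_{AR}(Y,d)$ is the infimum of $\dim_H(Y,\theta)$ over all Ahlfors regular distances $\theta$ on $Y$ such that $\mathrm{id}:(Y,d)\to(Y,\theta)$ is a quasisymmetric homeomorphism; components carry the restricted distance. By convention $\dim_{AR}$ of a one-point space is $0$. *)

(* Defs.v *)
From HB Require Import structures.
From mathcomp Require Import all_boot all_order all_algebra.
From mathcomp Require Import all_classical all_reals all_analysis.

Set Implicit Arguments.
Unset Strict Implicit.
Unset Printing Implicit Defensive.

Import Order.TTheory GRing.Theory Num.Theory.
Import numFieldNormedType.Exports.

Local Open Scope classical_set_scope.
Local Open Scope ring_scope.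

Section restricted_distance.
Context (R : realType) (X : metricType R) (A : set X).

Let d (x y : A) : R := mdist (set_val x) (set_val y).

Let d_ge0 x y : 0 <= d x y. Proof. exact: mdist_ge0. Qed.

Let d_positivity x y : d x y = 0 -> x = y.
Proof. by move=> /mdist_positivity; exact: val_inj. Qed.

Let d_ball (x : A) (r : R) : ball x r = [set y | d x y < r].
Proof. by rewrite -initial_ballE ballEmdist. Qed.

HB.instance Definition _ :=
  PseudoMetric_isMetric.Build R (set_type A) d_ge0 d_positivity d_ball.

End restricted_distance.

Record distance (R : realType) (T : Type) := Distance {
  dist_fun :> T -> T -> R ;
  distxx : forall x, dist_fun x x = 0 ;
  dist_positivity : forall x y, dist_fun x y = 0 -> x = y ;
  dist_sym : forall x y, dist_fun x y = dist_fun y x ;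
  dist_triangle : forall y x z, dist_fun x z <= dist_fun x y + dist_fun y z
}.

(* The metric space (T, theta), a copy of T whose topology is that of theta. *)
Definition remetric (R : realType) (T : choiceType) (theta : distance R T) :
  Type := T.

HB.instance Definition _ (R : realType) (T : choiceType)
  (theta : distance R T) := Choice.copy (remetric theta) T.
HB.instance Definition _ (R : realType) (T : choiceType)
  (theta : distance R T) := isMetric.Build R (remetric theta)
    (distxx theta) (@dist_positivity _ _ theta) (dist_sym theta)
    (dist_triangle theta).

(* The library only has measures on pointed types, and a subspace has no
   canonical point, so the Borel sigma-algebra is put on a copy of M pointed at
   some p : M. The measurable sets do not depend on p. *)
Definition pointed_at (R : realType) (M : metricType R) (p : M) : Type := M.

HB.instance Definition _ (R : realType) (M : metricType R) (p : M) :=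
  Choice.copy (pointed_at p) M.
HB.instance Definition _ (R : realType) (M : metricType R) (p : M) :=
  isPointed.Build (pointed_at p) p.

Definition borel (R : realType) (M : metricType R) (p : M) :=
  g_sigma_algebraType ((@open M) : set (set (pointed_at p))).

Section metric_notions.
Context (R : realType).
Implicit Types (M N : metricType R) (r s : R).

(* The 0 makes the diameter of the empty set 0 rather than -oo. *)
Definition diam M (A : set M) : \bar R :=
  maxe 0%E (ereal_sup [set (mdist x y)%:E | x in A & y in A]).

Definition set_dist M (A C : set M) : \bar R :=
  ereal_inf [set (mdist x y)%:E | x in A & y in C].

Definition neighborhood M r (A : set M) : set M := \bigcup_(x in A) ball x r.

Definition doubling M : Prop :=
  exists n : nat, forall (x : M) r, 0 < r ->
    exists2 s : seq M, (size s <= n)%N &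
      ball x r `<=` \bigcup_(y in [set` s]) ball y (r / 2).

Definition uniformly_perfect M : Prop :=
  exists2 lambda : R, 1 < lambda & forall (x : M) r, 0 < r ->
    ~` ball x r !=set0 -> ball x r `\` ball x (r / lambda) !=set0.

(* phi is only meaningful on the ball. It is a bijection of the ball onto U, and
   the bi-Lipschitz bounds make it a homeomorphism. *)
Definition approximately_self_similar M : Prop :=
  exists c0 L0 : R, [/\ 0 < c0, 1 <= L0 &
    forall r (x : M), 0 < r -> (r%:E <= diam [set: M])%E ->
      exists (U : set M) (phi : M -> M),
        [/\ open U, (c0%:E <= diam U)%E, set_bij (ball x r) U phi &
          forall y z, ball x r y -> ball x r z ->
            L0^-1 * (mdist y z / r) <= mdist (phi y) (phi z)
              <= L0 * (mdist y z / r)]].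

Definition components M : set (set M) := range (connected_component [set: M]).

Definition linearly_connected (K : R) M : Prop :=
  connected [set: M] /\
  forall r (x y : M), 0 < r -> (r%:E <= diam [set: M])%E -> mdist x y <= r ->
    (ereal_inf [set diam J | J in
       [set J : set M | [/\ connected J, J x & J y]]] <= (K * r)%:E)%E.

Definition hausdorff_content M (delta s : R) : \bar R :=
  ereal_inf [set (\sum_(0 <= i <oo) diam (E i) `^ s)%E | E in
    [set E : (set M)^nat | (forall i, (diam (E i) <= delta%:E)%E) /\
                           \bigcup_i E i = [set: M]]].

Definition hausdorff_measure M (s : R) : \bar R :=
  ereal_sup [set hausdorff_content M delta s | delta in
    [set delta : R | 0 < delta]].

(* s = 0 is left out because x `^ 0 = 1 even for x = 0; this does not change the
   infimum. *)
Definition hausdorff_dim M : \bar R :=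
  ereal_inf [set s%:E | s in
    [set s : R | 0 < s /\ hausdorff_measure M s = 0%E]].

Definition radon M (mu : set M -> \bar R) : Prop :=
  [/\ forall C, compact C -> (mu C < +oo)%E,
      forall B, <<s (@open M) >> B ->
        mu B = ereal_inf [set mu U | U in [set U | open U /\ B `<=` U]] &
      forall U, open U ->
        mu U = ereal_sup [set mu C | C in [set C | compact C /\ C `<=` U]]].

Definition ahlfors_regular (q : R) M : Prop :=
  exists (p : M) (mu : {measure set (borel p) -> \bar R}) (K : R),
    [/\ radon (mu : set M -> \bar R), 1 <= K &
      forall (x : M) r, 0 < r -> (r%:E <= diam [set: M])%E ->
        ((K^-1 * r `^ q)%:E <= mu (ball x r) <= (K * r `^ q)%:E)%E].

Definition homeomorphism M N (f : M -> N) : Prop :=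
  exists g : N -> M,
    [/\ cancel f g, cancel g f, continuous f & continuous g].

(* An increasing homeomorphism of [0, +oo[; continuity of the inverse is
   automatic. *)
Definition distortion_function (eta : R -> R) : Prop :=
  [/\ set_bij `[0, +oo[ `[0, +oo[ eta,
      {within `[0, +oo[, continuous eta} &
      forall s t, 0 <= s -> s < t -> eta s < eta t].

Definition quasisymmetric M N (f : M -> N) : Prop :=
  homeomorphism f /\
  exists2 eta : R -> R, distortion_function eta &
    forall x y z : M, x != y ->
      mdist (f x) (f z) / mdist (f x) (f y) <= eta (mdist x z / mdist x y).

Definition dim_AR M : \bar R :=
  if `[< exists x : M, [set: M] = [set x] >] then 0%E else
  ereal_inf [set hausdorff_dim (remetric theta) | theta in
    [set theta : distance R M |
       (exists2 q : R, 0 < q & ahlfors_regular q (remetric theta)) /\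
       quasisymmetric (idfun : M -> remetric theta)]].

End metric_notions.

Arguments components {R} M _.

(* Main.v *)
(* If theta is quasisymmetric to d and every r-separated subset of a theta-ball of
   radius rho has at most C (rho / r)^p points, then dim_AR <= q for every q > p:
   nested nets carry a measure mu with mu(B(x, rho)) <= A (rho / r)^q mu(B(x, r))
   (as in the Volberg-Konyagin theorem), and d' with d'(x, y)^q comparable to
   mu(B(x, d(x, y))) is Ahlfors regular of dimension q. For the restriction to a
   component Y, which is uniformly perfect since it is connected, this gives
   dim_AR Y <= dim_AR X.

   Conversely let all dim_AR Y be less than p. By self-similarity and the linear
   connectedness of the finitely many large components, distinct components are
   relatively separated: dist(Y, Y') >= c min(diam Y, diam Y'). Hence a coarse
   component of X at scale s, whose points are joined by s-chains, is either of
   diameter comparable to s, or lies near a single component Y of much larger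
   diameter, and the latter remains true with the same Y along each interval of
   scales. Rescaling by self-similarity replaces Y by one of the finitely many
   components of diameter at least delta, and on these there are distances theta_Y
   quasisymmetric to d that satisfy the packing bound for an exponent q < p. The
   coarse components, grouped along these intervals of scales, form a tree; the
   theta_Y are glued along this tree, each child being shrunk to the theta_Y-size
   of the ball it replaces, times a small eta. Power bounds for the theta_Y-size
   of balls make the result quasisymmetric to d. Since q < p the sum of the p-th
   powers of the sizes of the children converges, so for eta small the glued
   distance satisfies the packing bound with exponent p. *)
Require Import Defs.
From mathcomp Require Import all_boot all_order all_algebra.
From mathcomp Require Import all_classical all_reals all_analysis.
From mathcomp Require Import lra ring.
Import Order.TTheory GRing.Theory Num.Theory.
Import numFieldNormedType.Exports.
Local Open Scope classical_set_scope.
Local Open Scope ring_scope.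
Set Implicit Arguments.
Unset Strict Implicit.
Unset Printing Implicit Defensive.

(** The working quantity is the [packing] bound rather than Ahlfors regularity: it needs no measure,
    passes to subsets with the same constants and survives rescaling, whereas gluing with shrunken
    children has no reason to preserve regularity. Regularity enters only at the two ends. A regular
    distance of dimension below [p] gives a packing bound with an exponent below [p], and a packing
    bound gives back a regular distance at the cost of an arbitrarily small increase of the
    exponent, which is harmless since dimensions are compared up to every positive [e].

    The main obstacle is uniformity over infinitely many nodes: no constant may deteriorate with the
    scale or with the number of generations crossed. Every estimate on models therefore has a
    constant that is chosen before the model. The parameter [eta] is chosen last:
    [eta^p * Cb <= 2^-1] lets the count of separated points close up over all generations, and
    [eta * B <= 1] keeps the constant of one generation from accumulating along a branch. *)

Section MetricBasics.
Context (R : realType) (M : metricType R).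
Implicit Types (x y z : M) (r : R).

Lemma mballE x r y : ball x r y = (mdist x y < r) :> Prop.
Proof. by rewrite ballEmdist. Qed.

Lemma open_mdistP (A : set M) :
  open A <-> forall x, A x -> exists2 r, 0 < r & forall y, mdist x y < r -> A y.
Proof.
rewrite openE; split => oA x Ax.
  have := oA x Ax; rewrite /interior -filter_from_ballE => -[r r0 rA].
  by exists r => // y xy; apply: rA; rewrite mballE.
have [r r0 rA] := oA x Ax; rewrite /interior -filter_from_ballE.
by exists r => //= y; rewrite mballE; exact: rA.
Qed.

Lemma open_mball x r : open (ball x r).
Proof.
apply/open_mdistP => y; rewrite mballE => xy; exists (r - mdist x y).
  by rewrite subr_gt0.
move=> z yz; rewrite mballE; apply: le_lt_trans (metric_triangle _ y _) _.
by rewrite -ltrBrDl.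
Qed.

Lemma closed_mdist (A : set M) x : closed A ->
  (forall e, 0 < e -> exists2 y, A y & mdist x y < e) -> A x.
Proof.
move=> cA H; apply: cA => B; rewrite -filter_from_ballE => -[e e0 eB].
by have [y Ay xy] := H e e0; exists y; split=> //; apply: eB; rewrite mballE.
Qed.

Lemma compact_bounded : compact [set: M] ->
  exists2 D, 0 < D & forall x y, mdist x y <= D.
Proof.
move=> /compact_near_coveringP cM.
have [[x0 _]|nx] := pselect (exists x : M, True); last first.
  by exists 1 => // x; exfalso; apply: nx; exists x.
have [|r0 [_ H]] := cM R (pinfty_nbhs R) (fun r x => mdist x0 x < r) _.
  move=> x _; exists (ball x 1, [set r | mdist x0 x + 1 < r]) => /=.
    split; first by apply: nbhsx_ballx.
    by exists (mdist x0 x + 1); split; [exact: num_real|].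
  move=> [y r] /= []; rewrite mballE => xy H.
  by apply: lt_trans H; apply: le_lt_trans (metric_triangle _ x _) _; rewrite ltrD2l.
have {}H y : mdist x0 y < r0 + 1 by apply: H => //; rewrite ltrDl.
exists (2 * (r0 + 1)).
  by rewrite mulr_gt0 // (le_lt_trans _ (H x0)) // mdist_ge0.
move=> x y; apply: le_trans (metric_triangle _ x0 _) _.
by rewrite metric_sym mulr2n mulrDl mul1r lerD // ltW.
Qed.

Lemma compact_cluster_seq (u : nat -> M) : compact [set: M] ->
  exists x, forall e N, 0 < e -> exists2 n, (N <= n)%N & mdist x (u n) < e.
Proof.
move=> cM; have [|x [_ cx]] := cM (u @ \oo) _; first exact: filterT.
exists x => e N e0.
have [||z [[n /= Nn <-]]] := cx (u @` [set n | (N <= n)%N]) (ball x e).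
- by exists N => // n /= Nn; exists n.
- by apply: nbhsx_ballx.
- by rewrite mballE => H; exists n.
Qed.

Lemma diam_leP (A : set M) r : 0 <= r ->
  ((diam A <= r%:E)%E <-> forall x y, A x -> A y -> mdist x y <= r).
Proof.
move=> r0; rewrite /diam ge_max lee_fin r0 /=; split.
  move=> H x y Ax Ay; rewrite -lee_fin; apply: le_trans H.
  by apply: ereal_sup_ubound; exists x => //; exists y.
move=> H; apply: ge_ereal_sup => _ [x Ax [y Ay <-]]; rewrite lee_fin; exact: H.
Qed.

Lemma diam_ge0 (A : set M) : (0 <= diam A)%E.
Proof. by rewrite /diam le_max lexx. Qed.

Lemma mdist_le_diam (A : set M) x y : A x -> A y -> ((mdist x y)%:E <= diam A)%E.
Proof.
move=> Ax Ay; rewrite /diam le_max; apply/orP; right.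
by apply: ereal_sup_ubound; exists x => //; exists y.
Qed.

Lemma diam_gt (A : set M) r : 0 <= r -> (r%:E < diam A)%E ->
  exists x y, [/\ A x, A y & r < mdist x y].
Proof.
move=> r0; rewrite /diam lt_max ltNge lee_fin r0 /=.
by move=> /ereal_sup_gt [_ [x Ax [y Ay <-]]]; rewrite lte_fin => H; exists x, y.
Qed.

End MetricBasics.

(** * Distortion functions and quasisymmetric changes of distance *)

Section Distortion.
Context (R : realType).
Implicit Types (a b C t : R).

Lemma powR_continuous0 a : 0 < a ->
  {within `[0, +oo[, continuous (fun t : R => t `^ a)}.
Proof.
move=> a0; apply/continuous_within_itvcyP; split.
  move=> x; rewrite in_itv /= andbT => x0.
  apply/differentiable_continuous/derivable1_diffP/derivable_powR.
  by rewrite in_itv /= andbT.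
by rewrite powR0 ?gt_eqF //; exact: powR_cvg0.
Qed.

(** The smaller exponent governs ratios below 1 and the larger one ratios above 1; taking the sum
    avoids a distinction of cases. *)
Lemma distortion_powR C a b : 0 < C -> 0 < a -> 0 < b ->
  distortion_function (fun t => C * (t `^ a + t `^ b)).
Proof.
move=> C0 a0 b0; pose f t := C * (t `^ a + t `^ b).
have fi s t : 0 <= s -> s < t -> f s < f t.
  move=> s0 st; have t0 : 0 < t := le_lt_trans s0 st.
  by rewrite ltr_pM2l // ltrD // gt0_ltr_powR ?nnegrE // ltW.
have f0 : f 0 = 0 by rewrite /f !powR0 ?gt_eqF // addr0 mulr0.
have cf : {within `[0, +oo[, continuous f}.
  move=> x; apply: cvgM; first exact: cvg_cst.
  by apply: cvgD; [exact: (powR_continuous0 a0)|exact: (powR_continuous0 b0)].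
split => //; split.
- move=> t; rewrite /= !in_itv /= !andbT => t0; rewrite mulr_ge0 ?(ltW C0) //.
  by rewrite addr_ge0 // powR_ge0.
- move=> s t; rewrite !inE /= !in_itv /= !andbT => s0 t0 fst.
  have [st|ts|//] := ltgtP s t.
    by have := fi s t s0 st; rewrite /f fst ltxx.
  by have := fi t s t0 ts; rewrite /f fst ltxx.
- move=> v; rewrite /= in_itv /= andbT => v0.
  (* At [B] the first power alone already reaches [v], so the intermediate value theorem applies on
     [[0, B]]. *)
  pose B := (v / C) `^ a^-1.
  have vC : 0 <= v / C by rewrite divr_ge0 // ltW.
  have fB : v <= f B.
    rewrite /f /B -powRrM mulVf ?gt_eqF // powRr1 //.
    by rewrite mulrDr mulrCA divff ?gt_eqF // mulr1 lerDl mulr_ge0 ?(ltW C0) ?powR_ge0.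
  have B0 : 0 <= B by exact: powR_ge0.
  have [|| c] := @IVT R f 0 B v B0.
  + apply: continuous_subspaceW cf => x; rewrite /= !in_itv /= => /andP[-> _] //.
  + rewrite f0 (min_idPl _) ?(max_idPr _) ?v0 ?fB // ?(le_trans v0 fB) //.
  rewrite in_itv /= => /andP[c0 _] fc; exists c => //=.
  by rewrite in_itv /= c0.
Qed.

Lemma distortion_comp (f g : R -> R) :
  distortion_function f -> distortion_function g -> distortion_function (f \o g).
Proof.
move=> [bf cf mf] [bg cg mg]; split.
- exact: set_bij_comp bg bf.
- refine ((@subspace_continuousP R `[0%R, +oo[%classic R (f \o g)).2 _) => x x0 U fU.
  have gA y : `[0, +oo[%classic y -> `[0, +oo[%classic (g y).
    by have [h _ _] := bg; exact: h.
  have hf := (@subspace_continuousP R `[0%R, +oo[%classic R f).1 cf; have hg := (@subspace_continuousP R `[0%R, +oo[%classic R g).1 cg.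
  have H := hf (g x) (gA x x0) U fU.
  have H' := hg x x0 _ H.
  apply: (@filterS _ (nbhs x) _ _ _ _ H') => y /= Hy y0; exact: (Hy y0 (gA y y0)).
- move=> s t s0 st; apply: mf; last exact: mg.
  by have [h _ _] := bg; have := h s; rewrite /= !in_itv /= !andbT; apply.
Qed.

End Distortion.

Section Quasisymmetry.
Context (R : realType).

(** The inequality alone makes the identity a homeomorphism. Continuity holds because [eta] is small
    near 0; for the inverse the inequality is used with [y] and [z] exchanged. If [x] is the only
    point, both are trivial. *)
Lemma qs_of_ineq (M : metricType R) (theta : distance R M) (eta : R -> R) :
  distortion_function eta ->
  (forall x y z : M, x != y ->
    theta x z / theta x y <= eta (mdist x z / mdist x y)) ->
  quasisymmetric (idfun : M -> remetric theta).
Proof.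
move=> deta H; split; last by exists eta.
have [[eA _ eS] ce me] := deta.
have e_ge0 t : 0 <= t -> 0 <= eta t.
  by move=> t0; have := eA t; rewrite /= !in_itv /= !andbT; apply.
have th_ge0 x y : 0 <= theta x y by exact: (mdist_ge0 (x : remetric theta) y).
have th_gt0 x y : x != y -> 0 < theta x y.
  by move=> xy; have := mdist_gt0 (x : remetric theta) y; rewrite xy.
have inj s t : 0 <= s -> 0 <= t -> eta s < eta t -> s < t.
  move=> s0 t0; apply: contraTT; rewrite -!leNgt le_eqVlt => /orP[/eqP ->//|ts].
  by rewrite ltW // me.
have {}eS v : 0 <= v -> exists2 s, 0 <= s & eta s = v.
  move=> v0; have /eS[s] : `[0, +oo[%classic v by rewrite /= in_itv /= v0.
  by rewrite /= in_itv /= andbT; exists s.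
have eta0 : eta 0 = 0.
  have [s] := eS 0 (lexx 0).
  rewrite le_eqVlt => /orP[/eqP <- //|s0 es].
  by have := me _ _ (lexx 0) s0; rewrite es ltNge e_ge0.
have inv (x : M) e : 0 < e ->
    exists2 t, 0 < t & forall z, theta x z < t -> mdist x z < e.
  move=> e0; have [[y yx]|nx] := pselect (exists y : M, y != x); last first.
    exists 1 => // z _; suff -> : z = x by rewrite mdistxx.
    by apply/eqP/negPn/negP => zx; apply: nx; exists z.
  have xy : x != y by rewrite eq_sym.
  have q0 : 0 < mdist x y / e by rewrite divr_gt0 // mdist_gt0.
  have eq0 : 0 < eta (mdist x y / e) by rewrite -eta0 me.
  have td : 0 < theta x y / eta (mdist x y / e) by rewrite divr_gt0 ?th_gt0.
  exists (theta x y / eta (mdist x y / e)) => // z xz.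
  rewrite ltNge; apply/negP => ez.
  have dxz : 0 < mdist x z by exact: lt_le_trans e0 ez.
  have zx : x != z by rewrite -mdist_gt0.
  have := H x z y zx; rewrite ler_pdivrMr ?th_gt0 // leNgt => /negP; apply.
  have le1 : mdist x y / mdist x z <= mdist x y / e.
    by rewrite ler_pM2l ?mdist_gt0 // lef_pV2 ?posrE.
  have {}le1 : eta (mdist x y / mdist x z) <= eta (mdist x y / e).
    move: le1; rewrite le_eqVlt => /orP[/eqP ->//|/me h]; apply/ltW/h.
    by rewrite divr_ge0 // mdist_ge0.
  apply: le_lt_trans (ler_wpM2r (th_ge0 _ _) le1) _.
  by rewrite mulrC -ltr_pdivlMr.
exists idfun; split => //.
- move=> x; apply/(@metricType_numDomainType.cvgrPdist_lt R (remetric theta)) => e e0.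
  have [[y yx]|nx] := pselect (exists y, y != x); last first.
    apply: nearW => z; suff -> : z = x by rewrite mdistxx.
    by apply/eqP/negPn/negP => zx; apply: nx; exists z.
  have xy : x != y by rewrite eq_sym.
  have v0 : 0 < e / theta x y / 2 by rewrite !divr_gt0 // th_gt0.
  have [t t0 et] := eS _ (ltW v0).
  have {}t0 : 0 < t.
    by rewrite lt_neqAle t0 andbT; apply: contraTneq v0 => E; rewrite -et -E eta0 ltxx.
  have dxy : 0 < mdist x y by rewrite mdist_gt0.
  have td : 0 < t * mdist x y by rewrite mulr_gt0.
  apply: filterS (nbhsx_ballx x _ td) => z; rewrite mballE => xz.
  change (theta x z < e).
  have := H x y z xy; rewrite ler_pdivrMr ?th_gt0 // => /le_lt_trans; apply.
  have E1 : e / theta x y / 2 * theta x y = e / 2.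
    by rewrite mulrAC divfK ?gt_eqF ?th_gt0.
  have /ltW : mdist x z / mdist x y < t by rewrite ltr_pdivrMr.
  rewrite le_eqVlt => /orP[/eqP ->|].
    by rewrite et E1 ltr_pdivrMr // ltr_pMr // ltr1n.
  have q0 : 0 <= mdist x z / mdist x y by rewrite divr_ge0 // mdist_ge0.
  move=> /(me _ _ q0) h; apply: (lt_trans (y := eta t * theta x y)).
    by rewrite ltr_pM2r ?th_gt0.
  by rewrite et E1 ltr_pdivrMr // ltr_pMr // ltr1n.
- move=> x.
  apply/(@metricType_numDomainType.cvgrPdist_lt R M (remetric theta)
    (nbhs (x : remetric theta)) (nbhs_filter _) idfun x) => e e0.
  have [t t0 ht] := inv x e e0.
  have N := @nbhsx_ballx R (remetric theta) x _ t0.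
  apply: (@filterS _ (nbhs (x : remetric theta)) (nbhs_filter _) _ _ _ N) => z.
  by rewrite (@mballE R (remetric theta)); exact: ht.
Qed.

Lemma qs_comp (M : metricType R) (theta : distance R M) (theta' : distance R M) :
  quasisymmetric (idfun : M -> remetric theta) ->
  quasisymmetric (idfun : remetric theta -> remetric theta') ->
  quasisymmetric (idfun : M -> remetric theta').
Proof.
move=> [_ [e1 d1 h1]] [_ [e2 d2 h2]].
apply: (qs_of_ineq (distortion_comp d2 d1)) => x y z xy.
apply: le_trans (h2 x y z xy) _.
have [[eA _ _] _ me] := d2.
have th_ge0 u v : 0 <= theta u v by exact: (mdist_ge0 (u : remetric theta) v).
have := h1 x y z xy; rewrite le_eqVlt => /orP[/eqP|] H.
  by rewrite /= -H.
by apply/ltW/me => //; rewrite divr_ge0 // th_ge0.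
Qed.

(** Suppose a [theta]-annulus about [x] is empty and let [inf S] be the [mdist]-distance from [x] to
    the outside. Uniform perfectness of [mdist] gives a point [w] with
    [inf S / lam <= mdist x w < inf S], hence in the inner [theta]-ball, while some outer point [z]
    has [mdist x z < 2 * inf S]. Quasisymmetry bounds the jump from [w] to [z] by the factor
    [eta (4 * lam)], too little to cross the annulus. *)
Lemma qs_uniformly_perfect (M : metricType R) (theta : distance R M) :
  uniformly_perfect M -> quasisymmetric (idfun : M -> remetric theta) ->
  uniformly_perfect (remetric theta).
Proof.
move=> [lam lam1 um] [[f [fK _ ci cf]] [eta [[eA _ eS] ce me] H]].
have {f fK cf} cont : forall x : M, forall e, 0 < e -> exists2 t, 0 < t &
    forall z, mdist x z < t -> theta x z < e.
  move=> x e e0.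
  have /(@metricType_numDomainType.cvgrPdist_lt R (remetric theta)) h := ci x.
  have := h e e0; rewrite -filter_from_ballE => -[t t0 ht]; exists t => // z xz.
  by apply: ht; rewrite mballE.
have th_ge0 u v : 0 <= theta u v by exact: (mdist_ge0 (u : remetric theta) v).
have th_gt0 x y : x != y -> 0 < theta x y.
  by move=> xy; have := mdist_gt0 (x : remetric theta) y; rewrite xy.
have l0 : 0 < lam := lt_trans ltr01 lam1.
have el : 0 <= eta (4 * lam).
  by have := eA (4 * lam); rewrite /= !in_itv /= !andbT; apply; rewrite mulr_ge0 // ltW.
exists (eta (4 * lam) + 2); first by rewrite ltr_wpDl // ltr1n.
have E0 : 0 < eta (4 * lam) + 2 by rewrite ltr_wpDl.
suff main (x z0 : M) r : 0 < r -> r <= theta x z0 ->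
    exists2 w, r / (eta (4 * lam) + 2) <= theta x w & theta x w < r.
  move=> x r r0 [z0 /=]; rewrite (@mballE R (remetric theta)) => /negP.
  rewrite -leNgt => xz0; have [w w1 w2] := main x z0 r r0 xz0; exists w.
  by split; rewrite (@mballE R (remetric theta)) //; apply/negP; rewrite -leNgt.
move=> r0 xz0.
have [[w w1 w2]|E] := pselect (exists2 w, r / (eta (4 * lam) + 2) <= theta x w
  & theta x w < r); first by exists w.
have gap w : theta x w < r -> theta x w < r / (eta (4 * lam) + 2).
  by move=> xw; rewrite ltNge; apply/negP => xw2; apply: E; exists w.
exfalso.
pose S := [set mdist x z | z in [set z | r <= theta x z]].
have S0 : S !=set0 by exists (mdist x z0); exists z0.
have [t t0 ht] := cont x r r0.
have lbS : lbound S t.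
  by move=> _ [z /= rz <-]; rewrite leNgt; apply/negP => /ht; rewrite ltNge rz.
have hS : has_inf S by split => //; exists t.
have iS : t <= inf S by exact: lb_le_inf.
have iS0 : 0 < inf S by exact: lt_le_trans iS.
have [|_ [z rz <-] xz] := @inf_adherent _ S (inf S) _ hS; first exact: iS0.
have rz' : inf S <= mdist x z by apply: ge_inf; [exists t|exists z].
have [||w []] := um x (inf S).
- exact: iS0.
- by exists z => /=; rewrite mballE; apply/negP; rewrite -leNgt.
rewrite !mballE => xw /negP; rewrite -leNgt => wx.
have w1 : theta x w < r / (eta (4 * lam) + 2).
  apply: gap; rewrite ltNge; apply/negP => rw.
  by have : inf S <= mdist x w by [apply: ge_inf; [exists t|exists w]]; rewrite leNgt xw.
have dw0 : 0 < mdist x w by apply: lt_le_trans wx; rewrite divr_gt0.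
have nxw : x != w by rewrite -mdist_gt0.
have h := H x w z nxw; change (is_true (theta x z / theta x w <= eta (mdist x z / mdist x w))) in h.
rewrite ler_pdivrMr ?th_gt0 // in h.
have : theta x z < r; last by rewrite ltNge rz.
apply: le_lt_trans h _.
have rat : mdist x z / mdist x w < 4 * lam.
  rewrite ltr_pdivrMr //; apply: (lt_le_trans xz).
  rewrite -mulrA; move: wx; rewrite ler_pdivrMr // => wx.
  by rewrite (mulrC lam); lra.
have q0 : 0 <= mdist x z / mdist x w by rewrite divr_ge0 // mdist_ge0.
have := me _ _ q0 rat => e1.
apply: (@le_lt_trans _ _ (eta (4 * lam) * theta x w)).
  by rewrite ler_wpM2r ?th_ge0 // ltW.
move: w1; rewrite ltr_pdivlMr // => w1; apply: le_lt_trans w1.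
by rewrite mulrC ler_wpM2l // ?th_ge0 // lerDl.
Qed.

End Quasisymmetry.

(** * Packing bounds, Ahlfors regularity and Hausdorff dimension *)

Section Packing.
Context (R : realType).

(* A quantitative form of: the Assouad dimension of (T, d) is at most q. *)
Definition packing (T : eqType) (d : T -> T -> R) (q C : R) : Prop :=
  forall (x : T) (rho r : R) (s : seq T), 0 < r -> r <= rho -> uniq s ->
    {in s, forall y, d x y < rho} ->
    {in s &, forall y z, y != z -> r <= d y z} ->
    (size s)%:R <= C * (rho / r) `^ q.

Lemma packing_weaken (T : eqType) (d : T -> T -> R) (q q' C C' : R) :
  0 <= C -> q <= q' -> C <= C' -> packing d q C -> packing d q' C'.
Proof.
move=> C0 qq CC H x rho r s r0 rr us s1 s2.
apply: le_trans (H x rho r s r0 rr us s1 s2) _.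
apply: ler_pM => //; first exact: powR_ge0.
by apply: ler_powR => //; rewrite ler_pdivlMr // mul1r.
Qed.

(** An uncovered point can be added to [s] without spoiling the separation, and the bound [N] stops
    the process. Starting from a prescribed [s] is what makes the nets of successive scales
    nested. *)
Lemma exists_net (T : eqType) (d : T -> T -> R) (r : R) (N : nat) (s : seq T) :
  (forall x y, d x y = d y x) -> (forall x, d x x < r) ->
  (forall t : seq T, uniq t -> {in t &, forall y z, y != z -> r <= d y z} ->
    (size t <= N)%N) ->
  uniq s -> {in s &, forall y z, y != z -> r <= d y z} ->
  exists t : seq T, [/\ uniq t, {subset s <= t},
    {in t &, forall y z, y != z -> r <= d y z} &
    forall x, exists2 y, y \in t & d x y < r].
Proof.
move=> ds dxx bN; move: {2}(N - size s)%N (leqnn (N - size s)) => k.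
elim: k s => [|k IH] s; last first.
  move=> sk us ss.
  have [H|/existsNP[x nx]] := pselect (forall x, exists2 y, y \in s & d x y < r).
    by exists s; split.
  have {}nx y : y \in s -> r <= d x y.
    by move=> ys; rewrite leNgt; apply/negP => xy; apply: nx; exists y.
  have xs : x \notin s.
    by apply/negP => /nx; rewrite leNgt dxx.
  have uxs : uniq (x :: s) by rewrite /= xs.
  have sxs : {in x :: s &, forall y z, y != z -> r <= d y z}.
    move=> y z; rewrite !inE => /orP[/eqP ->|ys] /orP[/eqP ->|zs] //.
    - by rewrite eqxx.
    - by move=> _; exact: nx.
    - by rewrite ds => _; exact: nx.
    - exact: ss.
  have := bN _ uxs sxs => /= sN.
  have [|t [ut st tt td]] := IH (x :: s) _ uxs sxs.
    by rewrite /= subnS -subn1 leq_subLR add1n.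
  by exists t; split => // y ys; apply: st; rewrite inE ys orbT.
move=> sk us ss; exists s; split => // x; apply: contrapT => nx.
have {}nx y : y \in s -> r <= d x y.
  by move=> ys; rewrite leNgt; apply/negP => xy; apply: nx; exists y.
have xs : x \notin s.
  by apply/negP => /nx; rewrite leNgt dxx.
have uxs : uniq (x :: s) by rewrite /= xs.
have sxs : {in x :: s &, forall y z, y != z -> r <= d y z}.
  move=> y z; rewrite !inE => /orP[/eqP ->|ys] /orP[/eqP ->|zs] //.
  - by rewrite eqxx.
  - by move=> _; exact: nx.
  - by rewrite ds => _; exact: nx.
  - exact: ss.
have := bN _ uxs sxs => /= sN.
by move: sk; rewrite leqn0 subn_eq0 leqNgt sN.
Qed.

Lemma packing_net (M : metricType R) (q C D r : R) (s : seq M) :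
  packing (@mdist R M) q C -> (forall x y : M, mdist x y <= D) -> 0 < r ->
  uniq s -> {in s &, forall y z, y != z -> r <= mdist y z} ->
  exists t : seq M, [/\ uniq t, {subset s <= t},
    {in t &, forall y z, y != z -> r <= mdist y z} &
    forall x, exists2 y, y \in t & mdist x y < r].
Proof.
move=> pk bD r0 us ss.
have [[x0 _]|nx] := pselect (exists x : M, True); last first.
  by exists s; split => // x; exfalso; apply: nx; exists x.
pose B := C * ((D + r) / r) `^ q.
have [n nB] : exists n : nat, B <= n%:R.
  exists (Num.bound `|B|); apply: le_trans (ler_norm _) _.
  exact/ltW/archi_boundP/normr_ge0.
apply: (exists_net (N := n)) => //.
- exact: metric_sym.
- by move=> x; rewrite mdistxx.
- move=> t ut tt; rewrite -(ler_nat R); apply: le_trans nB.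
  have D0 : 0 <= D by apply: le_trans (bD x0 x0); exact: mdist_ge0.
  apply: (pk x0) => //; first by rewrite lerDr.
  by move=> y _; apply: le_lt_trans (bD _ _) _; rewrite ltrDl.
Qed.

Lemma measure_disjoint_ge d (T : measurableType d) (mu : {measure set T -> \bar R})
    (I : choiceType) (s : seq I) (F : I -> set T) (c : R) :
  uniq s -> {in s, forall i, measurable (F i)} ->
  {in s &, forall i j, i != j -> F i `&` F j = set0} ->
  {in s, forall i, (c%:E <= mu (F i))%E} ->
  (((size s)%:R * c)%:E <= mu (\big[setU/set0]_(i <- s) F i))%E.
Proof.
elim: s => [|i s IH] /=; first by rewrite big_nil mul0r measure0.
move=> /andP[is_ us] mF dF cF; rewrite big_cons.
have ms : measurable (\big[setU/set0]_(i <- s) F i).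
  rewrite big_seq; apply: bigsetU_measurable => j js.
  by apply: mF; rewrite inE js orbT.
rewrite measureU //.
- rewrite -natr1 mulrDl mul1r (addrC (_ * c)) EFinD; apply: leeD.
    by apply: cF; rewrite inE eqxx.
  by apply: IH => //; [move=> j js; apply: mF|move=> j k js ks; apply: dF|
    move=> j js; apply: cF]; rewrite inE ?js ?ks orbT.
- by apply: mF; rewrite inE eqxx.
- rewrite -subset0 => x [Fix]; rewrite -bigcup_seq => -[j /= js Fjx].
  have : F i `&` F j = set0.
    apply: dF; rewrite ?inE ?eqxx ?js ?orbT //.
    by apply: contraNneq is_ => ->.
  by rewrite -subset0 => /(_ x); apply.
Qed.

Lemma measure_bigsetU_le d (T : measurableType d) (mu : {measure set T -> \bar R})
    (I : choiceType) (s : seq I) (F : I -> set T) (c : R) :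
  {in s, forall i, measurable (F i)} ->
  {in s, forall i, (mu (F i) <= c%:E)%E} ->
  (mu (\big[setU/set0]_(i <- s) F i) <= ((size s)%:R * c)%:E)%E.
Proof.
elim: s => [|i s IH] /=; first by rewrite big_nil mul0r measure0.
move=> mF cF; rewrite big_cons.
have ms : measurable (\big[setU/set0]_(i <- s) F i).
  rewrite big_seq; apply: bigsetU_measurable => j js.
  by apply: mF; rewrite inE js orbT.
apply: (@le_trans _ _ (mu (F i) + mu (\big[setU/set0]_(j <- s) F j))%E).
  by apply: measureU2 => //; apply: mF; rewrite inE eqxx.
rewrite -natr1 mulrDl mul1r (addrC (_ * c)) EFinD; apply: leeD.
  by apply: cF; rewrite inE eqxx.
by apply: IH => j js; [apply: mF|apply: cF]; rewrite inE js orbT.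
Qed.

End Packing.

Section Regular.
Context (R : realType) (M : metricType R).

Lemma borel_open (p : M) (U : set M) : open U -> measurable (U : set (borel p)).
Proof. by move=> oU; apply: sub_sigma_algebra. Qed.

Lemma fin_diam : compact [set: M] -> exists2 D : R, 0 <= D &
  diam [set: M] = D%:E.
Proof.
move=> /compact_bounded[D D0 bD].
have h : (diam [set: M] <= D%:E)%E by apply/diam_leP; [exact: ltW|].
have h0 := @diam_ge0 R M setT.
have := h0; rewrite -(@fineK _ (diam [set: M])); last first.
  by rewrite ge0_fin_numE // (le_lt_trans h) // ltry.
by rewrite lee_fin => f0; exists (fine (diam [set: M])).
Qed.

(** The balls of radius [r / 2] about the points of [s] are disjoint and lie in a ball of radius
    [2 * rho], so their number is at most a quotient of two masses. *)
Lemma ahlfors_packing (q : R) : compact [set: M] -> 0 < q ->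
  ahlfors_regular q M -> exists2 C : R, 1 <= C & packing (@mdist R M) q C.
Proof.
move=> cM q0 [p [mu [K [[finC _ _] K1 reg]]]].
have [D D0 dD] := fin_diam cM.
have leD (y z : M) : mdist y z <= D.
  by move: y z; apply: (fun H y z => (diam_leP setT D0).1 H y z Logic.I Logic.I); rewrite dD.
have K0 : 0 < K := lt_le_trans ltr01 K1.
pose m := fine (mu setT).
have muT : mu setT = m%:E by rewrite fineK // ge0_fin_numE // finC.
have m0 : 0 <= m by rewrite fine_ge0.
(* The three terms serve sequences of at most one point, radii with [2 * rho <= D], and larger
   radii, where regularity says nothing and the total mass [m] is used. *)
pose C := 1 + K * K * 4 `^ q + K * m * 4 `^ q / D `^ q.
have p4 : 0 <= 4 `^ q :> R by exact: powR_ge0.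
have e1 : 0 <= K * K * 4 `^ q by rewrite !mulr_ge0 // ltW.
have e2 : 0 <= K * m * 4 `^ q / D `^ q.
  by rewrite divr_ge0 ?powR_ge0 // !mulr_ge0 // ltW.
have C1 : 1 <= C by rewrite /C -addrA lerDl addr_ge0.
exists C => // x rho r s r0 rr us s1 s2.
have rho0 : 0 < rho := lt_le_trans r0 rr.
have rr1 : 1 <= rho / r by rewrite ler_pdivlMr // mul1r.
have rrq : 1 <= (rho / r) `^ q by rewrite -(powRr0 (rho / r)) ler_powR // ltW.
have [s_le1|s_gt1] := leqP (size s) 1.
  apply: (@le_trans _ _ 1); first by rewrite lern1.
  by rewrite -[1]mulr1 ler_pM.
have rD : r <= D.
  case: s us s2 s_gt1 {s1} => [|y [|z s]] //= /andP[yz _] s2 _.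
  apply: le_trans (s2 y z _ _ _) (leD _ _); rewrite ?inE ?eqxx ?orbT //.
  by apply: contraNneq yz => ->; rewrite inE eqxx.
have Dpos : 0 < D := lt_le_trans r0 rD.
have r2 : 0 < r / 2 by rewrite divr_gt0.
have c0 : 0 < K^-1 * (r / 2) `^ q by rewrite mulr_gt0 ?invr_gt0 ?powR_gt0.
have low := @measure_disjoint_ge R _ _ mu M s (fun y => ball y (r / 2))
  (K^-1 * (r / 2) `^ q) us.
have {}low : (((size s)%:R * (K^-1 * (r / 2) `^ q))%:E <=
    mu (\big[setU/set0]_(i <- s) ball i (r / 2)))%E.
  apply: low.
  - by move=> y _; by apply: borel_open; exact: open_mball.
  - move=> y z ys zs yz; rewrite -subset0 => w []; rewrite !mballE => h1 h2.
    have := s2 y z ys zs yz; rewrite leNgt => /negP; apply.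
    apply: le_lt_trans (metric_triangle _ w _) _; rewrite (splitr r) ltrD //.
    by rewrite metric_sym.
  - move=> y _; have := reg y (r / 2) r2; rewrite dD lee_fin.
    have -> : r / 2 <= D by apply: le_trans rD; rewrite ler_pdivrMr // ler_pMr // ler1n.
    by move=> /(_ isT)/andP[].
have mU : measurable (\big[setU/set0]_(i <- s) ball i (r / 2) : set (borel p)).
  rewrite -bigcup_seq; apply: borel_open; apply: bigcup_open => i _.
  exact: open_mball.
set U := \big[setU/set0]_(i <- s) ball i (r / 2) in low mU.
have UB : U `<=` ball x (2 * rho).
  move=> w; rewrite /U -bigcup_seq => -[y /= ys]; rewrite !mballE => yw.
  apply: le_lt_trans (metric_triangle _ y _) _.
  have := s1 y ys; lra.
set n := (size s)%:R in low *.
set w := (r / 2) `^ q in c0 low *.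
have w0 : 0 < w by rewrite powR_gt0.
have E4 : (2 * rho) `^ q = 4 `^ q * (rho / r) `^ q * w.
  rewrite /w -powRM ?divr_ge0 ?(ltW rho0) ?(ltW r0) // -powRM //.
  - by congr (_ `^ _); field; rewrite gt_eqF.
  - by rewrite mulr_ge0 // divr_ge0 ?(ltW rho0) ?(ltW r0).
  - exact: ltW.
have bnd B : (mu U <= B%:E)%E -> n <= B * K / w.
  move=> UB'; have := le_trans low UB'; rewrite lee_fin => h.
  rewrite ler_pdivlMr // -ler_pdivrMr //.
  by rewrite mulrAC -mulrA.
have [D2|D2] := leP (2 * rho) D.
  have {}bnd : n <= K * (2 * rho) `^ q * K / w.
    apply: bnd; apply: (@le_trans _ _ (mu (ball x (2 * rho)))).
      by apply: le_measure; rewrite ?inE //; by apply: borel_open; exact: open_mball.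
    have := reg x (2 * rho); rewrite dD lee_fin => /(_ _ D2).
    by rewrite mulr_gt0 // => /(_ isT)/andP[].
  apply: (le_trans bnd); rewrite E4 /C.
  have -> : K * (4 `^ q * (rho / r) `^ q * w) * K / w
    = K * K * 4 `^ q * (rho / r) `^ q by field; rewrite gt_eqF.
  by apply: ler_wpM2r; [exact: powR_ge0|rewrite addrAC lerDr addr_ge0].
have {}bnd : n <= m * K / w.
  apply: bnd; rewrite -muT; apply: le_measure; rewrite ?inE //.
apply: (le_trans bnd).
have Dq : 0 < D `^ q by rewrite powR_gt0.
have D2q : D `^ q <= 4 `^ q * (rho / r) `^ q * w.
  rewrite -E4; apply: ge0_ler_powR; rewrite ?nnegrE ?mulr_ge0 //; exact: ltW.
apply: (@le_trans _ _ (K * m * 4 `^ q / D `^ q * (rho / r) `^ q)); last first.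
  by apply: ler_wpM2r; [exact: powR_ge0|rewrite lerDr addr_ge0].
rewrite ler_pdivrMr //.
have -> : K * m * 4 `^ q / D `^ q * (rho / r) `^ q * w
  = m * K * ((4 `^ q * (rho / r) `^ q * w) / D `^ q) by field; rewrite gt_eqF.
by rewrite ler_peMr ?mulr_ge0 ?(ltW K0) // ler_pdivlMr // mul1r.
Qed.

(** Mass distribution principle: if [s < q], a cover with small sum of [diam^s] would carry less
    than the total mass. Each [E i] is put in an open set of mass at most [A * diam^s] plus an error
    summable in [i]; the error takes care of the sets of diameter zero. *)
Lemma ahlfors_le_hausdorff (q s : R) : compact [set: M] -> (exists x y : M, x != y) ->
  ahlfors_regular q M -> 0 < s -> hausdorff_measure M s = 0%E -> q <= s.
Proof.
move=> cM [x0 [y0 xy0]] [p [mu [K [_ K1 reg]]]] s0 H0.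
rewrite leNgt; apply/negP => sq.
have q0 : 0 < q := lt_trans s0 sq.
have [D D0 dD] := fin_diam cM.
have leD (y z : M) : mdist y z <= D.
  by move: y z; apply: (fun H y z => (diam_leP setT D0).1 H y z Logic.I Logic.I); rewrite dD.
have Dpos : 0 < D by apply: lt_le_trans (leD x0 y0); rewrite mdist_gt0.
have K0 : 0 < K := lt_le_trans ltr01 K1.
have [a a0 ha] : exists2 a : R, 0 < a & (a%:E <= mu setT)%E.
  exists (K^-1 * D `^ q); first by rewrite mulr_gt0 ?invr_gt0 ?powR_gt0.
  have := reg x0 D Dpos; rewrite dD // => /(_ (lexx _))/andP[+ _].
  move=> /le_trans; apply.
  by apply: le_measure => //; rewrite inE; [apply: borel_open; exact: open_mball|exact: measurableT].
pose A := K * 2 `^ q * (D / 2) `^ (q - s).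
have A0 : 0 < A by rewrite !mulr_gt0 ?powR_gt0 // divr_gt0.
(* A set of diameter at most [D / 2] lies in a ball of radius at most [D], where regularity
   applies. *)
have cont : (hausdorff_content M (D / 2) s = 0)%E.
  apply/eqP; rewrite eq_le; apply/andP; split.
    rewrite -H0; apply: ereal_sup_ubound; exists (D / 2) => //=.
    by rewrite divr_gt0.
  apply: le_ereal_inf_tmp => _ [E _ <-]; apply: nneseries_ge0 => n _ _.
  exact: poweR_ge0.
have e0 : 0 < a / (A + 2) by rewrite divr_gt0 // addr_gt0.
set e := a / (A + 2) in e0.
have : (hausdorff_content M (D / 2) s < e%:E)%E by rewrite cont lte_fin.
move=> /ereal_inf_lt[_ [E [Ed Ec] <-]] Ee.
have ball_le (x : M) r : 0 < r -> r <= D -> (mu (ball x r) <= (K * r `^ q)%:E)%E.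
  move=> r0 rD; have := reg x r r0; rewrite dD lee_fin => /(_ rD).
  by move=> /andP[].
have O i : exists U : set M, [/\ open U, E i `<=` U &
    (mu U <= A%:E * diam (E i) `^ s + (e / (2 ^ i.+1)%:R)%:E)%E].
  have e'0 : 0 < e / (2 ^ i.+1)%:R by rewrite divr_gt0 // ltr0n expn_gt0.
  have [Ei0|/set0P[x Eix]] := eqVneq (E i) set0.
    exists set0; split; [exact: open0|by rewrite Ei0|].
    rewrite measure0; apply: adde_ge0; last by rewrite lee_fin ltW.
    by apply: mule_ge0; [rewrite lee_fin ltW|exact: poweR_ge0].
  have [t [dt t0 tD]] : exists t : R, [/\ diam (E i) = t%:E, 0 <= t & t <= D / 2].
    have f : diam (E i) \is a fin_num.
      by rewrite ge0_fin_numE ?diam_ge0 // (le_lt_trans (Ed i)) // ltry.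
    exists (fine (diam (E i))); rewrite fineK //; split => //.
      by rewrite fine_ge0 // diam_ge0.
    by rewrite -lee_fin fineK.
  have Et y : E i y -> mdist x y <= t.
    by move=> Eiy; rewrite -lee_fin -dt; exact: mdist_le_diam.
  have sub r : t < r -> E i `<=` ball x r.
    by move=> tr y /Et h; rewrite mballE (le_lt_trans h).
  move: t0; rewrite le_eqVlt => /orP[/eqP t0|t0].
    pose r := Num.min D ((e / (2 ^ i.+1)%:R / K) `^ q^-1).
    have r0 : 0 < r by rewrite lt_min Dpos powR_gt0 // divr_gt0.
    exists (ball x r); split; [exact: open_mball|by apply: sub; rewrite -t0|].
    apply: le_trans (ball_le x r r0 _) _; first by rewrite ge_min lexx.
    rewrite dt -t0 poweR0r ?gt_eqF // mule0 add0e lee_fin.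
    rewrite -ler_pdivlMl // mulrC.
    have -> : e / (2 ^ i.+1)%:R / K = ((e / (2 ^ i.+1)%:R / K) `^ q^-1) `^ q.
      by rewrite -powRrM mulVf ?gt_eqF // powRr1 // divr_ge0 // ltW.
    apply: ge0_ler_powR; rewrite ?nnegrE ?powR_ge0 ?(ltW r0) ?(ltW q0) //.
    by rewrite ge_min lexx orbT.
  have t2 : 0 < 2 * t by rewrite mulr_gt0.
  have t2D : 2 * t <= D by move: tD; lra.
  exists (ball x (2 * t)); split; [exact: open_mball|apply: sub; lra|].
  apply: le_trans (ball_le x _ t2 t2D) _.
  apply: (@le_trans _ _ (A%:E * diam (E i) `^ s)%E); last first.
    by rewrite leeDl // lee_fin ltW.
  rewrite dt poweR_EFin -EFinM lee_fin /A.
  have -> : (2 * t) `^ q = 2 `^ q * t `^ q by rewrite powRM // ltW.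
  rewrite -!mulrA ler_pM2l // ler_pM2l ?powR_gt0 //.
  have -> : t `^ q = t `^ (q - s) * t `^ s by rewrite -powRD ?subrK // gt_eqF ?implybT.
  apply: ler_wpM2r; first exact: powR_ge0.
  apply: ge0_ler_powR; rewrite ?nnegrE ?subr_ge0 ?divr_ge0 //; exact: ltW.
pose U i := projT1 (cid (O i)).
have oU i : open (U i) by rewrite /U; case: cid => V [].
have sU i : E i `<=` U i by rewrite /U; case: cid => V [].
have mU i : (mu (U i) <= A%:E * diam (E i) `^ s + (e / (2 ^ i.+1)%:R)%:E)%E.
  by rewrite /U; case: cid => V [].
have : (a%:E <= A%:E * e%:E + e%:E)%E.
  apply: (le_trans ha).
  apply: (@le_trans _ _ (\sum_(0 <= i <oo) mu (U i))%E).
    apply: measure_sigma_subadditive => //.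
      by move=> i; apply: (@borel_open p); exact: oU.
    move=> x _; have : (\bigcup_i E i) x by rewrite Ec.
    by move=> [i _ Eix]; exists i => //; exact: sU.
  apply: (@le_trans _ _ (\sum_(0 <= i <oo)
      (A%:E * diam (E i) `^ s + (e / (2 ^ i.+1)%:R)%:E))%E).
    by apply: lee_nneseries.
  apply: le_trans (epsilon_trick _ _ _) _.
  - move=> n; rewrite mule_ge0 ?lee_fin ?(ltW A0) //; exact: poweR_ge0.
  - exact: ltW.
  rewrite leeD2r // nneseriesZl; last by move=> n _; exact: poweR_ge0.
  by rewrite lee_pmul2l // ltW.
rewrite -EFinM -EFinD lee_fin; apply/negP; rewrite -ltNge.
rewrite -{2}(mul1r e) -mulrDl /e mulrCA -[ltRHS]mulr1 ltr_pM2l //.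
by rewrite ltr_pdivrMr ?mul1r ?ltrD2l ?ltr1n // addr_gt0.
Qed.

(** A net of scale [r] has at most [C * ((D + 1) / r)^q] points, so the cover by its balls has an
    [s]-sum of order [r^(s - q)], which tends to 0 with [r]. *)
Lemma packing_hausdorff (q C : R) : 0 <= q -> compact [set: M] -> [set: M] !=set0 ->
  packing (@mdist R M) q C -> (hausdorff_dim M <= q%:E)%E.
Proof.
move=> q0 cM [x0 _] pk; have [D D0 bD] := compact_bounded cM.
suff main s : q < s -> hausdorff_measure M s = 0%E.
  apply/lee_addgt0Pr => e e0; apply: ereal_inf_lbound; exists (q + e) => //=.
  split; first exact: ltr_wpDl.
  by apply: main; rewrite ltrDl.
move=> qs; have s0 : 0 < s := le_lt_trans q0 qs.
apply/eqP; rewrite eq_le; apply/andP; split; last first.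
  apply: ereal_sup_ge; exists (hausdorff_content M 1 s); first by exists 1 => /=.
  apply: le_ereal_inf_tmp => _ [E _ <-]; apply: nneseries_ge0 => n _ _.
  exact: poweR_ge0.
apply: ge_ereal_sup => _ [delta /= d0 <-].
apply/lee_addgt0Pr => e e0; rewrite add0e.
pose B := `|C| * (D + 1) `^ q * 2 `^ s + 1.
have D1 : 0 < D + 1 by rewrite addr_gt0.
have B0 : 0 < B by rewrite ltr_wpDl // !mulr_ge0 ?powR_ge0.
pose r := Num.min (Num.min (delta / 2) (D + 1)) ((e / B) `^ (s - q)^-1).
have sq0 : 0 < s - q by rewrite subr_gt0.
have r0 : 0 < r by rewrite !lt_min D1 divr_gt0 //= powR_gt0 // divr_gt0.
have r1 : r <= delta / 2 by rewrite !ge_min lexx.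
have r2 : r <= D + 1 by rewrite !ge_min lexx orbT.
have r3 : B * r `^ (s - q) <= e.
  rewrite -ler_pdivlMl // mulrC.
  have -> : e / B = ((e / B) `^ (s - q)^-1) `^ (s - q).
    by rewrite -powRrM mulVf ?gt_eqF // powRr1 // divr_ge0 // ltW.
  apply: ge0_ler_powR; rewrite ?nnegrE ?powR_ge0 ?(ltW r0) ?(ltW sq0) //.
  by rewrite ge_min lexx orbT.
have [||t [ut _ tt td]] := packing_net pk bD r0 (s := [::]) => //.
pose E i := if (i < size t)%N then ball (nth x0 t i) r else set0.
have dE i : (diam (E i) <= (2 * r)%:E)%E.
  apply/diam_leP; first by rewrite mulr_ge0 // ltW.
  rewrite /E; case: ifP => // _ x y; rewrite !mballE => h1 h2.
  apply: le_trans (metric_triangle _ (nth x0 t i) _) _.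
  by rewrite metric_sym mulr2n mulrDl mul1r lerD // ltW.
apply: (@le_trans _ _ (\sum_(0 <= i <oo) diam (E i) `^ s)%E).
  apply: ereal_inf_lbound; exists E => //; split.
    by move=> i; apply: le_trans (dE i) _; rewrite lee_fin; lra.
  apply/seteqP; split => // x _; have [y yt xy] := td x.
  exists (index y t) => //; rewrite /E index_mem yt nth_index // mballE.
  by rewrite metric_sym.
rewrite (nneseries_split 0 (size t)); last by move=> *; exact: poweR_ge0.
rewrite eseries0 ?adde0; last first.
  move=> i; rewrite add0n => ti _; rewrite /E ltnNge ti /=.
  suff -> : diam (@set0 M) = 0%E by rewrite poweR0r // gt_eqF.
  apply/eqP; rewrite eq_le diam_ge0 andbT.
  by apply/diam_leP.
rewrite add0n big_mkord.
apply: (@le_trans _ _ (\sum_(i < size t) ((2 * r) `^ s)%:E)%E).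
  apply: lee_sum => i _; rewrite -poweR_EFin; apply: gt0_ler_poweR.
  - exact: ltW.
  - by rewrite in_itv /= diam_ge0 leey.
  - by rewrite in_itv /= leey lee_fin mulr_ge0 // ltW.
  - exact: dE.
rewrite sumEFin lee_fin big_const_ord iter_addr addr0 -[_ *+ size t]mulr_natl.
have sz : (size t)%:R <= C * ((D + 1) / r) `^ q.
  apply: (pk x0) => // y _; apply: le_lt_trans (bD _ _) _; by rewrite ltrDl.
apply: le_trans r3.
apply: (@le_trans _ _ (`|C| * ((D + 1) / r) `^ q * (2 * r) `^ s)).
  rewrite ler_wpM2r ?powR_ge0 //; apply: le_trans sz _; apply: ler_wpM2r; [exact: powR_ge0|exact: ler_norm].
have rq : r `^ s = r `^ (s - q) * r `^ q by rewrite -powRD ?subrK // gt_eqF ?implybT.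
rewrite powRM ?(ltW D1) ?invr_ge0 ?(ltW r0) // powRM ?(ltW r0) //.
have -> : r^-1 `^ q = (r `^ q)^-1 by rewrite -(powRN r) -(powR_inv1 (ltW r0)) -powRrM mulN1r.
rewrite rq /B mulrDl mul1r.
have rq0 : 0 < r `^ q by exact: powR_gt0.
have -> : `|C| * ((D + 1) `^ q / r `^ q) * (2 `^ s * (r `^ (s - q) * r `^ q))
  = `|C| * (D + 1) `^ q * 2 `^ s * r `^ (s - q).
  by field; rewrite gt_eqF.
by rewrite lerDl powR_ge0.
Qed.

End Regular.

(** * Dependent choice, geometric scales and partial sums *)

Section Nets.
Context (R : realType).

Lemma dependent_choice_nat (T : Type) (P : nat -> T -> Prop)
    (Q : nat -> T -> T -> Prop) (t0 : T) :
  P 0%N t0 -> (forall k t, P k t -> exists2 t', P k.+1 t' & Q k t t') ->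
  exists f : nat -> T, [/\ f 0%N = t0, forall k, P k (f k) &
    forall k, Q k (f k) (f k.+1)].
Proof.
move=> P0 PS.
pose g k (u : {t | P k t}) : {t' | P k.+1 t' & Q k (sval u) t'} :=
  cid2 (PS k (sval u) (svalP u)).
pose F := fix F k : {t | P k t} :=
  if k is k'.+1 then exist (P k'.+1) (s2val (g k' (F k'))) (s2valP (g k' (F k')))
  else exist (P 0%N) t0 P0.
exists (fun k => sval (F k)); split => //.
- by move=> k; exact: svalP.
- by move=> k; exact: (s2valP' (g k (F k))).
Qed.

Lemma exists_geom_lt (L a r : R) : 2 <= L -> 0 < a -> 0 < r ->
  exists k : nat, a / L ^+ k < r.
Proof.
move=> L2 a0 r0; have L0 : 0 < L by apply: lt_le_trans L2; rewrite ltr0n.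
have ra : 0 < r / a by rewrite divr_gt0.
have [N _ H] := near_infty_natSinv_lt (PosNum ra).
exists N; apply: (@le_lt_trans _ _ (a * N.+1%:R^-1)); last first.
  by rewrite mulrC -ltr_pdivlMr //; exact: (H N (leqnn N)).
rewrite ler_pM2l // lef_pV2 ?posrE ?exprn_gt0 //.
have : (N.+1 <= 2 ^ N)%N by exact: ltn_expl.
rewrite -(ler_nat R) => /le_trans; apply; rewrite natrX.
by apply: lerXn2r; rewrite ?nnegrE ?(ltW L0).
Qed.

(** Half-open intervals of lengths [F y] are laid end to end from [u] on. This locates [t] in one of
    them, and [prefix_sum_inj] shows that there is only one; they will be the cells of the children
    of a net point. *)
Lemma prefix_sum (T : eqType) (F : T -> R) (s : seq T) (u t : R) : uniq s ->
  u <= t -> t < u + \sum_(z <- s) F z ->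
  exists2 y, y \in s & u + \sum_(z <- take (index y s) s) F z <= t
    < u + \sum_(z <- take (index y s) s) F z + F y.
Proof.
elim: s u => [|a s IH] u /=; first by rewrite big_nil addr0 => _ /le_lt_trans/[apply]; rewrite ltxx.
move=> /andP[as_ us] ut; rewrite big_cons addrA => tu.
have [tua|uat] := ltP t (u + F a).
  by exists a; rewrite ?inE eqxx //= big_nil addr0 ut.
have [y ys H] := IH (u + F a) us uat tu; exists y; first by rewrite inE ys orbT.
have -> : a == y = false by apply/negbTE; apply: contraNneq as_ => ->.
by rewrite /= big_cons addrA.
Qed.

Lemma prefix_sum_le (T : eqType) (F : T -> R) (s : seq T) (y : T) :
  (forall z, 0 <= F z) -> y \in s ->
  \sum_(z <- take (index y s) s) F z + F y <= \sum_(z <- s) F z.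
Proof.
move=> F0; elim: s => // a s IH; rewrite inE /=.
case: (eqVneq a y) => [-> _ | ay].
  by rewrite big_nil add0r big_cons lerDl sumr_ge0.
move=> /= ys; rewrite !big_cons -addrA lerD2l.
exact: IH.
Qed.

Lemma prefix_sum_inj (T : eqType) (F : T -> R) (s : seq T) (u t : R) (y y' : T) :
  (forall z, 0 <= F z) -> y \in s -> y' \in s ->
  u + \sum_(z <- take (index y s) s) F z <= t
    < u + \sum_(z <- take (index y s) s) F z + F y ->
  u + \sum_(z <- take (index y' s) s) F z <= t
    < u + \sum_(z <- take (index y' s) s) F z + F y' -> y = y'.
Proof.
move=> F0; elim: s u => // a s IH u; rewrite !inE /=.
have [->|ay] := eqVneq a y; have [<-|ay'] := eqVneq _ y' => //=.
- move=> /= _ ys'; rewrite big_nil addr0 big_cons addrA.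
  move=> /andP[_ h1] /andP[h2 _]; have := lt_le_trans h1 (le_trans _ h2).
  rewrite ltxx => H; exfalso; suff: false by [].
  apply: H; rewrite lerDl; exact: sumr_ge0.
- move=> /= ys _; rewrite big_nil addr0 big_cons addrA.
  move=> /andP[h2 _] /andP[_ h1]; have := lt_le_trans h1 (le_trans _ h2).
  rewrite ltxx => H; exfalso; suff: false by [].
  apply: H; rewrite lerDl; exact: sumr_ge0.
- move=> /= ys ys'.
  by rewrite !big_cons !addrA; exact: IH.
Qed.

End Nets.

(** * A homogeneous measure *)

Section NestedNets.
Context (R : realType) (M : metricType R).
Variables (p q C D L : R) (x0 : M).
Hypothesis cM : compact [set: M].
Hypotheses (p0 : 0 <= p) (C1 : 1 <= C) (D0 : 0 < D) (L16 : 16 <= L).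
Hypothesis CL : C * L `^ p <= L `^ q.
Hypothesis pk : packing (@mdist R M) p C.
Hypothesis bD : forall x y : M, mdist x y < D.

Let eps k : R := D / L ^+ k.
Let L0 : 0 < L. Proof. by apply: lt_le_trans L16; rewrite ltr0n. Qed.
Let eps0 k : 0 < eps k. Proof. by rewrite divr_gt0 // exprn_gt0. Qed.
Let epsS k : eps k.+1 = eps k / L.
Proof. by rewrite /eps exprS; field; rewrite ?expf_neq0 gt_eqF. Qed.
Let eps16 k : 16 * eps k.+1 <= eps k.
Proof. by rewrite epsS mulrCA ler_piMr ?(ltW (eps0 k)) // ler_pdivrMr // mul1r. Qed.

Lemma nested_nets : exists net : nat -> seq M,
  [/\ net 0%N = [:: x0],
    forall k, [/\ uniq (net k),
      {in net k &, forall y z, y != z -> eps k <= mdist y z} &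
      forall x, exists2 y, y \in net k & mdist x y < eps k] &
    forall k, {subset net k <= net k.+1}].
Proof.
pose P k (s : seq M) := [/\ uniq s,
  {in s &, forall y z, y != z -> eps k <= mdist y z} &
  forall x, exists2 y, y \in s & mdist x y < eps k].
apply: (@dependent_choice_nat (seq M) P (fun _ s t => {subset s <= t}) [:: x0]).
  split => //; first by move=> y z; rewrite !inE => /eqP -> /eqP ->; rewrite eqxx.
  by move=> x; exists x0; rewrite ?inE // /eps expr0 divr1.
move=> k s [us ss _].
have [|t [ut st tt td]] := packing_net pk (fun x y => ltW (bD x y)) (eps0 k.+1) us.
  move=> y z ys zs yz; apply: le_trans (ss y z ys zs yz).
  by have := eps16 k; have := eps0 k.+1; lra.
by exists t.
Qed.

Variable net : nat -> seq M.
Hypothesis net0 : net 0%N = [:: x0].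
Hypothesis netP : forall k, [/\ uniq (net k),
      {in net k &, forall y z, y != z -> eps k <= mdist y z} &
      forall x, exists2 y, y \in net k & mdist x y < eps k].
Hypothesis netS : forall k, {subset net k <= net k.+1}.

(** A net point closer than half the separation is unique and is preferred as parent. Hence a net
    point is its own parent, and a point near it has the same parent, which [mass_neighbors]
    needs. *)
Lemma parents : exists par : nat -> M -> M, forall k y,
  [/\ par k y \in net k, mdist y (par k y) < eps k &
    forall x, x \in net k -> mdist y x < eps k / 2 -> par k y = x].
Proof.
suff H (ky : nat * M) : exists z, [/\ z \in net ky.1, mdist ky.2 z < eps ky.1 &
    forall x, x \in net ky.1 -> mdist ky.2 x < eps ky.1 / 2 -> z = x].
  by have [f fP] := choice H; exists (fun k y => f (k, y)) => k y; exact: (fP (k, y)).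
case: ky => k y /=; have [_ sk dk] := netP k.
have [[z zk yz]|nz] := pselect (exists2 z, z \in net k & mdist y z < eps k / 2).
  exists z; split => //; first by have := eps0 k; lra.
  move=> x xk yx; apply/eqP/negPn/negP => zx.
  have := sk z x zk xk zx; have := metric_triangle z y x; rewrite (metric_sym z y); lra.
have [z zk yz] := dk y; exists z; split => // x xk yx.
by exfalso; apply: nz; exists x.
Qed.

Variable par : nat -> M -> M.
Hypothesis parP : forall k y, [/\ par k y \in net k, mdist y (par k y) < eps k &
    forall x, x \in net k -> mdist y x < eps k / 2 -> par k y = x].

Let par_id k y : y \in net k -> par k y = y.
Proof.
by move=> yk; have [_ _] := parP k y; apply => //; rewrite mdistxx divr_gt0.
Qed.

(* Every child carries the fraction L^-q of the mass of its parent, except the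
   central one, which takes what is left. The central child is at least as heavy
   as the others, and the masses of neighbouring net points differ by at most the
   factor L^q. *)
Let w : R := L `^ (- q).
Let w0 : 0 < w. Proof. exact: powR_gt0. Qed.
Let kids k x := [seq y <- net k.+1 | par k y == x].
Let nk k x : R := (size (kids k x))%:R.
Let wt k y : R := if y \in net k then 1 - (nk k y - 1) * w else w.
Fixpoint mass k y : R := if k is k'.+1 then mass k' (par k' y) * wt k' y else 1.

(** Packing between the scales [eps k] and [eps k.+1], whose ratio is [L], allows at most [C * L^p]
    children, hence at most [L^q] by [CL]. Therefore the central child keeps at least the fraction
    [w]. *)
Let nk_le k x : nk k x * w <= 1.
Proof.
rewrite /w powRN ler_pdivrMr ?powR_gt0 // mul1r; apply: le_trans CL.
have LE : L = eps k / eps k.+1.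
  by rewrite epsS; field; rewrite !gt_eqF.
rewrite [X in X `^ p]LE; apply: (pk (x := x)) => //.
- have := eps16 k; have := eps0 k.+1; lra.
- by rewrite filter_uniq //; have [] := netP k.+1.
- move=> y; rewrite mem_filter => /andP[/eqP <- _]; rewrite metric_sym.
  by have [] := parP k y.
- move=> y z; rewrite !mem_filter => /andP[_ yk] /andP[_ zk].
  by have [_ + _] := netP k.+1; apply.
Qed.

Let wt_ge k y : w <= wt k y.
Proof.
rewrite /wt; case: ifP => // _; have := nk_le k y; lra.
Qed.
Let wt_le k y : y \in net k -> wt k y <= 1.
Proof.
move=> yk; rewrite /wt yk; have : 0 <= (nk k y - 1) * w; last by lra.
rewrite mulr_ge0 ?(ltW w0) // subr_ge0 /nk ler1n.
rewrite lt0n size_eq0; apply/eqP => E.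
have : y \in kids k y by rewrite mem_filter par_id // eqxx netS.
by rewrite E.
Qed.

Lemma mass_gt0 k y : 0 < mass k y.
Proof.
elim: k y => [|k IH] y //=; rewrite mulr_gt0 //.
exact: lt_le_trans w0 (wt_ge k y).
Qed.

Let w1 : w <= 1.
Proof. by have := wt_ge 0 x0; have := @wt_le 0 x0; rewrite net0 inE eqxx => /(_ isT); lra. Qed.

Let wt_le1 k y : wt k y <= 1.
Proof.
by have [|n] := boolP (y \in net k); [exact: wt_le|rewrite /wt (negbTE n) w1].
Qed.

Lemma mass_kids k x : x \in net k ->
  \sum_(y <- kids k x) mass k.+1 y = mass k x.
Proof.
move=> xk.
have xkids : x \in kids k x by rewrite mem_filter par_id // eqxx netS.
have uk : uniq (kids k x) by rewrite filter_uniq //; have [] := netP k.+1.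
rewrite (big_rem x) //= par_id // /wt xk.
rewrite (eq_big_seq (fun=> mass k x * w)); last first.
  move=> y; rewrite mem_rem_uniq // inE mem_filter => /andP[yx /andP[/eqP yk _]].
  rewrite yk ifF //; apply: contraNF yx => ynk.
  by rewrite -yk par_id.
rewrite big_const_seq count_predT iter_addr addr0 size_rem //.
rewrite -mulr_natr -mulrA -mulrDr -[RHS]mulr1; congr (_ * _).
have -> : (size (kids k x)).-1%:R = nk k x - 1 :> R.
  rewrite /nk; case: (kids k x) xkids => // a s _ /=.
  by rewrite -natr1 addrK.
ring.
Qed.

(** With a common parent it suffices that all fractions lie between [w] and 1. If the parents
    differ, neither point is a central child, since the other one would then be within [eps k / 2]
    of it and have it as parent. Both fractions are then [w], and the parents are again less than
    [8 * eps k] apart, so that nothing is lost in the induction. *)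
Lemma mass_neighbors k y y' : y \in net k -> y' \in net k ->
  mdist y y' < 8 * eps k -> w * mass k y <= mass k y'.
Proof.
elim: k y y' => [|k IH] y y'.
  by rewrite net0 !inE => /eqP -> /eqP ->; rewrite /= mulr1 w1.
move=> yk yk' yy'.
have [P1 P2 P3] := parP k y; have [P1' P2' P3'] := parP k y'.
have e16 := eps16 k.
have [E|NE] := eqVneq (par k y) (par k y').
  rewrite /= E mulrCA ler_pM2l ?mass_gt0 //.
  apply: le_trans (wt_ge k y'); rewrite ler_piMr ?(ltW w0) //; exact: wt_le1.
have nyk : y \notin net k.
  apply: contraNN NE => ynk; rewrite par_id //; apply/eqP/esym/P3' => //.
  by rewrite metric_sym; lra.
have nyk' : y' \notin net k.
  apply: contraNN NE => ynk'; rewrite (par_id ynk'); apply/eqP/P3 => //; lra.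
rewrite /= /wt (negbTE nyk) (negbTE nyk') mulrA ler_pM2r //.
apply: IH => //.
apply: le_lt_trans (metric_triangle _ y _) _; rewrite (metric_sym (par k y)).
have := metric_triangle y y' (par k y'); have := eps0 k; lra.
Qed.

(** The distances to successive ancestors form a geometric series; the term [- 2 * eps (j + i)]
    makes the induction close. *)
Lemma mass_ancestor i j y : y \in net (j + i)%N ->
  exists z, [/\ z \in net j, mdist y z <= 2 * eps j - 2 * eps (j + i)%N &
    w ^+ i * mass j z <= mass (j + i)%N y].
Proof.
elim: i y => [|i IH] y.
  by rewrite addn0 => yj; exists y; rewrite mdistxx subrr expr0 mul1r.
rewrite addnS => yk; have [P1 P2 P3] := parP (j + i) y.
have [z [zj z1 z2]] := IH _ P1; exists z; split => //.
  have := metric_triangle y (par (j + i) y) z.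
  have := eps16 (j + i); have := eps0 (j + i).+1; lra.
rewrite exprSr mulrAC /= ler_pM ?mulr_ge0 ?exprn_ge0 ?(ltW w0) //.
exact/ltW/mass_gt0.
Qed.

(* The masses are realized as lengths of nested intervals of [0, 1[, and mu is the
   image of Lebesgue measure under the map F sending t to the limit of the net
   points whose intervals contain t. *)
Fixpoint pos k y : R := if k is k'.+1 then
  let ks := kids k' (par k' y) in
  pos k' (par k' y) + \sum_(z <- take (index y ks) ks) mass k'.+1 z else 0.

Lemma posS k y : pos k.+1 y = pos k (par k y) +
  \sum_(z <- take (index y (kids k (par k y))) (kids k (par k y))) mass k.+1 z.
Proof. by []. Qed.

Definition cell k y : set R := [set t | pos k y <= t < pos k y + mass k y].

Lemma cell_par k y : y \in net k.+1 -> cell k.+1 y `<=` cell k (par k y).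
Proof.
move=> yk t /= /andP[t1 t2]; have [P1 _ _] := parP k y.
have yks : y \in kids k (par k y) by rewrite mem_filter eqxx.
have h := prefix_sum_le (fun z => ltW (mass_gt0 k.+1 z)) yks.
rewrite mass_kids // in h.
apply/andP; split.
  by apply: le_trans t1; rewrite lerDl sumr_ge0 // => z _; exact/ltW/(mass_gt0 k.+1).
by apply: lt_le_trans t2 _; rewrite -addrA lerD2l.
Qed.

Lemma cell_ex k t : 0 <= t < 1 -> exists2 y, y \in net k & cell k y t.
Proof.
move=> t01; elim: k => [|k [x xk /= /andP[t1 t2]]].
  by exists x0; rewrite ?net0 ?inE //= /cell /= add0r.
have uk : uniq (kids k x) by rewrite filter_uniq //; have [] := netP k.+1.
rewrite -(mass_kids xk) in t2.
have [y yx H] := prefix_sum uk t1 t2.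
move: (yx); rewrite mem_filter => /andP[/eqP E yk]; exists y => //.
by rewrite /cell /mkset posS E.
Qed.

Lemma cell_inj k t y y' : y \in net k -> y' \in net k ->
  cell k y t -> cell k y' t -> y = y'.
Proof.
elim: k y y' => [|k IH] y y'; first by rewrite net0 !inE => /eqP -> /eqP ->.
move=> yk yk' c c'.
have [P1 _ _] := parP k y; have [P1' _ _] := parP k y'.
have E := IH _ _ P1 P1' (cell_par yk c) (cell_par yk' c').
move: c c'; rewrite /cell /mkset !posS E; apply: prefix_sum_inj.
- by move=> z; exact/ltW/(mass_gt0 k.+1).
- by rewrite mem_filter E eqxx.
- by rewrite mem_filter eqxx.
Qed.

Lemma cell01 k y : y \in net k -> cell k y `<=` [set t | 0 <= t < 1].
Proof.
elim: k y => [|k IH] y yk; last first.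
  by apply: subset_trans (cell_par yk) (IH _ _); have [] := parP k y.
by rewrite /cell /= add0r.
Qed.

(** The net points whose cells contain [t] move by geometrically small steps, and compactness gives
    a cluster point. Outside the unit interval [x0] is a mere default that makes [F] total. *)
Lemma coding_map : exists F : R -> M,
  (forall t, ~~ (0 <= t < 1) -> F t = x0) /\
  forall k y t, y \in net k -> cell k y t -> mdist y (F t) <= 2 * eps k.
Proof.
suff H t : exists x, (~~ (0 <= t < 1) -> x = x0) /\
    forall k y, y \in net k -> cell k y t -> mdist y x <= 2 * eps k.
  have [F FP] := choice H; exists F; split; first by move=> t; exact: (FP t).1.
  by move=> k y t; exact: (FP t).2.
have [t01|nt] := boolP (0 <= t < 1); last first.
  exists x0; split => // k y yk /(cell01 yk) /= t01; by rewrite t01 in nt.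
have [f fP] : exists f : nat -> M, forall k, f k \in net k /\ cell k (f k) t.
  have H k : exists y, y \in net k /\ cell k y t.
    by have [y yk c] := cell_ex k t01; exists y.
  by have [f fP] := choice H; exists f.
have fS k i : mdist (f k) (f (k + i)%N) <= 2 * eps k - 2 * eps (k + i)%N.
  elim: i => [|i IH]; first by rewrite addn0 mdistxx subrr.
  rewrite addnS; have [f1 f2] := fP (k + i)%N.+1; have [f3 f4] := fP (k + i)%N.
  have [P1 P2 _] := parP (k + i) (f (k + i).+1).
  have E := cell_inj P1 f3 (cell_par f1 f2) f4; rewrite E metric_sym in P2.
  have := metric_triangle (f k) (f (k + i)%N) (f (k + i).+1).
  have := eps16 (k + i); have := eps0 (k + i).+1; lra.
have [x xP] := compact_cluster_seq f cM.
exists x; split => // k y yk c; have [f1 f2] := fP k.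
have -> := cell_inj yk f1 c f2.
apply/ler_addgt0Pr => e e0; have [n kn xn] := xP e k e0.
have := fS k (n - k)%N; rewrite subnKC // => h.
have := metric_triangle (f k) (f n) x; rewrite (metric_sym (f n)).
have := eps0 n; lra.
Qed.

Lemma cell_lebesgue k y : lebesgue_measure (cell k y : set R) = (mass k y)%:E.
Proof.
have -> : cell k y = `[pos k y, pos k y + mass k y[%classic.
  by apply/seteqP; split => t; rewrite /cell /= in_itv.
rewrite lebesgue_measure_itv /= lte_fin ltrDl mass_gt0 -EFinB.
by rewrite addrAC subrr add0r.
Qed.

Lemma cell_measurable k y : measurable (cell k y : set (measurableTypeR R)).
Proof.
have -> : cell k y = `[pos k y, pos k y + mass k y[%classic.
  by apply/seteqP; split => t; rewrite /cell /= in_itv.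
exact: measurable_itv.
Qed.

(** [F] is measurable because, within the unit interval, the preimage of an open set is the
    countable union of the cells of those net points whose closed [2 * eps k]-ball lies in the set.
    A ball then contains the mass of every net point deep inside it, and is exhausted by the masses
    of the net points near it. *)
Lemma limit_measure : exists mu : {measure set (borel x0) -> \bar R},
  [/\ mu setT = 1%E,
   forall k x r y, y \in net k -> mdist x y + 2 * eps k < r ->
     ((mass k y)%:E <= mu (ball x r))%E &
   forall k x r c, (forall y, y \in net k -> mdist x y < r + 2 * eps k -> mass k y <= c) ->
     (mu (ball x r) <= ((size [seq y <- net k | mdist x y < r + 2 * eps k])%:R * c)%:E)%E].
Proof.
have [F [F0 FP]] := coding_map.
pose I01 : set R := `[0, 1[%classic.
have I01E : I01 = [set t | 0 <= t < 1].
  by apply/seteqP; split => t; rewrite /I01 /= in_itv.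
have mI : measurable (I01 : set (measurableTypeR R)) by exact: measurable_itv.
have mF : measurable_fun [set: measurableTypeR R] (F : measurableTypeR R -> borel x0).
  apply: (measurability (@open M : set (set (borel x0)))) => // _ [U oU <-].
  rewrite setTI.
  pose good k y := (y \in net k) && `[< forall z, mdist y z <= 2 * eps k -> U z >].
  have -> : F @^-1` U = (if `[< U x0 >] then ~` I01 else set0) `|`
      \bigcup_k \big[setU/set0]_(y <- [seq y <- net k | good k y]) cell k y.
    apply/seteqP; split => t /=.
      have [t01|nt] := boolP (0 <= t < 1); last first.
        move=> UF; left; rewrite -(F0 t nt) (asboolT UF) I01E /=; exact/negP.
      move=> UF; right; have [r r0 rU] := (open_mdistP U).1 oU _ UF.
      have [k k5] : exists k, 5 * eps k < r.
        have L2 : 2 <= L by apply: le_trans L16; rewrite ler_nat.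
        have [|k kr] := exists_geom_lt L2 D0 (r := r / 5); first by rewrite divr_gt0.
        by exists k; rewrite mulrC -ltr_pdivlMr.
      have [y yk c] := cell_ex k t01.
      exists k => //; rewrite -bigcup_seq; exists y => //=.
      rewrite mem_filter /good yk andbT /=; apply/asboolP => z yz; apply: rU.
      apply: le_lt_trans (metric_triangle _ y _) _; rewrite metric_sym.
      have := FP k y t yk c; have := eps0 k; lra.
    move=> [|[k _]].
      case: ifP => // /asboolP Ux0; rewrite I01E => /negP nt.
      by rewrite F0.
    rewrite -bigcup_seq => -[y /=]; rewrite mem_filter => /andP[/andP[yk /asboolP H] _] c.
    exact: H (FP k y t yk c).
  apply: measurableU; first by case: ifP => _; [exact: measurableC|exact: measurable0].
  apply: bigcupT_measurable => k; apply: bigsetU_measurable => y _.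
  exact: cell_measurable.
pose leb : {measure set (measurableTypeR R) -> \bar R} := mrestr (@lebesgue_measure R) mI.
pose mu : {measure set (borel x0) -> \bar R} :=
  measure_function_pushforward__canonical__measure_function_Measure leb mF.
have muE A : mu A = lebesgue_measure ((F @^-1` A) `&` I01) by [].
have sub01 k y : y \in net k -> cell k y `<=` I01 by rewrite I01E; exact: cell01.
have mpre A : open A -> measurable (F @^-1` A `&` I01 : set (measurableTypeR R)).
  move=> oA; apply: measurableI => //.
  by have := mF measurableT A (@borel_open R M x0 A oA); rewrite setTI.
exists mu; split.
- by rewrite muE preimage_setT setTI lebesgue_measure_itv /= lte_fin ltr01 oppr0 adde0.
- move=> k x r y yk xy; rewrite muE -(cell_lebesgue k y).
  apply: le_measure; rewrite ?inE.
  + exact: cell_measurable.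
  + by apply: mpre; exact: open_mball.
  + move=> t c; split; last exact: sub01 c.
    rewrite /preimage /= mballE; apply: le_lt_trans xy.
    apply: le_trans (metric_triangle _ y _) _; rewrite lerD2l; exact: FP.
- move=> k x r c H; rewrite muE.
  pose s := [seq y <- net k | mdist x y < r + 2 * eps k].
  apply: (@le_trans _ _ (@lebesgue_measure R (\big[setU/set0]_(y <- s) cell k y))).
    apply: le_measure; rewrite ?inE.
    + by apply: mpre; exact: open_mball.
    + by apply: bigsetU_measurable => y _; exact: cell_measurable.
    + move=> t [/=]; rewrite mballE I01E => xt t01.
      have [y yk cy] := cell_ex k t01; rewrite -bigcup_seq; exists y => //=.
      rewrite mem_filter yk andbT; apply: le_lt_trans (metric_triangle _ (F t) _) _.
      by rewrite ltr_leD // metric_sym; exact: FP.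
  apply: measure_bigsetU_le => y; first by move=> _; exact: cell_measurable.
  rewrite mem_filter => /andP[xy yk].
  apply: (@le_trans _ _ (mass k y)%:E); first by rewrite -cell_lebesgue.
  by rewrite lee_fin; exact: H.
Qed.

End NestedNets.

Section Homogeneous.
Context (R : realType).

Lemma powR_ge1 (a b : R) : 1 <= a -> 0 <= b -> 1 <= a `^ b.
Proof. by move=> a1 b0; rewrite -(powRr0 a); exact: ler_powR. Qed.

Definition homogeneous (M : metricType R) (mu : set M -> \bar R) (q A : R) : Prop :=
  forall (x : M) (r rho : R), 0 < r -> r <= rho ->
    (mu (ball x rho) <= (A * (rho / r) `^ q)%:E * mu (ball x r))%E.

Lemma exists_homogeneous (M : metricType R) (p q C : R) (x0 : M) :
  compact [set: M] -> 0 <= p -> p < q -> 1 <= C -> packing (@mdist R M) p C ->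
  exists (mu : {measure set (borel x0) -> \bar R}) (A : R),
    [/\ 1 <= A, mu setT = 1%E & @homogeneous M mu q A].
Proof.
move=> cM p0 pq C1 pk; have [D' D'0 bD'] := compact_bounded cM.
pose D := D' + 1; have D0 : 0 < D by rewrite addr_gt0.
have bD (x y : M) : mdist x y < D by apply: le_lt_trans (bD' x y) _; rewrite ltrDl.
(* Since [q - p] is positive, a large [L] absorbs [C] in [C * L^p <= L^q]; the bound 16 is used in
   the geometry of the nets. *)
pose L := Num.max 16 (C `^ (q - p)^-1).
have L16 : 16 <= L by rewrite le_max lexx.
have L0 : 0 < L by apply: lt_le_trans L16; rewrite ltr0n.
have CL : C * L `^ p <= L `^ q.
  have -> : L `^ q = L `^ (q - p) * L `^ p by rewrite -powRD ?subrK // (gt_eqF L0) implybT.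
  apply: ler_wpM2r; first exact: powR_ge0.
  have qp : 0 < q - p by rewrite subr_gt0.
  have {1}-> : C = (C `^ (q - p)^-1) `^ (q - p).
    by rewrite -powRrM mulVf ?gt_eqF // powRr1 // (le_trans ler01).
  apply: ge0_ler_powR; rewrite ?nnegrE ?powR_ge0 ?(ltW L0) ?(ltW qp) //.
  by rewrite le_max lexx orbT.
have [net [net0 netP netS]] := @nested_nets R M p C D L x0 D0 L16 pk bD.
have [par parP] := @parents R M D L D0 L16 net netP.
pose eps k := D / L ^+ k.
pose m := mass q L net par.
have eps0 k : 0 < eps k by rewrite divr_gt0 // exprn_gt0.
have epsS k : eps k.+1 = eps k / L.
  by rewrite /eps exprS; field; rewrite ?expf_neq0 gt_eqF.
have m0 k v : 0 < m k v.
  exact: (mass_gt0 D0 L16 CL pk netP parP).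
have [mu [mu1 low up]] :=
  limit_measure cM D0 L16 CL pk net0 netP netS parP.
pose w := L `^ (- q); have w0 : 0 < w by exact: powR_gt0.
(* [C * 3^p] counts the net points near a ball, [w^-1] compares their masses, and [(3 * L^2)^q] pays
   for rounding both radii to scales of the nets. *)
pose A := C * 3 `^ p * w^-1 * (3 * L ^+ 2) `^ q.
have q0 : 0 < q := le_lt_trans p0 pq.
have L1 : 1 <= L by apply: le_trans L16; rewrite ler1n.
have w1 : 1 <= w^-1.
  by rewrite /w powRN invrK powR_ge1 // ltW.
have C3 : 1 <= C * 3 `^ p.
  by rewrite mulr_ege1 // powR_ge1 // ler1n.
have C3w : 1 <= C * 3 `^ p * w^-1 by rewrite mulr_ege1.
have L3 : 1 <= (3 * L ^+ 2) `^ q.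
  apply: powR_ge1; last exact: ltW.
  by rewrite mulr_ege1 // ?ler1n // exprn_ege1.
have A1 : 1 <= A by rewrite mulr_ege1.
have A0 : 0 < A := lt_le_trans ltr01 A1.
exists mu, A; split => // x r rho r0 rr.
have rho0 : 0 < rho := lt_le_trans r0 rr.
have rq1 : 1 <= (rho / r) `^ q.
  by rewrite powR_ge1 ?(ltW q0) // ler_pdivlMr // mul1r.
have Aq0 : 0 < A * (rho / r) `^ q.
  by apply: mulr_gt0 => //; exact: lt_le_trans ltr01 rq1.
have mu_le1 B : open B -> (mu B <= 1)%E.
  move=> oB; rewrite -mu1; apply: le_measure; rewrite ?inE //.
  exact: borel_open.
have L2 : 2 <= L by apply: le_trans L16; rewrite ler_nat.
have exk : exists k, 3 * eps k <= r.
  have [|k kr] := exists_geom_lt L2 D0 (r := r / 3); first by rewrite divr_gt0.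
  by exists k; rewrite mulrC -ler_pdivlMr // ltW.
have net00 : x0 \in net 0%N by rewrite net0 inE.
have e00 : eps 0%N = D by rewrite /eps expr0 divr1.
case: (ex_minnP exk) => -[|k'] kr kmin.
  apply: (@le_trans _ _ 1%E); first exact/mu_le1/open_mball.
  apply: (@le_trans _ _ ((A * (rho / r) `^ q)%:E * 1)%E).
    by rewrite mule1 lee_fin mulr_ege1.
  rewrite lee_pmul2l ?lte_fin //.
  apply: (low 0%N x r x0 net00); rewrite -/(eps 0%N) e00.
  by move: kr; rewrite e00; have := bD x x0; lra.
have rk' : r < 3 * eps k'.
  by rewrite ltNge; apply/negP => /kmin; rewrite ltnn.
have [_ _ dk] := netP k'.+1.
have [y yk xy] := dk x; change (is_true (mdist x y < eps k'.+1)) in xy.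
have lowy : ((m k'.+1 y)%:E <= mu (ball x r))%E.
  by apply: low => //; rewrite -/(eps _); have := kr; lra.
(* [j] is the scale of [rho], as [k'.+1] is that of [r]. Any net point of scale [j] close to [x]
   controls the mass of the large ball, and the ancestor of [y] at that scale is such a point. *)
have [j [jk ej Hj]] : exists j, [/\ (j <= k'.+1)%N, eps j <= L * rho &
    forall z, z \in net j -> mdist x z <= 3 * eps j ->
      (mu (ball x rho) <= (C * 3 `^ p * w^-1 * m j z)%:E)%E].
  have [e0r|re0] := leP (eps 0%N) rho.
    exists 0%N; split => //.
      by apply: (le_trans e0r); rewrite ler_peMl // ltW.
    move=> z _ _; apply: le_trans (mu_le1 _ (open_mball _ _)) _.
    by rewrite lee_fin /m /= mulr1.
  have exj : exists j, eps j < rho by have [j jr] := exists_geom_lt L2 D0 rho0; exists j.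
  case: (ex_minnP exj) => -[|j'] jr jmin; first by move: (lt_trans re0 jr); rewrite ltxx.
  have rj' : rho <= eps j'.
    by rewrite leNgt; apply/negP => /jmin; rewrite ltnn.
  have epsle a b : (a <= b)%N -> eps b <= eps a.
    move=> ab; rewrite /eps ler_pM2l // lef_pV2 ?posrE ?exprn_gt0 //.
    exact: ler_weXn2l.
  exists j'; split.
  - rewrite leqNgt; apply/negP => kj.
    have := epsle k'.+1 j' (ltnW kj); have := kr; have := rj'; have := rr; have := eps0 k'.+1; lra.
  - move: jr; rewrite epsS ltr_pdivrMr // => /ltW; by rewrite mulrC.
  - move=> z zj xz; have [u1 u2 u3] := netP j'.
    apply: le_trans (up j' x rho (w^-1 * m j' z) _) _; rewrite -/(eps j').
      move=> v vj xv; rewrite -ler_pdivrMl ?invr_gt0 // invrK.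
      apply: (mass_neighbors D0 L16 CL pk net0 netP netS parP) => //.
      rewrite -/(eps j'); have := metric_triangle v x z; rewrite (metric_sym v x).
      by have := eps0 j'; lra.
    rewrite lee_fin !mulrA ler_pM2r ?m0 // ler_pM2r ?invr_gt0 //.
    have E3 : 3 = 3 * eps j' / eps j' by rewrite mulfK // gt_eqF.
    rewrite [X in C * X `^ p]E3.
    apply: (pk x) => //.
    + by have := eps0 j'; lra.
    + by rewrite filter_uniq.
    + move=> v; rewrite mem_filter => /andP[xv _]; apply: lt_le_trans xv _.
      by rewrite -mulrA -/(eps j'); lra.
    + by move=> a b; rewrite !mem_filter => /andP[_ aj] /andP[_ bj]; exact: u2.
pose i := (k'.+1 - j)%N; have kE : (j + i)%N = k'.+1 by rewrite /i subnKC.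
have yk' : y \in net (j + i)%N by rewrite kE.
have [z [zj yz mz]] :=
  mass_ancestor D0 L16 CL pk netP parP yk'.
rewrite -/m -/w kE in mz; rewrite -/(eps j) -/(eps (j + i)%N) kE in yz.
have epsj : eps j = eps k'.+1 * L ^+ i.
  by rewrite -kE /eps exprD; field; rewrite ?expf_neq0 ?gt_eqF.
have xz : mdist x z <= 3 * eps j.
  have := metric_triangle x y z; have : eps k'.+1 <= eps j.
    by rewrite epsj ler_peMr ?(ltW (eps0 _)) // exprn_ege1.
  have := eps0 k'.+1; lra.
apply: le_trans (Hj z zj xz) _.
apply: (@le_trans _ _ ((A * (rho / r) `^ q)%:E * (m k'.+1 y)%:E)%E); last first.
  by rewrite lee_pmul2l ?lte_fin.
rewrite -EFinM lee_fin.
have Li : L ^+ i <= 3 * L ^+ 2 * (rho / r).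
  have -> : L ^+ i = eps j / eps k'.+1 by rewrite epsj; field; rewrite gt_eqF.
  rewrite ler_pdivrMr //; apply: (le_trans ej).
  have h : r <= 3 * L * eps k'.+1.
    rewrite epsS; have -> : 3 * L * (eps k' / L) = 3 * eps k' by field; rewrite gt_eqF.
    exact: ltW.
  have -> : 3 * L ^+ 2 * (rho / r) * eps k'.+1 = L * rho * ((3 * L * eps k'.+1) / r).
    by field; rewrite gt_eqF.
  rewrite ler_peMr ?mulr_ge0 ?(ltW L0) ?(ltW rho0) //.
  by rewrite ler_pdivlMr // mul1r.
have wi : (w ^+ i)^-1 <= (3 * L ^+ 2) `^ q * (rho / r) `^ q.
  have -> : (w ^+ i)^-1 = (L ^+ i) `^ q.
    rewrite /w powRN exprVn invrK -powR_mulrn ?powR_ge0 // -powRrM mulrC powRrM.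
    by rewrite powR_mulrn // ltW.
  have n1 : 0 <= 3 * L ^+ 2 by rewrite mulr_ge0 // exprn_ge0 // ltW.
  have n2 : 0 <= rho / r by rewrite divr_ge0 // ltW.
  have n3 : 0 <= L ^+ i by rewrite exprn_ge0 // ltW.
  rewrite -powRM //; apply: ge0_ler_powR; rewrite ?nnegrE //; [exact: ltW|exact: mulr_ge0].
have C3w0 : 0 <= C * 3 `^ p * w^-1 by apply: le_trans C3w.
rewrite [leRHS](_ : _ = C * 3 `^ p * w^-1 *
    ((3 * L ^+ 2) `^ q * (rho / r) `^ q * m k'.+1 y)); last by rewrite /A; ring.
apply: ler_wpM2l => //.
have wi0 : 0 < w ^+ i by rewrite exprn_gt0.
apply: (@le_trans _ _ ((w ^+ i)^-1 * m k'.+1 y)).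
  by rewrite ler_pdivlMl.
by rewrite ler_pM2r ?m0.
Qed.

End Homogeneous.

(** * From a homogeneous measure to an Ahlfors regular distance *)

Section ChainMetric.
Context (R : realType) (T : choiceType) (delta : T -> T -> R) (c : R).
Hypotheses (delta_ge0 : forall x y, 0 <= delta x y)
  (delta_sym : forall x y, delta x y = delta y x)
  (delta_xx : forall x, delta x x = 0)
  (delta_pos : forall x y, delta x y = 0 -> x = y).

Fixpoint chain_length (x : T) (s : seq T) : R :=
  if s is y :: s' then delta x y + chain_length y s' else 0.

Hypothesis c0 : 0 < c.
Hypothesis chainP : forall x s, c * delta x (last x s) <= chain_length x s.

Let cl_ge0 x s : 0 <= chain_length x s.
Proof. by apply: le_trans (chainP x s); rewrite mulr_ge0 // ltW. Qed.

Let cl_cat x s t : chain_length x (s ++ t) = chain_length x s + chain_length (last x s) t.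
Proof. by elim: s x => [|y s IH] x /=; rewrite ?add0r // IH addrA. Qed.

Let cl_rev x s : chain_length (last x s) (rev (belast x s)) = chain_length x s.
Proof.
elim: s x => [|y s IH] x //=; rewrite rev_cons -cats1 cl_cat IH /= addr0 addrC.
by congr (_ + _); case: s {IH} => [|z s] /=; rewrite ?rev_cons ?last_rcons delta_sym.
Qed.

Let lens x y := [set chain_length x s | s in [set s | last x s = y]].
Let th x y := inf (lens x y).

Let lens_has_inf x y : has_inf (lens x y).
Proof.
split; first by exists (chain_length x [:: y]), [:: y].
by exists 0 => _ [s _ <-].
Qed.

Let th_le x s : th x (last x s) <= chain_length x s.
Proof. by apply: ge_inf; [case: (lens_has_inf x (last x s))|exists s]. Qed.

Let th_ge x y r : (forall s, last x s = y -> r <= chain_length x s) -> r <= th x y.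
Proof.
move=> H; apply: lb_le_inf; first by case: (lens_has_inf x y).
by move=> _ [s /= sy <-]; exact: H.
Qed.

(** The infimum of chain lengths is symmetric by reversal and satisfies the triangle inequality by
    concatenation; [chainP] prevents it from collapsing. *)
Lemma chain_metric : exists theta : distance R T,
  forall x y, c * delta x y <= theta x y <= delta x y.
Proof.
have lo x y : c * delta x y <= th x y by apply: th_ge => s <-.
have hi x y : th x y <= delta x y.
  by have := th_le x [:: y]; rewrite /= addr0.
have thxx x : th x x = 0.
  apply/eqP; rewrite eq_le; have := lo x x; have := hi x x.
  by rewrite delta_xx mulr0 => -> ->.
have thpos x y : th x y = 0 -> x = y.
  move=> E; apply: delta_pos; apply/eqP; rewrite eq_le delta_ge0 andbT.
  by have := lo x y; rewrite E pmulr_rle0.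
have thsym x y : th x y = th y x.
  suff H a b : th a b <= th b a by apply/eqP; rewrite eq_le !H.
  apply: th_ge => s sa.
  have E : last (last b s) (rev (belast b s)) = b.
    by case: s {sa} => [|z s] //=; rewrite rev_cons last_rcons.
  by have := th_le (last b s) (rev (belast b s)); rewrite E cl_rev sa.
have thtri y x z : th x z <= th x y + th y z.
  rewrite -lerBlDr; apply: th_ge => s sy; rewrite lerBlDr -lerBlDl.
  apply: th_ge => t tz; rewrite lerBlDl.
  by have := th_le x (s ++ t); rewrite last_cat sy tz cl_cat sy.
by exists (Distance thxx thpos thsym thtri) => x y; rewrite /= lo hi.
Qed.

End ChainMetric.

Section Powers.
Context (R : realType).

(** Turns a decay by [k] for each factor [Lam] of the scale into a power law: [a] solves
    [Lam^(- a) = k], and [k^-1] pays for rounding [tau] to a power of [Lam]. *)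
Lemma geometric_powR (Lam k : R) : 1 < Lam -> 0 < k < 1 ->
  exists2 a : R, 0 < a & forall tau, 0 < tau -> tau <= 1 ->
    exists n : nat, tau <= (Lam ^+ n)^-1 /\ k ^+ n <= k^-1 * tau `^ a.
Proof.
move=> L1 /andP[k0 k1]; have L0 : 0 < Lam := lt_trans ltr01 L1.
have lL : 0 < ln Lam by rewrite ln_gt0.
have lk : 0 < - ln k by rewrite oppr_gt0 ln_lt0 // k0.
pose a := - ln k / ln Lam; have a0 : 0 < a by rewrite divr_gt0.
exists a => // tau t0 t1.
have kE n : k ^+ n = ((Lam ^+ n)^-1) `^ a.
  rewrite -powR_mulrn ?(ltW k0) // -powR_invn ?(ltW L0) // -powRrM /powR.
  rewrite !gt_eqF //; congr expR.
  by rewrite /a; field; rewrite gt_eqF.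
have ex : exists n, (Lam ^+ n)^-1 < tau.
  have : (fun n => Lam ^- n) @ \oo --> (0 : R).
    have -> : (fun n => Lam ^- n) = (fun n => (Lam^-1) ^+ n).
      by apply/funext => n; rewrite exprVn.
    by apply: cvg_expr; rewrite ger0_norm ?invr_ge0 ?(ltW L0) // invf_lt1.
  move=> /cvgrPdist_lt/(_ _ t0)[N _ H]; exists N.
  have := H N (leqnn N); rewrite /= sub0r normrN ger0_norm //.
  by rewrite invr_ge0 exprn_ge0 // ltW.
case: (ex_minnP ex) => -[|n] nt nmin.
  by move: nt; rewrite expr0 invr1 ltNge t1.
exists n; split.
  by rewrite leNgt; apply/negP => /nmin; rewrite ltnn.
rewrite ler_pdivlMl // -exprS kE; apply: ge0_ler_powR.
- exact: ltW.
- by rewrite nnegrE invr_ge0 exprn_ge0 // ltW.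
- by rewrite nnegrE ltW.
- exact: ltW.
Qed.

End Powers.

(** * Finite Borel measures on compact metric spaces are Radon *)

Section Radon.
Context (R : realType) (N : metricType R) (p : N).
Variable mu : {measure set (borel p) -> \bar R}.
Hypothesis cN : compact [set: N].
Hypothesis fin_mu : (mu setT < +oo)%E.

Let cvge0_lt (u : nat -> \bar R) (e : R) : u @ \oo --> (0%E : \bar R) -> 0 < e ->
  exists n, (u n < e%:E)%E.
Proof.
move=> cv e0; have H : nbhs (0%E : \bar R) [set x | (x < e%:E)%E].
  exists e => //= z; rewrite /ball /= sub0r normrN lte_fin => h.
  exact: le_lt_trans (ler_norm z) h.
by have [m _ Hm] := cv _ H; exists m; exact: (Hm m (leqnn m)).
Qed.

Let mu_fin (B : set N) : measurable (B : set (borel p)) -> (mu B \is a fin_num)%E.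
Proof.
move=> mB; rewrite ge0_fin_numE //; apply: le_lt_trans fin_mu.
by apply: le_measure; rewrite ?inE.
Qed.

Let mclosed (F : set N) : closed F -> measurable (F : set (borel p)).
Proof. by move=> cF; rewrite -(setCK F); apply: measurableC; apply: borel_open; exact: closed_openC. Qed.

Let regular (B : set N) := forall e : R, 0 < e -> exists F U : set N,
  [/\ closed F, open U, F `<=` B, B `<=` U & (mu (U `\` F) < e%:E)%E].

(** The closed sets of points at distance at least [1 / (n + 1)] from the complement exhaust [U],
    and the measure is continuous from above. *)
Let regular_open (U : set N) : open U -> regular U.
Proof.
move=> oU e e0.
pose G n : set N := \bigcup_(z in ~` U) ball z (n.+1%:R^-1).
have oG n : open (G n) by apply: bigcup_open => z _; exact: open_mball.
have mUG n : measurable (U `&` G n : set (borel p)).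
  by apply: measurableI; apply: borel_open.
have cap0 : \bigcap_n (U `&` G n) = set0.
  rewrite -subset0 => x H; have [Ux _] := H 0%N Logic.I.
  have [r r0 rU] := (open_mdistP U).1 oU x Ux.
  have [m _ Hm] := near_infty_natSinv_lt (PosNum r0).
  have [_ [z nUz]] := H m Logic.I; rewrite mballE => zx; apply: nUz; apply: rU.
  by rewrite metric_sym (lt_trans zx) //; exact: (Hm m (leqnn m)).
have cv : (mu \o (fun n => U `&` G n)) @ \oo --> mu (\bigcap_n (U `&` G n)).
  apply: nonincreasing_cvg_mu => //.
  - by rewrite -ge0_fin_numE //; exact: mu_fin.
  - exact: bigcap_measurable.
  - move=> a b ab; apply/subsetPset => x [Ux [z nz]]; rewrite mballE => zx.
    split=> //; exists z => //; rewrite mballE (lt_le_trans zx) //.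
    by rewrite lef_pV2 ?posrE // ler_nat ltnS.
rewrite cap0 measure0 in cv.
have [m' hm] := cvge0_lt cv e0.
exists (~` G m'), U; split=> //.
- exact: open_closedC.
- move=> x nG; apply: contrapT => nUx; apply: nG; exists x => //.
  by rewrite mballE mdistxx.
- by rewrite setDE setCK.
Qed.

Let regularC (B : set N) : regular B -> regular (~` B).
Proof.
move=> rB e e0; have [F [U [cF oU FB BU h]]] := rB e e0.
exists (~` U), (~` F); split.
- exact: open_closedC.
- exact: closed_openC.
- exact: subsetC.
- exact: subsetC.
- by rewrite setDE setCK setIC -setDE.
Qed.

(** A countable union of closed sets need not be closed, so it is cut at a finite index [n]. Half of
    [e] pays for this and the other half, divided geometrically, for the approximation of the
    [A n]. *)
Let regular_bigcup (A : (set N)^nat) : (forall n, regular (A n)) ->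
  regular (\bigcup_n A n).
Proof.
move=> rA e e0.
have e2 n : 0 < e / 2 / (2 ^ n.+1)%:R by rewrite !divr_gt0 // ltr0n expn_gt0.
have H n : exists FU : set N * set N, [/\ closed FU.1, open FU.2, FU.1 `<=` A n,
    A n `<=` FU.2 & (mu (FU.2 `\` FU.1) < (e / 2 / (2 ^ n.+1)%:R)%:E)%E].
  by have [F [U h]] := rA n _ (e2 n); exists (F, U).
have {H} [FU H] := choice H.
pose F n := (FU n).1; pose U n := (FU n).2.
have cF n : closed (F n) by have [] := H n.
have oU n : open (U n) by have [] := H n.
have FA n : F n `<=` A n by have [] := H n.
have AU n : A n `<=` U n by have [] := H n.
have mUF n : (mu (U n `\` F n) < (e / 2 / (2 ^ n.+1)%:R)%:E)%E by have [] := H n.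
have mF n : measurable (F n : set (borel p)) by exact: mclosed.
have mU n : measurable (U n : set (borel p)) by exact: borel_open.
pose W := \bigcup_n F n.
pose C n := \big[setU/set0]_(i < n) F i.
have mW : measurable (W : set (borel p)) by exact: bigcupT_measurable.
have mC n : measurable (C n : set (borel p)) by apply: bigsetU_measurable.
have mWC n : measurable (W `\` C n : set (borel p)) by apply: measurableD.
have cap0 : \bigcap_n (W `\` C n) = set0.
  rewrite -subset0 => x Hx; have [[n _ Fx] _] := Hx 0%N Logic.I.
  have [_] := Hx n.+1 Logic.I; apply.
  by rewrite /C -bigcup_mkord; exists n => /=.
have cv : (mu \o (fun n => W `\` C n)) @ \oo --> (0%E : \bar R).
  rewrite -(measure0 mu) -cap0; apply: nonincreasing_cvg_mu => //.
  - by rewrite -ge0_fin_numE //; exact: mu_fin.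
  - exact: bigcap_measurable.
  - move=> a b ab; apply/subsetPset; apply: setDS; exact: subset_bigsetU.
have e20 : 0 < e / 2 by rewrite divr_gt0.
have [n hn] := cvge0_lt cv e20.
exists (C n), (\bigcup_n U n); split.
- by rewrite /C; elim/big_ind: _ => //; [exact: closed0|exact: closedU].
- exact: bigcup_open.
- by rewrite /C -bigcup_mkord => x [i _ Fx]; exists i => //; exact: FA.
- by move=> x [i _ Ax]; exists i => //; exact: AU.
have mUall : measurable (\bigcup_n U n : set (borel p)) by exact: bigcupT_measurable.
apply: (@le_lt_trans _ _ (mu ((\bigcup_n (U n `\` F n)) `|` (W `\` C n)))).
  apply: le_measure; rewrite ?inE.
  - exact: measurableD.
  - by apply: measurableU => //; apply: bigcupT_measurable => k; exact: measurableD.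
  - move=> x [[k _ Ux] nC]; have [Wx|nW] := pselect (W x); first by right.
    by left; exists k => //; split => // Fx; apply: nW; exists k.
have mD : measurable (\bigcup_n (U n `\` F n) : set (borel p)).
  by apply: bigcupT_measurable => k; exact: measurableD.
apply: (@le_lt_trans _ _ (mu (\bigcup_n (U n `\` F n)) + mu (W `\` C n))%E).
  exact: measureU2.
rewrite (splitr e) EFinD; apply: lee_ltD => //; first exact: mu_fin.
apply: le_trans (measure_sigma_subadditive _ _ _ (@subset_refl _ _)) _ => //.
  by move=> k; exact: measurableD.
apply: (@le_trans _ _ (\sum_(0 <= i <oo) (0 + (e / 2 / (2 ^ i.+1)%:R)%:E))%E).
  by apply: lee_nneseries => // k _; rewrite add0e ltW.
apply: le_trans (epsilon_trick _ _ _) _ => //; first by rewrite divr_ge0 // ltW.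
by rewrite eseries0 // add0e.
Qed.

(** The sets enclosed between a closed and an open set of almost equal measure form a sigma-algebra
    that contains the open sets; closed inner sets are compact because [N] is. *)
Lemma finite_measure_radon : radon (mu : set N -> \bar R).
Proof.
have reg B : <<s (@open N) >> B -> regular B.
  move: B; apply: smallest_sub; last exact: regular_open.
  split; first by move=> e e0; exists set0, set0; split => //; [exact: closed0|exact: open0|rewrite setDv measure0 lte_fin].
  - by move=> A rA; rewrite setTD; exact: regularC.
  - by move=> A rA; exact: regular_bigcup.
have close (F U : set N) (e : R) : closed F -> open U -> F `<=` U ->
    (mu (U `\` F) < e%:E)%E -> (mu U <= mu F + e%:E)%E.
  move=> cF oU FU h.
  have mF := mclosed cF; have mU : measurable (U : set (borel p)) by exact: borel_open.
  have -> : mu U = (mu F + mu (U `\` F))%E.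
    have mUF : measurable (U `\` F : set (borel p)) by apply: measurableD.
    by rewrite -measureU ?setDUK // setDIK.
  by rewrite leeD2l // ltW.
split.
- move=> C cC; apply: le_lt_trans fin_mu; apply: le_measure; rewrite ?inE //.
  by apply: mclosed; apply: compact_closed => //; exact: metric_hausdorff.
- move=> B mB; apply/eqP; rewrite eq_le; apply/andP; split.
    apply: le_ereal_inf_tmp => _ [U [oU BU] <-]; apply: le_measure; rewrite ?inE //.
    exact: borel_open.
  apply/lee_addgt0Pr => e e0; have [F [U [cF oU FB BU h]]] := reg B mB e e0.
  apply: (@le_trans _ _ (mu U)); first by apply: ereal_inf_lbound; exists U.
  apply: le_trans (close F U e cF oU (subset_trans FB BU) h) _.
  by rewrite leeD2r //; apply: le_measure; rewrite ?inE //; exact: mclosed.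
- move=> U oU; apply/eqP; rewrite eq_le; apply/andP; split; last first.
    apply: ge_ereal_sup => _ [C [cC CU] <-]; apply: le_measure; rewrite ?inE //.
      by apply: mclosed; apply: compact_closed => //; exact: metric_hausdorff.
    exact: borel_open.
  apply/lee_addgt0Pr => e e0.
  have [F [V [cF oV FU UV h]]] := reg U (@borel_open R N p U oU) e e0.
  have h' : (mu (U `\` F) < e%:E)%E.
    apply: le_lt_trans h; apply: le_measure; rewrite ?inE.
    - by apply: measurableD; [exact: borel_open|exact: mclosed].
    - by apply: measurableD; [exact: borel_open|exact: mclosed].
    - exact: setSD.
  apply: le_trans (close F U e cF oU FU h') _; rewrite leeD2r //.
  apply: ereal_sup_ubound; exists F => //; split => //.
  exact: subclosed_compact cF cN _.
Qed.

End Radon.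

(** * The regular distance of a homogeneous measure *)

Section Uniformization.
Context (R : realType) (M : metricType R) (x0 : M).
Variable mu : {measure set (borel x0) -> \bar R}.
Variables (q A : R).
Hypotheses (cM : compact [set: M]) (up : uniformly_perfect M)
  (twoM : exists x y : M, x != y) (q0 : 0 < q) (A1 : 1 <= A)
  (mu1 : mu setT = 1%E) (hmu : @homogeneous R M mu q A).

Let v x r := fine (mu (ball x r)).

Let mball_meas x r : measurable (ball x r : set (borel x0)).
Proof. by apply: borel_open; exact: open_mball. Qed.

Let vE x r : mu (ball x r) = (v x r)%:E.
Proof.
rewrite /v fineK // ge0_fin_numE // (@le_lt_trans _ _ (mu setT)) ?mu1 ?ltry //.
by rewrite -mu1; apply: le_measure; rewrite ?inE.
Qed.

Let v_ge0 x r : 0 <= v x r. Proof. by rewrite fine_ge0. Qed.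

Let v_mono x y r s : ball x r `<=` ball y s -> v x r <= v y s.
Proof. by move=> H; rewrite -lee_fin -!vE; apply: le_measure; rewrite ?inE. Qed.

Let v_ball x y r s : mdist x y + r <= s -> v x r <= v y s.
Proof.
move=> h; apply: v_mono => z; rewrite !mballE => xz.
by apply: le_lt_trans (metric_triangle _ x _) _; rewrite metric_sym; lra.
Qed.

Let v_hom x r rho : 0 < r -> r <= rho -> v x rho <= A * (rho / r) `^ q * v x r.
Proof. by move=> r0 rr; have := hmu x r0 rr; rewrite !vE -EFinM lee_fin. Qed.

Let A0 : 0 < A. Proof. exact: lt_le_trans ltr01 A1. Qed.

Let v_gt0 x r : 0 < r -> 0 < v x r.
Proof.
move=> r0; have [D D0 bD] := compact_bounded cM.
have h := v_hom x r0 (_ : r <= D + 1 + r).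
have {h} : 1 <= A * ((D + 1 + r) / r) `^ q * v x r.
  apply: le_trans (h _); last by rewrite lerDr addr_ge0 // ltW.
  rewrite -lee_fin -vE -mu1; apply: le_measure; rewrite ?inE // => y _.
  by rewrite mballE; apply: le_lt_trans (bD x y) _; rewrite -addrA ltrDl addr_gt0.
move=> h; rewrite lt_neqAle v_ge0 andbT; apply/eqP => E.
by move: h; rewrite -E mulr0 ler10.
Qed.

(** The distance to be built is comparable to [h x (mdist x y)], so that its balls of radius [rho]
    have mass comparable to [rho^q]. *)
Let h x r := v x r `^ q^-1.
Let iq0 : 0 < q^-1. Proof. by rewrite invr_gt0. Qed.
Let h_ge0 x r : 0 <= h x r. Proof. exact: powR_ge0. Qed.
Let h_gt0 x r : 0 < r -> 0 < h x r.
Proof. by move=> r0; apply: powR_gt0; exact: v_gt0. Qed.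
Let h0 x : h x 0 = 0.
Proof.
rewrite /h /v; have -> : ball x (0 : R) = set0.
  by rewrite -subset0 => y; rewrite mballE ltNge mdist_ge0.
by rewrite measure0 powR0 // gt_eqF.
Qed.
Let hq x r : h x r `^ q = v x r.
Proof. by rewrite /h -powRrM mulVf ?gt_eqF // powRr1. Qed.

Let B := A `^ q^-1.
Let B1 : 1 <= B. Proof. by apply: powR_ge1 => //; exact: ltW. Qed.
Let B0 : 0 < B. Proof. exact: lt_le_trans ltr01 B1. Qed.

Let pow_le a b : 0 <= a -> a <= b -> a `^ q^-1 <= b `^ q^-1.
Proof.
by move=> a0 ab; apply: ge0_ler_powR; rewrite ?nnegrE ?(ltW iq0) // (le_trans a0).
Qed.

Let h_ball x y r s : mdist x y + r <= s -> h x r <= h y s.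
Proof. by move=> H; apply: pow_le => //; exact: v_ball. Qed.

Let h_mono x r s : r <= s -> h x r <= h x s.
Proof. by move=> rs; apply: h_ball; rewrite mdistxx add0r. Qed.

Let h_hom x r rho : 0 < r -> r <= rho -> h x rho <= B * (rho / r) * h x r.
Proof.
move=> r0 rr; have rho0 : 0 < rho := lt_le_trans r0 rr.
have rr0 : 0 <= rho / r by rewrite divr_ge0 // ltW.
apply: le_trans (pow_le _ (v_hom x r0 rr)) _ => //.
rewrite powRM ?mulr_ge0 ?powR_ge0 ?(ltW A0) // powRM ?powR_ge0 ?(ltW A0) //.
by rewrite -powRrM mulfV ?gt_eqF // powRr1.
Qed.

(** Reverse doubling: uniform perfectness gives a point [w] off the small ball such that the ball of
    radius [s = r / (4 * lam)] about [w] is disjoint from the small ball and contained in the large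
    one. It carries at least the fraction [c] of the mass, because the ball of radius
    [2 * r = 8 * lam * s] about [w] contains the large ball. *)
Let reverse : exists Lam k : R, [/\ 1 < Lam, 0 < k < 1 &
  forall x y n, v x (mdist x y / Lam ^+ n) <= k ^+ n * v x (mdist x y)].
Proof.
have [lam lam1 H] := up; have l0 : 0 < lam := lt_trans ltr01 lam1.
pose c := (A * (8 * lam) `^ q)^-1.
have L81 : 1 < 8 * lam by rewrite mulr_egt1 // ltr1n.
have pw1 : 1 < (8 * lam) `^ q.
  have := @gt0_ltr_powR R q q0 1 (8 * lam); rewrite powR1; apply => //.
    by rewrite nnegrE.
  by rewrite nnegrE mulr_ge0 // ltW.
have Ap : 1 < A * (8 * lam) `^ q by rewrite (lt_le_trans pw1) // ler_peMl // ltW // (lt_trans ltr01).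
have c0 : 0 < c by rewrite invr_gt0 (lt_trans ltr01).
have c1 : c < 1 by rewrite invf_lt1 // (lt_trans ltr01).
exists (4 * lam), (1 - c); split.
- by rewrite mulr_egt1 // ltr1n.
- by rewrite subr_gt0 c1 ltrBlDr ltrDl c0.
have step x r z : 0 < r -> r <= mdist x z -> v x (r / (4 * lam)) <= (1 - c) * v x r.
  move=> r0 rz; have r2 : 0 < r / 2 by rewrite divr_gt0.
  have [|w []] := H x (r / 2) r2.
    exists z => /=; rewrite mballE; apply/negP; rewrite -leNgt.
    by apply: le_trans rz; rewrite ler_pdivrMr // ler_pMr // ler1n.
  rewrite !mballE => xw nw.
  have {}nw : r / 2 / lam <= mdist x w by rewrite leNgt; apply/negP.
  pose s := r / (4 * lam); have s0 : 0 < s by rewrite divr_gt0 // mulr_gt0.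
  have sE : r / 2 / lam = 2 * s by rewrite /s; field; rewrite gt_eqF.
  have s4 : 4 * s < r.
    have -> : r = 4 * lam * s by rewrite /s; field; rewrite gt_eqF.
    by rewrite ltr_pM2r // ltr_pMr.
  have vw : c * v x r <= v w s.
    rewrite /c mulrC ler_pdivrMr ?(lt_trans ltr01) //.
    apply: (@le_trans _ _ (v w (2 * r))); first by apply: v_ball; lra.
    rewrite [leRHS]mulrC.
    have -> : 8 * lam = 2 * r / s by rewrite /s; field; rewrite !gt_eqF.
    by apply: v_hom => //; lra.
  have : v x s + v w s <= v x r.
    rewrite -lee_fin EFinD -!vE -measureU //; last first.
      rewrite -subset0 => u []; rewrite !mballE => xu wu.
      by have := metric_triangle x u w; rewrite (metric_sym u w); lra.
    apply: le_measure; rewrite ?inE //; first exact: measurableU.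
    move=> u; rewrite /setU /= !mballE => -[xu|wu]; first by lra.
    by apply: le_lt_trans (metric_triangle _ w _) _; lra.
  by rewrite -/s mulrBl mul1r; lra.
move=> x y; elim=> [|n IH]; first by rewrite expr0 divr1 mul1r.
have [E|xy] := eqVneq x y.
  by rewrite E mdistxx !mul0r -(hq y) h0 powR0 ?gt_eqF // mulr0.
have d0 : 0 < mdist x y by rewrite mdist_gt0.
have L0 : 0 < 4 * lam by rewrite mulr_gt0.
have L1 : 1 <= 4 * lam by rewrite mulr_ege1 // ?ler1n // ltW.
have -> : mdist x y / (4 * lam) ^+ n.+1 = mdist x y / (4 * lam) ^+ n / (4 * lam).
  by rewrite exprSr invfM mulrA.
apply: le_trans (step x _ y _ _) _.
- by rewrite divr_gt0 // exprn_gt0.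
- by rewrite ler_pdivrMr ?exprn_gt0 // ler_peMr ?mdist_ge0 // exprn_ege1.
by rewrite exprS -mulrA ler_wpM2l // subr_ge0 ltW.
Qed.

Let small : exists2 a : R, 0 < a & exists2 K : R, 0 < K &
  forall x y r, 0 <= r -> r <= mdist x y ->
    h x r <= K * (r / mdist x y) `^ a * h x (mdist x y).
Proof.
have [Lam [k [L1 k01 H]]] := reverse; have /andP[k0 k1] := k01.
have [a a0 aP] := geometric_powR L1 k01.
exists (a / q); first by rewrite divr_gt0.
exists (k^-1 `^ q^-1); first by rewrite powR_gt0 // invr_gt0.
move=> x y r; rewrite le_eqVlt => /orP[/eqP <- _|r0 rd].
  by rewrite h0 !mulr_ge0 ?powR_ge0.
have d0 : 0 < mdist x y := lt_le_trans r0 rd.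
have t0 : 0 < r / mdist x y by rewrite divr_gt0.
have [|n [n1 n2]] := aP _ t0; first by rewrite ler_pdivrMr // mul1r.
have rn : r <= mdist x y / Lam ^+ n by move: n1; rewrite ler_pdivrMr // mulrC.
have : v x r <= k^-1 * (r / mdist x y) `^ a * v x (mdist x y).
  apply: le_trans (v_ball (y := x) (s := mdist x y / Lam ^+ n) _) _.
    by rewrite mdistxx add0r.
  by apply: le_trans (H x y n) _; apply: ler_wpM2r.
move=> /(pow_le (v_ge0 _ _))/le_trans; apply.
by rewrite powRM ?mulr_ge0 ?powR_ge0 ?invr_ge0 ?(ltW k0) // powRM ?invr_ge0 ?powR_ge0 ?(ltW k0) // powRrM.
Qed.

Let h_small x e : 0 < e -> exists2 r, 0 < r & h x r < e.
Proof.
move=> e0; have [a a0 [K K0 H]] := small.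
have [y xy] : exists y, x != y.
  have [u [w uw]] := twoM; have [E|] := eqVneq x u; last by exists u.
  by exists w; rewrite E.
have d0 : 0 < mdist x y by rewrite mdist_gt0.
have G0 : 0 < K * h x (mdist x y) by rewrite mulr_gt0 // h_gt0.
pose t := Num.min 1 ((e / 2 / (K * h x (mdist x y))) `^ a^-1).
have t0 : 0 < t by rewrite lt_min ltr01 powR_gt0 // !divr_gt0.
exists (t * mdist x y); first by rewrite mulr_gt0.
apply: le_lt_trans (H x y _ _ _) _.
- by rewrite mulr_ge0 // ltW.
- by rewrite ler_piMl ?(ltW d0) // ge_min lexx.
rewrite mulfK ?gt_eqF // mulrAC.
apply: (@le_lt_trans _ _ (e / 2)); last by rewrite ltr_pdivrMr // ltr_pMr // ltr1n.
rewrite mulrC -ler_pdivlMr //.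
have -> : e / 2 / (K * h x (mdist x y)) = ((e / 2 / (K * h x (mdist x y))) `^ a^-1) `^ a.
  by rewrite -powRrM mulVf ?gt_eqF // powRr1 // ltW // !divr_gt0.
apply: ge0_ler_powR; rewrite ?nnegrE ?powR_ge0 ?(ltW a0) ?(ltW t0) //.
by rewrite ge_min lexx orbT.
Qed.

Let delta x y := h x (mdist x y) + h y (mdist x y).

Let delta_le x y : delta x y <= (1 + 2 * B) * h x (mdist x y).
Proof.
have [<-|xy] := eqVneq x y; first by rewrite /delta mdistxx h0 addr0 mulr0.
have d0 : 0 < mdist x y by rewrite mdist_gt0.
rewrite /delta mulrDl mul1r lerD2l.
apply: (@le_trans _ _ (h x (2 * mdist x y))).
  by apply: h_ball; rewrite metric_sym; lra.
have := @h_hom x (mdist x y) (2 * mdist x y) d0; rewrite mulfK ?gt_eqF //.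
by rewrite (mulrC B); apply; lra.
Qed.

Let kap := (2 * B)^-1.
Let kap0 : 0 < kap. Proof. by rewrite invr_gt0 mulr_gt0. Qed.

(** Homogeneity with exponent [q] says that [h] grows at most linearly with the radius. So a jump of
    length [t] starting within [D] of [x] costs at least a fixed multiple of the proportion [t / D]
    of [h x D], and subdividing a chain cannot make it arbitrarily short. *)
Let step_lower x z z' D : 0 < D -> mdist x z < D ->
  kap * (Num.min (mdist z z') D / D) * h x D <= h z (mdist z z').
Proof.
move=> D0 xz; set t := mdist z z'.
have xD : h x D <= h z (2 * D) by apply: h_ball; lra.
have [E|zz'] := eqVneq z z'.
  rewrite /t E mdistxx (min_idPl _) ?(ltW D0) // mul0r mulr0 mul0r; exact: h_ge0.
have t0 : 0 < t by rewrite mdist_gt0.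
have [t2|t2] := leP t (2 * D); last first.
  apply: (@le_trans _ _ (h z (2 * D))); last by apply: h_mono; exact: ltW.
  apply: le_trans xD; rewrite ler_piMl // /kap mulrC ler_pdivrMr ?mulr_gt0 //.
  apply: (@le_trans _ _ 1); first by rewrite ler_pdivrMr // mul1r ge_min lexx orbT.
  by rewrite mul1r; have := B1; lra.
have H := le_trans xD (h_hom z t0 t2).
have m0 : 0 <= Num.min t D / D by rewrite divr_ge0 ?(ltW D0) // le_min (ltW t0) (ltW D0).
have m1 : Num.min t D / D <= t / D by rewrite ler_pM2r ?invr_gt0 // ge_min lexx.
apply: (@le_trans _ _ (kap * (t / D) * (B * (2 * D / t) * h z t))).
  by apply: ler_pM => //; [rewrite mulr_ge0 // ltW|apply: ler_wpM2l => //; exact: ltW].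
rewrite /kap; have -> : (2 * B)^-1 * (t / D) * (B * (2 * D / t) * h z t) = h z t.
  by field; rewrite !gt_eqF.
by [].
Qed.

Let cl_ge0 z s : 0 <= chain_length delta z s.
Proof. by elim: s z => [|a s IH] z //=; rewrite !addr_ge0. Qed.

(** Up to the first exit from the ball of radius [D] the costs of the jumps add up in proportion to
    the remaining way [D - mdist x z]; the rest of the chain is discarded. *)
Let chain_lower x z s D : 0 < D -> mdist x z < D -> D <= mdist x (last z s) ->
  kap * ((D - mdist x z) / D) * h x D <= chain_length delta z s.
Proof.
move=> D0; elim: s z => [|z' s IH] z /=.
  by move=> /lt_le_trans/[apply]; rewrite ltxx.
move=> xz Dl; set t := mdist z z'.
have tri : mdist x z' <= mdist x z + t := metric_triangle x z z'.
have st : kap * (Num.min t D / D) * h x D <= delta z z'.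
  by apply: le_trans (step_lower z' D0 xz) _; rewrite lerDl.
have kh : 0 <= kap * h x D by rewrite mulr_ge0 // ltW.
have [z'D|Dz'] := ltP (mdist x z') D.
  have := lerD st (IH z' z'D Dl); apply: le_trans.
  have -> : kap * (Num.min t D / D) * h x D + kap * ((D - mdist x z') / D) * h x D
    = (kap * h x D) * ((Num.min t D + (D - mdist x z')) / D) by ring.
  rewrite mulrAC; apply: ler_wpM2l => //; rewrite ler_pM2r ?invr_gt0 //.
  have : mdist x z' - mdist x z <= Num.min t D; last by lra.
  by rewrite le_min; have := mdist_ge0 x z; lra.
apply: (@le_trans _ _ (delta z z')); last by rewrite lerDl cl_ge0.
apply: le_trans st; rewrite mulrAC [leRHS]mulrAC; apply: ler_wpM2l => //.
rewrite ler_pM2r ?invr_gt0 // le_min; have := mdist_ge0 x z; lra.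
Qed.

Let c := kap / (1 + 2 * B).
Let C := 1 + 2 * B.
Let C0 : 0 < C. Proof. by rewrite addr_gt0 // mulr_gt0. Qed.
Let c0 : 0 < c. Proof. by rewrite divr_gt0. Qed.

Let exists_metric : exists theta : distance R M, forall x y,
  c * h x (mdist x y) <= theta x y <= C * h x (mdist x y).
Proof.
have [|||||x s|theta H] := @chain_metric R M delta c.
- by move=> x y; rewrite addr_ge0.
- by move=> x y; rewrite /delta metric_sym addrC.
- by move=> x; rewrite /delta mdistxx !h0 addr0.
- move=> x y E; apply/eqP/negPn/negP => xy.
  have d0 : 0 < mdist x y by rewrite mdist_gt0.
  by have := h_gt0 x d0; have := h_ge0 y (mdist x y); move: E; rewrite /delta; lra.
- exact: c0.
- set y := last x s.
  have [E|xy] := eqVneq x y.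
    by rewrite -E /delta mdistxx !h0 addr0 mulr0 cl_ge0.
  have d0 : 0 < mdist x y by rewrite mdist_gt0.
  have := @chain_lower x x s (mdist x y) d0; rewrite mdistxx => /(_ d0 (lexx _)).
  rewrite subr0 divff ?gt_eqF // mulr1; apply: le_trans.
  rewrite /c -mulrA; apply: ler_wpM2l; first exact: ltW.
  by rewrite mulrC ler_pdivrMr // mulrC delta_le.
exists theta => x y; have /andP[h1 h2] := H x y; apply/andP; split.
  by apply: le_trans h1; apply: ler_wpM2l; [exact: ltW|rewrite lerDl].
exact: le_trans h2 (delta_le x y).
Qed.

Lemma exists_ahlfors_metric : exists theta : distance R M,
  ahlfors_regular q (remetric theta) /\ quasisymmetric (idfun : M -> remetric theta).
Proof.
have [theta H] := exists_metric; exists theta.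
have lo x y : c * h x (mdist x y) <= theta x y by have /andP[] := H x y.
have hi x y : theta x y <= C * h x (mdist x y) by have /andP[] := H x y.
have th_gt0 x y : x != y -> 0 < theta x y.
  by move=> xy; have := mdist_gt0 (x : remetric theta) y; rewrite xy.
have QS : quasisymmetric (idfun : M -> remetric theta).
  have [a a0 [K K0 HK]] := small.
  pose G := C / c * (B + K).
  have Cc : 0 < C / c by rewrite divr_gt0.
  have G0 : 0 < G by rewrite mulr_gt0 // addr_gt0.
  apply: (qs_of_ineq (distortion_powR G0 a0 ltr01)) => x y z xy.
  have d0 : 0 < mdist x y by rewrite mdist_gt0.
  have hy0 := h_gt0 x d0.
  set t := mdist x z / mdist x y; have t0 : 0 <= t by rewrite divr_ge0 ?mdist_ge0.
  rewrite powRr1 // ler_pdivrMr ?th_gt0 //.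
  suff : h x (mdist x z) <= (B + K) * (t `^ a + t) * h x (mdist x y).
    move=> hh; apply: le_trans (hi x z) _.
    apply: (@le_trans _ _ (C * ((B + K) * (t `^ a + t) * h x (mdist x y)))).
      by apply: ler_wpM2l => //; exact: ltW.
    have -> : C * ((B + K) * (t `^ a + t) * h x (mdist x y)) =
      G * (t `^ a + t) * (c * h x (mdist x y)) by rewrite /G; field; rewrite gt_eqF.
    by apply: ler_wpM2l => //; rewrite mulr_ge0 ?(ltW G0) // addr_ge0 ?powR_ge0.
  apply: (@le_trans _ _ ((B * t + K * t `^ a) * h x (mdist x y))); last first.
    apply: ler_wpM2r => //; have := powR_ge0 t a.
    have : 0 <= B * t `^ a by rewrite mulr_ge0 ?powR_ge0 // ltW.
    have : 0 <= K * t by rewrite mulr_ge0 // ltW.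
    by rewrite mulrDl !mulrDr; lra.
  have [zy|yz] := leP (mdist x z) (mdist x y).
    apply: le_trans (HK x y _ (mdist_ge0 _ _) zy) _.
    by apply: ler_wpM2r => //; rewrite lerDr mulr_ge0 // ltW.
  apply: le_trans (h_hom x d0 (ltW yz)) _.
  by apply: ler_wpM2r => //; rewrite lerDl mulr_ge0 ?powR_ge0 // ltW.
split => //.
have [[_ [_ _ cid _]] _] := QS.
have cN : compact [set: remetric theta].
  have := @continuous_compact M (remetric theta) idfun setT.
  have -> : idfun @` [set: M] = [set: remetric theta] by apply/seteqP; split => // x _; exists x.
  by apply => //; exact: continuous_subspaceT.
have openN (U : set M) : @open (remetric theta) U -> @open M U.
  by move=> oU; have := @open_comp M (remetric theta) idfun U (fun x _ => cid x) oU.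
have mid : measurable_fun [set: borel x0]
    (idfun : borel x0 -> borel (x0 : remetric theta)).
  apply: (measurability (@open (remetric theta) : set (set (borel (x0 : remetric theta))))) => //.
  by move=> _ [U oU <-]; rewrite setTI; apply: borel_open; exact: openN.
pose mu' : {measure set (borel (x0 : remetric theta)) -> \bar R} :=
  measure_function_pushforward__canonical__measure_function_Measure mu mid.
have mu'E S : mu' S = mu S by [].
pose E (x : M) r : set M := [set y | theta x y < r].
have EE x r : @ball R (remetric theta) x r = E x r.
  by apply/seteqP; split => y; rewrite (@mballE R (remetric theta)).
have oE x r : @open M (E x r) by apply: openN; rewrite -EE; exact: open_mball.
have mE x r : measurable (E x r : set (borel x0)) by exact: borel_open.
have mu_fin S : measurable (S : set (borel x0)) -> mu S \is a fin_num.
  move=> mS; rewrite ge0_fin_numE // (@le_lt_trans _ _ (mu setT)) ?mu1 ?ltry //.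
  by rewrite -mu1; apply: le_measure; rewrite ?inE.
have [D D0 bD] := compact_bounded cM.
pose K1 := A * 3 `^ q * c^-1 `^ q.
have K10 : 0 < K1 by rewrite !mulr_gt0 ?powR_gt0 // invr_gt0.
have upper x rho : 0 < rho -> (mu (E x rho) <= ((1 + K1) * rho `^ q)%:E)%E.
  move=> rho0; have rq : 0 < rho `^ q by exact: powR_gt0.
  (* [sup S] is the [mdist]-radius of the [theta]-ball. If it is 0 the ball is a single point, and
     small [mdist]-balls bound its mass. *)
  pose S := [set mdist x y | y in E x rho].
  have Ex : E x rho x by rewrite /E /= distxx.
  have S0 : S !=set0 by exists 0, x => //; rewrite mdistxx.
  have hS : has_sup S by split => //; exists D => _ [y _ <-]; exact: bD.
  have dS y : E x rho y -> mdist x y <= sup S by move=> Ey; apply: ub_le_sup; [case: hS|exists y].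
  have : 0 <= sup S by apply: le_trans (dS x Ex); rewrite mdistxx.
  rewrite le_eqVlt => /orP[/eqP s0|s0].
    have [r r0 hr] := h_small x rho0.
    apply: (@le_trans _ _ (v x r)%:E).
      rewrite -vE; apply: le_measure; rewrite ?inE // => y /dS.
      by rewrite -s0 mballE => /le_lt_trans; apply.
    rewrite lee_fin -hq mulrDl mul1r; apply: (@le_trans _ _ (rho `^ q)).
      by apply: ge0_ler_powR; rewrite ?nnegrE ?(ltW q0) ?(ltW rho0) ?(ltW hr).
    by rewrite lerDl mulr_ge0 // ltW.
  have s2 : 0 < sup S / 2 by rewrite divr_gt0.
  have [_ [y Ey <-] sy] := sup_adherent s2 hS.
  have dy : 0 < mdist x y by lra.
  apply: (@le_trans _ _ (v x (3 * mdist x y))%:E).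
    rewrite -vE; apply: le_measure; rewrite ?inE // => z /dS; rewrite mballE; lra.
  rewrite lee_fin; apply: (@le_trans _ _ (K1 * rho `^ q)); last by rewrite mulrDl lerDr mul1r ltW.
  apply: le_trans (v_hom x dy _) _; first lra.
  rewrite mulfK ?gt_eqF // /K1 -!mulrA !ler_pM2l ?powR_gt0 // -hq -powRM ?invr_ge0 ?(ltW c0) ?(ltW rho0) //.
  apply: ge0_ler_powR; rewrite ?nnegrE ?(ltW q0) ?mulr_ge0 ?invr_ge0 ?(ltW c0) ?(ltW rho0) //.
  by rewrite ler_pdivlMl // (le_trans (lo x y)) // ltW.
pose K2 := A * 2 `^ q * (3 * C) `^ q.
have K20 : 0 < K2 by rewrite !mulr_gt0 ?powR_gt0 // mulr_gt0.
have lower x rho w : 0 < rho -> rho / 3 <= theta x w ->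
    ((K2^-1 * rho `^ q)%:E <= mu (E x rho))%E.
  move=> rho0 xw; have rho3 : 0 < rho / 3 by rewrite divr_gt0.
  (* Dually, the [mdist]-ball of radius [inf S] lies in the [theta]-ball, and a point [z] with
     [theta x z >= rho / 3] and [mdist x z < 2 * inf S] shows that it is not too small. *)
  pose S := [set mdist x z | z in [set z | rho / 3 <= theta x z]].
  have [|r r0 hr] := h_small x (e := rho / 3 / C); first by rewrite divr_gt0.
  have lbS : lbound S r.
    move=> _ [z /= zr <-]; rewrite leNgt; apply/negP => zr'.
    move: zr; apply/negP; rewrite -ltNge; apply: le_lt_trans (hi x z) _.
    by rewrite -ltr_pdivlMl // mulrC (le_lt_trans _ hr) // h_mono // ltW.
  have hS : has_inf S by split; [exists (mdist x w), w|exists r].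
  have i0 : 0 < inf S by apply: lt_le_trans r0 _; apply: lb_le_inf => //; case: hS.
  have [_ [z zr <-] zi] := inf_adherent i0 hS.
  have sub : ball x (inf S) `<=` E x rho.
    move=> u; rewrite mballE => xu; rewrite /E /= ltNge; apply/negP => ru.
    have : inf S <= mdist x u.
      apply: ge_inf; first by exists r.
      by exists u => //=; apply: le_trans ru; rewrite ler_pdivrMr // ler_pMr // ler1n.
    by rewrite leNgt xu.
  apply: (@le_trans _ _ (v x (inf S))%:E); last first.
    by rewrite -vE; apply: le_measure; rewrite ?inE.
  rewrite lee_fin mulrC ler_pdivrMr //.
  have h1 : rho <= 3 * C * h x (2 * inf S).
    have : theta x z <= C * h x (2 * inf S).
      apply: le_trans (hi x z) _; apply: ler_wpM2l; first exact: ltW.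
      by apply: h_mono; lra.
    by move: zr => /=; lra.
  have : rho `^ q <= (3 * C) `^ q * v x (2 * inf S).
    rewrite -hq -powRM ?mulr_ge0 ?(ltW C0) //.
    by apply: ge0_ler_powR; rewrite ?nnegrE ?(ltW q0) ?(ltW rho0) ?mulr_ge0 ?(ltW C0).
  move=> /le_trans; apply.
  have : v x (2 * inf S) <= A * 2 `^ q * v x (inf S).
    have := @v_hom x (inf S) (2 * inf S) i0; rewrite mulfK ?gt_eqF //; apply; lra.
  move=> hh; rewrite /K2 mulrC [leRHS]mulrC -mulrA mulrA.
  rewrite -(mulrA (A * 2 `^ q)) [(3 * C) `^ q * _]mulrC mulrA.
  by apply: ler_wpM2r; first exact: powR_ge0.
pose K := 1 + K1 + K2.
have K0 : 0 < K by rewrite !addr_gt0.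
exists (x0 : remetric theta), mu', K; split.
- by apply: finite_measure_radon => //; rewrite mu'E mu1 ltry.
- by rewrite /K -addrA lerDl addr_ge0 // ltW.
- move=> x rho rho0 rd; rewrite EE mu'E; apply/andP; split; last first.
    apply: le_trans (upper x rho rho0) _; rewrite lee_fin ler_pM2r ?powR_gt0 //.
    by rewrite lerDl ltW.
  (* As [rho] is at most the diameter, two points are more than [2 * rho / 3] apart, and one of them
     is at least [rho / 3] away from [x]. The factor below 1 avoids having to attain the
     diameter. *)
  have [||u [w [_ _ uw]]] := @diam_gt R (remetric theta) setT (2 * rho / 3).
  + by rewrite divr_ge0 // mulr_ge0 // ltW.
  + by apply: lt_le_trans rd; rewrite lte_fin; lra.
  change (is_true (2 * rho / 3 < theta u w)) in uw.
  have [z xz] : exists z, rho / 3 <= theta x z.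
    have [xu|xu] := leP (rho / 3) (theta x u); first by exists u.
    exists w; have := dist_triangle theta x u w; rewrite (dist_sym theta u x); lra.
  apply: le_trans (lower x rho z rho0 xz); rewrite lee_fin ler_pM2r ?powR_gt0 //.
  by rewrite lef_pV2 ?posrE // lerDr addr_ge0 // ltW.
Qed.

End Uniformization.

(** * From a packing bound to the conformal dimension *)

Section Compactness.
Context (R : realType) (M : metricType R).

Lemma quasisymmetric_compact (theta : distance R M) : compact [set: M] ->
  quasisymmetric (idfun : M -> remetric theta) -> compact [set: remetric theta].
Proof.
move=> cM [[_ [_ _ ci _]] _].
have := @continuous_compact M (remetric theta) idfun setT.
have -> : idfun @` [set: M] = [set: remetric theta] by apply/seteqP; split => // x _; exists x.
by apply => //; exact: continuous_subspaceT.
Qed.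

End Compactness.

Section Dimension.
Context (R : realType) (M : metricType R).

(** The homogeneous measure lives on [remetric theta], where the packing bound holds, and [qs_comp]
    brings the resulting distance back to [M]. Its Hausdorff dimension is bounded by passing once
    more from regularity to packing. *)
Lemma dim_AR_le (theta : distance R M) (p q C : R) : compact [set: M] ->
  (exists x y : M, x != y) -> uniformly_perfect M ->
  quasisymmetric (idfun : M -> remetric theta) ->
  0 <= p -> p < q -> 1 <= C -> packing theta p C -> (dim_AR M <= q%:E)%E.
Proof.
move=> cM two upM qs p0 pq C1 pk.
pose N : metricType R := remetric theta.
have cN : compact [set: N] := quasisymmetric_compact cM qs.
have upN : uniformly_perfect N := qs_uniformly_perfect upM qs.
have [x0 [y0 xy0]] := two.
have q0 : 0 < q := le_lt_trans p0 pq.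
have [mu [A [A1 mu1 hmu]]] := @exists_homogeneous R N p q C x0 cN p0 pq C1 pk.
have twoN : exists x y : N, x != y by exists x0, y0.
have [theta' [ar qs']] := exists_ahlfors_metric cN upN twoN q0 A1 mu1 hmu.
have cN' := quasisymmetric_compact cN qs'.
have [C' C'1 pk'] := ahlfors_packing cN' q0 ar.
have Hd : (hausdorff_dim (remetric (theta' : distance R M)) <= q%:E)%E.
  by apply: (packing_hausdorff (ltW q0) cN' _ pk'); exists x0.
rewrite /dim_AR; case: ifP => [_|_]; first by rewrite lee_fin ltW.
apply: le_trans Hd; apply: ereal_inf_lbound.
exists (theta' : distance R M) => //; split; first by exists q.
exact: (@qs_comp R M theta (theta' : distance R M) qs qs').
Qed.

End Dimension.

(** * Connected spaces and subspaces *)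

Section Connected.
Context (R : realType) (M : metricType R).

(** If the annulus were empty, the ball of radius [r] would be open and closed. *)
Lemma connected_annulus (x z : M) (r : R) : connected [set: M] -> 0 < r ->
  r <= mdist x z -> exists2 w, r / 2 <= mdist x w & mdist x w < r.
Proof.
move=> cM r0 rz; apply: contrapT => nw.
have gap w : mdist x w < r -> mdist x w < r / 2.
  by move=> xw; rewrite ltNge; apply/negP => H; apply: nw; exists w.
suff E : ball x r = [set: M].
  have : ball x r z by rewrite E.
  by rewrite mballE ltNge rz.
apply: cM.
- by exists x; rewrite mballE mdistxx.
- by exists (ball x r); rewrite ?setTI //; exact: open_mball.
- exists (ball x r); rewrite ?setTI // -(setCK (ball x r)).
  apply: open_closedC; apply/open_mdistP => y; rewrite /setC /= mballE => /negP.
  rewrite -leNgt => ry; exists (r / 2); first by rewrite divr_gt0.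
  move=> u yu; rewrite mballE => /gap xu.
  by have := metric_triangle x u y; rewrite (metric_sym u); lra.
Qed.

Lemma connected_uniformly_perfect : connected [set: M] -> uniformly_perfect M.
Proof.
move=> cM; exists 2; first by rewrite ltr1n.
move=> x r r0 [z /=]; rewrite mballE => /negP; rewrite -leNgt => rz.
have [w w1 w2] := connected_annulus cM r0 rz.
by exists w; split; rewrite mballE //; apply/negP; rewrite -leNgt.
Qed.

Lemma dim_AR_ge0 : (0 <= dim_AR M)%E.
Proof.
rewrite /dim_AR; case: ifP => // _; apply: le_ereal_inf_tmp => _ [theta _ <-].
by apply: le_ereal_inf_tmp => _ [s [s0 _] <-]; rewrite lee_fin ltW.
Qed.

(** The exponent of a regular distance is at most every [s] whose Hausdorff measure vanishes, hence
    below [p] for a distance that nearly attains the infimum; regularity then becomes a packing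
    bound with that exponent. *)
Lemma dim_AR_lt (p : R) : compact [set: M] -> (exists x y : M, x != y) ->
  (dim_AR M < p%:E)%E -> exists (theta : distance R M) (q C : R),
  [/\ 0 < q, q < p, 1 <= C, packing theta q C &
      quasisymmetric (idfun : M -> remetric theta)].
Proof.
move=> cM [x [y xy]]; rewrite /dim_AR; case: ifPn => [/asboolP[z zE]|_].
  have E (u : M) : u = z by have : [set: M] u by []; rewrite zE.
  by move: xy; rewrite (E x) (E y) eqxx.
move=> /ereal_inf_lt[_ [theta [[q q0 ar] qs] <-]].
move=> /ereal_inf_lt[_ [s [s0 hs] <-]]; rewrite lte_fin => sp.
have cN := quasisymmetric_compact cM qs.
have [C C1 pk] := ahlfors_packing cN q0 ar.
exists theta, q, C; split=> //; apply: le_lt_trans sp.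
by apply: (ahlfors_le_hausdorff cN _ ar s0 hs); exists x, y.
Qed.

End Connected.

Section Subspace.
Context (R : realType) (X : metricType R) (Y : set X).

Lemma compact_set_type : compact Y -> compact [set: set_type Y].
Proof.
move=> cY F PF _.
have FY : (set_val @ F : set_system X) Y.
  by apply: (@filterS _ F _ setT); [move=> a _; exact: set_valP|exact: filterT].
have [x [Yx clx]] := cY (set_val @ F) _ FY.
exists (SigSub (mem_set Yx) : set_type Y); split => // A B FA.
rewrite -filter_from_ballE => -[e /= e0 eB].
have [||z [[a Aa <-] za]] := clx (set_val @` A) (ball x e).
- by apply: (@filterS _ F _ A) => // a Aa; exists a.
- exact: nbhsx_ballx.
- by exists a; split => //; apply: eB; rewrite mballE; move: za; rewrite mballE.
Qed.

Definition restrict_fun (theta : distance R X) (a b : Y) : R :=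
  theta (set_val a) (set_val b).

Definition restrict (theta : distance R X) : distance R (set_type Y).
Proof.
refine (@Distance R (set_type Y) (restrict_fun theta) _ _ _ _).
- by move=> a; exact: distxx.
- by move=> a b h; apply: val_inj; exact: (dist_positivity h).
- by move=> a b; exact: dist_sym.
- by move=> b a c; exact: dist_triangle.
Defined.

Lemma packing_restrict (theta : distance R X) (q C : R) :
  packing theta q C -> packing (restrict theta) q C.
Proof.
move=> pk a rho r s r0 rr us s1 s2.
rewrite -(size_map set_val); apply: (pk (set_val a)) => //.
- by rewrite map_inj_uniq //; exact: val_inj.
- by move=> _ /mapP[b bs ->]; exact: (s1 b bs).
- move=> _ _ /mapP[b bs ->] /mapP[b' bs' ->] ne; apply: (s2 b b' bs bs').
  by apply: contraNneq ne => ->.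
Qed.

Lemma quasisymmetric_restrict (theta : distance R X) :
  quasisymmetric (idfun : X -> remetric theta) ->
  quasisymmetric (idfun : set_type Y -> remetric (restrict theta)).
Proof.
move=> [_ [eta deta H]]; apply: (qs_of_ineq deta) => a b c ab.
have ab' : set_val a != set_val b by apply: contraNneq ab => /val_inj ->.
exact: (H _ _ (set_val c) ab').
Qed.

Lemma dim_AR_subset : Y !=set0 -> compact [set: X] -> closed Y -> connected [set: set_type Y] ->
  (dim_AR (set_type Y) <= dim_AR X)%E.
Proof.
move=> [y0 Yy0] cX clY coY.
have [[a [b ab]]|one] := pselect (exists a b : Y, a != b); last first.
  pose a : set_type Y := SigSub (mem_set Yy0).
  rewrite {1}/dim_AR ifT ?dim_AR_ge0 //; apply/asboolP; exists a.
  apply/seteqP; split => // b _ /=; apply/eqP/negPn/negP => ba.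
  by apply: one; exists b, a.
have cY : compact [set: set_type Y].
  by apply: compact_set_type; exact: subclosed_compact clY cX _.
apply/lee_addgt0Pr => e e0.
case E : (dim_AR X) => [t| |]; last 2 first.
- by rewrite addye // leey.
- by have := dim_AR_ge0 X; rewrite E.
have lt : (dim_AR X < (t + e)%:E)%E by rewrite E lte_fin ltrDl.
have [|theta [q [C [q0 qt C1 pk qs]]]] := dim_AR_lt cX _ lt.
  by exists (set_val a), (set_val b); apply: contraNneq ab => /val_inj ->.
apply: (@dim_AR_le _ _ (restrict theta) q (t + e) C) => //.
- by exists a, b.
- exact: connected_uniformly_perfect.
- exact: quasisymmetric_restrict.
- exact: ltW.
- exact: packing_restrict.
Qed.

End Subspace.

(** * Gluing distances along nested partitions *)

Section Representatives.
Context (T : eqType).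

(** No transitivity is assumed: [G] is a maximal set of pairwise unrelated elements. This is needed
    for relations such as being closer than [u]. *)
Lemma greedy_representatives (e : rel T) (s : seq T) : symmetric e ->
  {in s, forall x, e x x} -> uniq s ->
  exists G : seq T, [/\ uniq G, {subset G <= s},
    {in G &, forall x y, x != y -> ~~ e x y} &
    {in s, forall x, exists2 y, y \in G & e y x}].
Proof.
move=> es; elim: s => [|a s IH] er /=; first by exists [::].
move=> /andP[as_ us]; have [|G [uG Gs Gn Gc]] := IH _ us.
  by move=> x xs; apply: er; rewrite inE xs orbT.
have [/hasP[y yG ya]|/hasPn nG] := boolP (has (fun y => e y a) G).
  exists G; split => // x.
    by move=> /Gs xs; rewrite inE xs orbT.
  by rewrite inE => /orP[/eqP ->|]; [exists y|exact: Gc].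
exists (a :: G); split => /=.
- by rewrite uG andbT; apply: contraNN as_ => /Gs.
- by move=> x; rewrite !inE => /orP[->//|/Gs ->]; rewrite orbT.
- move=> x y; rewrite !inE => /orP[/eqP ->|xG] /orP[/eqP ->|yG].
  + by rewrite eqxx.
  + by move=> _; rewrite es nG.
  + by move=> _; exact: nG.
  + exact: Gn.
- move=> x; rewrite inE => /orP[/eqP ->|xs].
    by exists a; rewrite ?inE ?eqxx // er // inE eqxx.
  by have [y yG yx] := Gc x xs; exists y => //; rewrite inE yG orbT.
Qed.

Lemma size_le_cover (e : rel T) (s G : seq T) :
  {in s, forall x, exists2 y, y \in G & e y x} ->
  (size s <= \sum_(y <- G) size [seq x <- s | e y x])%N.
Proof.
elim: s => [|a s IH] H //=.
have {}IH := IH _; rewrite (@leq_trans (1 + \sum_(y <- G) size [seq x <- s | e y x])) //.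
  by rewrite add1n ltnS IH // => x xs; apply: H; rewrite inE xs orbT.
have [y yG ya] := H a (mem_head _ _).
rewrite (big_rem y) //= [leqRHS](big_rem y) //= ya /= addnA add1n leq_add //.
apply: leq_sum => z _; case: ifP => // _; exact: leqnSn.
Qed.

End Representatives.

(* E i x y says that x and y belong to the same node of generation i. On such a
   node tau i is a pseudodistance between its children, which are the nodes of
   generation i.+1, and g i x is the size of the child of x relative to the node.
   Points may belong to no node of generation i.+1: the child is then a point. *)
Section Gluing.
Context (R : realType) (T : choiceType).
Variables (E : nat -> T -> T -> Prop) (tau : nat -> T -> T -> R)
  (g : nat -> T -> R) (eta : R).
Hypotheses (E0 : forall x y, E 0 x y)
  (Esym : forall i x y, E i x y -> E i y x)
  (Etrans : forall i x y z, E i x y -> E i y z -> E i x z)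
  (ES : forall i x y, E i.+1 x y -> E i x y)
  (tau_sym : forall i x y, E i x y -> tau i x y = tau i y x)
  (tau_tri : forall i x y z, E i x y -> E i y z -> tau i x z <= tau i x y + tau i y z)
  (tau_le1 : forall i x y, E i x y -> tau i x y <= 1)
  (tau_const : forall i x y z, E i x y -> E i.+1 y z -> tau i x y = tau i x z)
  (g_const : forall i x y, E i.+1 x y -> g i x = g i y)
  (g_ge0 : forall i x, 0 <= g i x)
  (g_gt0 : forall i x, E i.+1 x x -> 0 < g i x)
  (g_le : forall i x y, E i x y -> g i x <= tau i x y)
  (eta01 : 0 < eta <= 2^-1)
  (tau_end : forall i x, E i x x -> ~ E i.+1 x x -> tau i x x = 0)
  (separate : forall x y, x <> y -> exists i, [/\ E i x y, ~ E i.+1 x y & 0 < tau i x y]).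

(** The absolute size of the node of [x], as a product of relative sizes with one factor [eta] per
    generation. It is the unit in which [tau i] is measured. *)
Fixpoint glue_size i x : R :=
  if i is j.+1 then eta * glue_size j x * g j x else 1.
Local Notation sig := glue_size.

Let eta0 : 0 < eta. Proof. by case/andP: eta01. Qed.
Let eta2 : eta <= 2^-1. Proof. by case/andP: eta01. Qed.

Let Ele i j x y : (i <= j)%N -> E j x y -> E i x y.
Proof.
move=> /subnK <-; elim: (j - i)%N => // n IH; rewrite addSn => /ES; exact: IH.
Qed.

Let Erefl i x y : E i x y -> E i x x.
Proof. by move=> h; apply: Etrans h (Esym h). Qed.

Lemma glue_size_const i x y : E i x y -> sig i x = sig i y.
Proof.
elim: i => //= i IH h; rewrite (g_const h) IH //; exact: ES.
Qed.

Lemma glue_size_gt0 i x : E i x x -> 0 < sig i x.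
Proof.
elim: i => //= i IH h; rewrite !mulr_gt0 ?g_gt0 // IH //; exact: ES.
Qed.

Let sig_ge0 i x : 0 <= sig i x.
Proof. by elim: i => //= i IH; rewrite !mulr_ge0 // ltW. Qed.

Let tau_ge0 i x y : E i x y -> 0 <= tau i x y.
Proof. by move=> h; apply: le_trans (g_le h). Qed.

Let g_le1 i x : E i x x -> g i x <= 1.
Proof. by move=> h; apply: le_trans (g_le h) (tau_le1 h). Qed.

Let sigS i x : sig i.+1 x <= sig i x * g i x.
Proof.
rewrite /= -mulrA ler_piMl ?mulr_ge0 //; apply: le_trans eta2 _.
by rewrite invf_le1 // ler1n.
Qed.

Let vals x y := [set sig i x * tau i x y | i in [set i | E i x y]].
(** For distinct points the infimum is attained at the last common generation ([th_last]). Defining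
    the distance as an infimum gives 0 on the diagonal, even when a point has nodes of all
    generations, and allows the triangle inequality to be checked for arbitrary generations of the
    two pairs. *)
Let th x y := inf (vals x y).

Let vals_inf x y : has_inf (vals x y).
Proof.
split; first by exists (sig 0 x * tau 0 x y), 0%N.
by exists 0 => _ [i /= h <-]; rewrite mulr_ge0 // tau_ge0.
Qed.

Let th_le i x y : E i x y -> th x y <= sig i x * tau i x y.
Proof. by move=> h; apply: ge_inf; [case: (vals_inf x y)|exists i]. Qed.

Let th_ge x y r : (forall i, E i x y -> r <= sig i x * tau i x y) -> r <= th x y.
Proof.
move=> H; apply: lb_le_inf; first by case: (vals_inf x y).
by move=> _ [i /= h <-]; exact: H.
Qed.

(** The chain is [sig i.+1 * tau i.+1 <= sig i.+1 <= sig i * g i <= sig i * tau i]: distances inside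
    a child do not exceed the size of the child, nor does this size exceed the distance to any point
    of the node. *)
Let sig_anti i k x y : E (i + k)%N x y -> E i x y ->
  sig (i + k)%N x * tau (i + k)%N x y <= sig i x * tau i x y.
Proof.
elim: k => [|k IH]; first by rewrite addn0.
rewrite addnS => h hi; apply: le_trans (IH (ES h) hi).
apply: (@le_trans _ _ (sig (i + k).+1 x)).
  by rewrite ler_piMr // tau_le1.
apply: le_trans (sigS _ _) _; apply: ler_wpM2l => //; apply: g_le; exact: ES.
Qed.

Let th_last i x y : E i x y -> ~ E i.+1 x y -> th x y = sig i x * tau i x y.
Proof.
move=> h nh; apply/eqP; rewrite eq_le th_le //=; apply: th_ge => j hj.
have ji : (j <= i)%N by rewrite leqNgt; apply/negP => /Ele/(_ hj).
by rewrite -(subnKC ji); apply: sig_anti; rewrite ?subnKC.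
Qed.

Lemma exists_glued_distance : exists theta : distance R T,
  (forall i x y, E i x y -> ~ E i.+1 x y -> theta x y = sig i x * tau i x y) /\
  (forall i x y, E i x y -> theta x y <= sig i x).
Proof.
have th_ge0 x y : 0 <= th x y.
  by apply: th_ge => i h; rewrite mulr_ge0 // tau_ge0.
have sig_pow i x : (forall i, E i x x) -> sig i x <= 2^-1 ^+ i.
  move=> H; elim: i => //= i IH; rewrite exprS -mulrA ler_pM ?mulr_ge0 ?(ltW eta0) //.
  by apply: le_trans IH; rewrite ler_piMr // g_le1.
have thxx x : th x x = 0.
  apply/eqP; rewrite eq_le th_ge0 andbT; apply/ler_addgt0Pr => e e0; rewrite add0r.
  have [H|/existsNP[j nj]] := pselect (forall i, E i x x).
    have [|n hn] := @exists_geom_lt R 2 1 e _ ltr01 e0; first by [].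
    apply: le_trans (th_le (H n)) _; apply: (@le_trans _ _ (sig n x)).
      by rewrite ler_piMr // tau_le1.
    by apply: le_trans (sig_pow n x H) _; rewrite exprVn -div1r ltW.
  have [i [hi nhi]] : exists i, E i x x /\ ~ E i.+1 x x.
    elim: j nj => [|j IH] nj; first by case: nj.
    by have [h|/IH] := pselect (E j x x); first by exists j.
  by apply: le_trans (th_le hi) _; rewrite tau_end // mulr0 ltW.
have thpos x y : th x y = 0 -> x = y.
  move=> e; apply: contrapT => /separate[i [h nh t0]].
  move: e; rewrite (th_last h nh) => /eqP; rewrite mulf_eq0 !gt_eqF //.
  by apply: glue_size_gt0; exact: Erefl h.
have thsym x y : th x y = th y x.
  suff H a b : th a b <= th b a by apply/eqP; rewrite eq_le !H.
  apply: th_ge => i h; rewrite (glue_size_const h) tau_sym //.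
  by apply: th_le; exact: Esym.
have thtri y x z : th x z <= th x y + th y z.
  (* If the generations differ, the pair with the deeper one lies in a single child of the other
     node, and [tau_const] exchanges its points. Only equal generations require [tau_tri]. *)
  suff H i j : E i x y -> E j y z ->
      th x z <= sig i x * tau i x y + sig j y * tau j y z.
    rewrite -lerBlDr; apply: th_ge => i h; rewrite lerBlDr -lerBlDl.
    by apply: th_ge => j h'; rewrite lerBlDl; exact: H.
  move=> hi hj.
  have p1 : 0 <= sig i x * tau i x y by rewrite mulr_ge0 // tau_ge0.
  have p2 : 0 <= sig j y * tau j y z by rewrite mulr_ge0 // tau_ge0.
  have [ij|ji|ij] := ltngtP i j.
  - have h : E i.+1 y z by exact: Ele hj.
    have hz : E i x z by apply: Etrans hi _; exact: ES.
    by apply: le_trans (th_le hz) _; rewrite -(tau_const hi h) lerDl.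
  - have h : E j.+1 x y by exact: Ele hi.
    have hz : E j x z by apply: Etrans _ hj; exact: ES.
    apply: le_trans (th_le hz) _; rewrite (tau_sym hz).
    rewrite -(tau_const (Esym hj) (Esym h)) (tau_sym (Esym hj)).
    by rewrite (glue_size_const (ES h)) lerDr.
  - rewrite -ij in hj p2 *; apply: le_trans (th_le (Etrans hi hj)) _.
    rewrite -(glue_size_const hi) -mulrDr; apply: ler_wpM2l => //.
    exact: tau_tri.
exists (Distance thxx thpos thsym thtri); split => /=; first exact: th_last.
by move=> i x y h; apply: le_trans (th_le h) _; rewrite ler_piMr // tau_le1.
Qed.

Variables (p Ca Cb : R) (theta : distance R T).
Hypotheses (p0 : 0 < p) (Ca1 : 1 <= Ca) (Cb0 : 0 <= Cb) (etaCb : eta `^ p * Cb <= 2^-1)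
  (packA : forall i rho r s, 0 < r -> r <= rho -> uniq s ->
     {in s &, forall x y, E i x y} ->
     {in s &, forall x y, x != y -> ~ E i.+1 x y} ->
     {in s &, forall x y, x != y -> r <= tau i x y <= rho} ->
     (size s)%:R <= Ca * (rho / r) `^ p)
  (packB : forall i rho s, 0 < rho -> uniq s ->
     {in s &, forall x y, E i x y} ->
     {in s &, forall x y, x != y -> ~ E i.+1 x y} ->
     {in s, forall x, g i x <= rho} ->
     {in s &, forall x y, x != y -> tau i x y <= rho} ->
     \sum_(x <- s) g i x `^ p <= Cb * rho `^ p)
  (theta_last : forall i x y, E i x y -> ~ E i.+1 x y -> theta x y = sig i x * tau i x y)
  (theta_le : forall i x y, E i x y -> theta x y <= sig i x).

Let K := 2 * Ca.

(** Points whose child is smaller than [r], or which have none, lie in different children and are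
    counted by [packA]. The points in the larger children are counted by [IH], one representative
    [y] in [G] for each child, and the bounds are summed by [packB]. As [eta^p * Cb <= 2^-1], this
    second part is at most [K / 2 = Ca] times the power, and the recursion closes with
    [K = 2 * Ca]. *)
Let step i rho r s x0 : 0 < r -> x0 \in s -> uniq s ->
  {in s &, forall x y, E i x y} ->
  {in s &, forall x y, x != y -> r <= theta x y} ->
  0 < rho -> r <= rho * sig i x0 ->
  {in s, forall x, g i x <= rho} ->
  {in s &, forall x y, ~ E i.+1 x y -> tau i x y <= rho} ->
  (forall s' y, y \in s -> y \in s' -> uniq s' -> {subset s' <= s} ->
    {in s' &, forall x y, E i.+1 x y} -> r <= sig i.+1 y ->
    (size s')%:R <= K * (sig i.+1 y / r) `^ p) ->
  (size s)%:R <= K * (rho * sig i x0 / r) `^ p.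
Proof.
move=> r0 x0s us sE ss rho0 rs gs ts IH.
set sg := sig i x0.
have sg0 : 0 < sg by apply: glue_size_gt0; exact: sE.
have sgE x : x \in s -> sig i x = sg by move=> xs; apply: glue_size_const; exact: sE.
pose P x := `[< E i.+1 x x >] && (r <= sig i.+1 x).
pose s1 := [seq x <- s | ~~ P x]; pose s2 := [seq x <- s | P x].
have -> : size s = (size s1 + size s2)%N by rewrite !size_filter addnC count_predC.
rewrite natrD.
have W0 : 0 <= (rho * sg / r) `^ p by exact: powR_ge0.
have W1 : 1 <= (rho * sg / r) `^ p.
  by apply: powR_ge1; [rewrite ler_pdivlMr // mul1r|exact: ltW].
have h1 : (size s1)%:R <= Ca * (rho * sg / r) `^ p.
  have nE : {in s1 &, forall x y, x != y -> ~ E i.+1 x y}.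
    move=> x y; rewrite !mem_filter => /andP[nPx xs] /andP[nPy ys] xy exy.
    move/negP: nPx; apply; rewrite /P; apply/andP; split.
      by apply/asboolP; exact: Erefl exy.
    by apply: le_trans (ss x y xs ys xy) (theta_le exy).
  have [|s1r] := ltP (rho * sg) r; first by rewrite ltNge rs.
  have -> : rho * sg / r = rho / (r / sg) by field; rewrite !gt_eqF.
  apply: (packA (i := i)) => //.
  - by rewrite divr_gt0.
  - by rewrite ler_pdivrMr.
  - by rewrite filter_uniq.
  - by move=> x y; rewrite !mem_filter => /andP[_ xs] /andP[_ ys]; exact: sE.
  - move=> x y xs1 ys1 xy; have nxy := nE x y xs1 ys1 xy.
    move: xs1 ys1; rewrite !mem_filter => /andP[_ xs] /andP[_ ys].
    rewrite ts // andbT ler_pdivrMr // mulrC -(sgE x xs).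
    by rewrite -theta_last //; [exact: ss|exact: sE].
have h2 : (size s2)%:R <= Ca * (rho * sg / r) `^ p.
  pose e x y := (x == y) || `[< E i.+1 x y >].
  have es : symmetric e.
    move=> x y; rewrite /e eq_sym; congr (_ || _).
    by apply/asboolP/asboolP; exact: Esym.
  have us2 : uniq s2 by rewrite filter_uniq.
  have [|G [uG Gs Gn Gc]] := greedy_representatives es _ us2.
    by move=> x _; rewrite /e eqxx.
  have Gss x : x \in G -> x \in s by move=> /Gs; rewrite mem_filter => /andP[].
  have GP x : x \in G -> E i.+1 x x /\ r <= sig i.+1 x.
    by move=> /Gs; rewrite mem_filter => /andP[/andP[/asboolP ? ?] _].
  have := size_le_cover Gc; rewrite -(ler_nat R) natr_sum => /le_trans; apply.
  apply: (@le_trans _ _ (\sum_(y <- G) K * (eta * sg / r) `^ p * g i y `^ p)).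
    rewrite big_seq [leRHS]big_seq; apply: ler_sum => y yG.
    have [yy ry] := GP y yG; have ys := Gss y yG.
    have sy : sig i.+1 y = eta * sg * g i y by rewrite /= sgE.
    rewrite -mulrA -powRM ?divr_ge0 ?mulr_ge0 ?(ltW eta0) ?(ltW sg0) ?(ltW r0) //.
    have -> : eta * sg / r * g i y = sig i.+1 y / r by rewrite sy mulrAC.
    have eE x : x \in [seq x <- s2 | e y x] -> E i.+1 y x.
      by rewrite mem_filter /e => /andP[/orP[/eqP <-//|/asboolP]].
    apply: IH => //.
    - by rewrite mem_filter /e eqxx /=; exact: Gs.
    - by rewrite filter_uniq.
    - by move=> x; rewrite !mem_filter => /andP[_ /andP[]].
    - by move=> a b /eE ya /eE yb; apply: Etrans yb; exact: Esym.
  rewrite -mulr_sumr.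
  have sumG : \sum_(y <- G) g i y `^ p <= Cb * rho `^ p.
    have nE : {in G &, forall x y, x != y -> ~ E i.+1 x y}.
      move=> x y xG yG xy exy; have := Gn x y xG yG xy.
      by rewrite /e (negbTE xy) /= => /asboolP.
    apply: packB => //.
    - by move=> x y /Gss xs /Gss ys; exact: sE.
    - by move=> x /Gss; exact: gs.
    - by move=> x y xG yG xy; apply: ts; [exact: Gss|exact: Gss|exact: nE].
  have K0 : 0 <= K by rewrite mulr_ge0 // (le_trans ler01).
  apply: (@le_trans _ _ (K * (eta * sg / r) `^ p * (Cb * rho `^ p))).
    by apply: ler_wpM2l => //; rewrite mulr_ge0 // powR_ge0.
  have -> : eta * sg / r = eta * (sg / r) by rewrite mulrA.
  have sr : 0 <= sg / r by rewrite divr_ge0 // ltW.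
  rewrite -(mulrA rho) (powRM _ (ltW eta0) sr) (powRM _ (ltW rho0) sr).
  have -> : K * (eta `^ p * (sg / r) `^ p) * (Cb * rho `^ p) =
    (2 * (eta `^ p * Cb)) * (Ca * (rho `^ p * (sg / r) `^ p)) by rewrite /K; ring.
  rewrite ler_piMl //; last by have := etaCb; lra.
  by rewrite !mulr_ge0 ?powR_ge0 // (le_trans ler01).
apply: le_trans (lerD h1 h2) _; rewrite /K; lra.
Qed.

(** Sizes are at least halved from one generation to the next, so the induction runs on the number
    [n] of halvings possible before the size falls below [r]. *)
Let node_bound n i r s x0 : 0 < r -> x0 \in s -> uniq s ->
  {in s &, forall x y, E i x y} ->
  {in s &, forall x y, x != y -> r <= theta x y} ->
  r <= sig i x0 -> sig i x0 <= r * 2 ^+ n ->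
  (size s)%:R <= K * (sig i x0 / r) `^ p.
Proof.
elim: n i s x0 => [|n IH] i s x0 r0 x0s us sE ss rs sn.
all: have sgE x : x \in s -> sig i x = sig i x0
  by move=> xs; apply: glue_size_const; exact: sE.
all: have sg0 : 0 < sig i x0 by exact: lt_le_trans rs.
all: have sS y : y \in s -> sig i.+1 y <= sig i x0 / 2
  by move=> ys; rewrite /= sgE // -mulrA mulrCA ler_pM2l //;
     rewrite -[leRHS]mulr1 ler_pM ?(ltW eta0) ?g_le1 //; exact: sE.
all: rewrite -[X in (X / r) `^ p]mul1r; apply: step => //; rewrite ?mul1r //.
all: try by move=> x xs; apply: g_le1; exact: sE.
all: try by move=> x y xs ys _; apply: tau_le1; exact: sE.
- move=> s' y ys _ _ _ _ ry; have := sS y ys; move: sn ry; rewrite expr0 mulr1; lra.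
- move=> s' y ys ys' us' ss' sE' ry; apply: IH => //.
  + by move=> a b /ss' as_ /ss' bs; exact: ss.
  + by apply: le_trans (sS y ys) _; move: sn; rewrite exprS; lra.
Qed.

Lemma glued_packing : packing theta p (K * 2 `^ p).
Proof.
have K1 : 1 <= K by rewrite /K; have := Ca1; lra.
have p2 : 1 <= 2 `^ p :> R by apply: powR_ge1; [rewrite ler1n|exact: ltW].
move=> x rho r s r0 rr us s1 s2.
have rho0 : 0 < rho := lt_le_trans r0 rr.
have W : 1 <= (rho / r) `^ p.
  by apply: powR_ge1; [rewrite ler_pdivlMr // mul1r|exact: ltW].
have [s_le1|s_gt1] := leqP (size s) 1.
  by apply: (@le_trans _ _ 1); [rewrite lern1|apply: mulr_ege1 => //; exact: mulr_ege1].
have [a [b [as_ bs ab]]] : exists a b, [/\ a \in s, b \in s & a != b].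
  case: s us s_gt1 {s1 s2} => [|a [|b s]] //= /andP[ab _] _.
  exists a, b; rewrite !inE !eqxx orbT; split => //.
  by apply: contraNneq ab => ->; rewrite inE eqxx.
have ex : exists i, ~~ `[< {in s &, forall x y, E i x y} >].
  have /separate[i [_ n _]] : a <> b by exact/eqP.
  by exists i.+1; apply/negP => /asboolP H; apply: n; exact: H.
(* [i] is the last generation at which all of [s] lies in one node. There [theta] is [sig i * tau i]
   between different children, so [step] applies with the relative radius [2 * rho / sg]. *)
case: (ex_minnP ex) => -[|i] ni imin.
  by move/negP: ni; case; apply/asboolP => u v _ _; exact: E0.
have sE : {in s &, forall x y, E i x y}.
  by apply: contrapT => h; have := imin i; rewrite ltnn => H; apply: notF; apply: H; apply/asboolPn.
have [u [v [us_ vs uv]]] : exists u v, [/\ u \in s, v \in s & ~ E i.+1 u v].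
  apply: contrapT => H; move/negP: ni; apply; apply/asboolP => u v us_ vs.
  by apply: contrapT => uv; apply: H; exists u, v.
set sg := sig i a.
have sg0 : 0 < sg by apply: glue_size_gt0; exact: sE.
have sgE y : y \in s -> sig i y = sg by move=> ys; apply: glue_size_const; exact: sE.
have th2 y z : y \in s -> z \in s -> theta y z <= 2 * rho.
  move=> ys zs; apply: le_trans (dist_triangle theta x y z) _.
  by rewrite (dist_sym theta y x); have := s1 y ys; have := s1 z zs; lra.
have tle y z : y \in s -> z \in s -> ~ E i.+1 y z -> tau i y z <= 2 * rho / sg.
  move=> ys zs n; rewrite ler_pdivlMr // mulrC -(sgE y ys).
  by rewrite -theta_last; [exact: th2|exact: sE|].
have r2 : 0 < 2 * rho / sg by rewrite divr_gt0 // mulr_gt0.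
have sgK : 2 * rho / sg * sg = 2 * rho by rewrite divfK // gt_eqF.
have : (size s)%:R <= K * (2 * rho / sg * sg / r) `^ p.
  apply: step => //.
  - by rewrite -/sg sgK; have := rr; lra.
  (* The child of [y] differs from that of [u] or from that of [v], so its size is bounded by a
     distance between two children. *)
  - move=> y ys; have [yu|nyu] := pselect (E i.+1 y u); last first.
      by apply: le_trans (g_le (sE y u ys us_)) _; exact: tle.
    apply: le_trans (g_le (sE y v ys vs)) _; apply: tle => // yv.
    by apply: uv; apply: Etrans yv; exact: Esym.
  - move=> s' y ys ys' us' ss' sE' ry.
    have [n hn] : exists n, sig i.+1 y <= r * 2 ^+ n.
      have ss0 : 0 < sig i.+1 y by exact: lt_le_trans ry.
      have [|n hn] := @exists_geom_lt R 2 (sig i.+1 y) r _ ss0 r0; first by [].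
      by exists n; rewrite -ler_pdivrMr ?exprn_gt0 // ltW.
    apply: node_bound hn => //.
    by move=> c d /ss' cs /ss' ds; exact: s2.
rewrite sgK => /le_trans; apply.
rewrite -!mulrA -powRM ?divr_ge0 ?(ltW rho0) ?(ltW r0) //.
Qed.

End Gluing.

(** * Uniform constants and positive distances *)

Section FiniteUniform.
Context (R : realType).

Lemma finite_uniform_pos (T : eqType) (s : seq T) (P : T -> R -> Prop) :
  (forall t c c', 0 < c' -> c' <= c -> P t c -> P t c') ->
  (forall t, t \in s -> exists2 c, 0 < c & P t c) ->
  exists2 c, 0 < c & forall t, t \in s -> P t c.
Proof.
move=> mono; elim: s => [|a s IH] H; first by exists 1.
have [c c0 hc] := IH (fun t ts => H t (mem_behead (s := a :: s) ts)).
have [c' c'0 hc'] := H a (mem_head _ _).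
have m0 : 0 < Num.min c c' by rewrite lt_min c0.
exists (Num.min c c') => // t; rewrite inE => /orP[/eqP ->|ts].
  by apply: mono hc' => //; rewrite ge_min lexx orbT.
by apply: mono (hc t ts) => //; rewrite ge_min lexx.
Qed.

Lemma disjoint_closed_dist (M : metricType R) (A B : set M) : compact [set: M] ->
  closed A -> closed B -> A `&` B = set0 ->
  exists2 c, 0 < c & forall u v, A u -> B v -> c <= mdist u v.
Proof.
move=> cM cA cB AB; apply: contrapT => H.
have {}H n : exists uv : M * M, [/\ A uv.1, B uv.2 & mdist uv.1 uv.2 < n.+1%:R^-1].
  apply: contrapT => nH; apply: H; exists n.+1%:R^-1; first by rewrite invr_gt0.
  by move=> u v Au Bv; rewrite leNgt; apply/negP => uv; apply: nH; exists (u, v).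
have [f fP] := choice H.
have [x xP] := compact_cluster_seq (fun n => (f n).1) cM.
suff : (A `&` B) x by rewrite AB.
split; apply: closed_mdist => // e e0.
  by have [n _ xn] := xP e 0%N e0; have [Au _ _] := fP n; exists (f n).1.
have e2 : 0 < e / 2 by rewrite divr_gt0.
have [N _ HN] := near_infty_natSinv_lt (PosNum e2).
have [n Nn xn] := xP (e / 2) N e2; have [_ Bv uv] := fP n.
exists (f n).2 => //; apply: le_lt_trans (metric_triangle _ (f n).1 _) _.
have h : n.+1%:R^-1 < e / 2 := HN n Nn.
by rewrite (splitr e); apply: ltrD; [exact: xn|exact: lt_trans uv h].
Qed.

Lemma lipschitz_within (M N : metricType R) (A : set M) (f : M -> N) (L : R) :
  (forall y z, A y -> A z -> mdist (f y) (f z) <= L * mdist y z) ->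
  {within A, continuous f}.
Proof.
move=> H; apply/subspace_continuousP => x Ax.
apply/(@metricType_numDomainType.cvgrPdist_lt R N) => e e0.
have L1 : 0 < `|L| + 1 by rewrite ltr_wpDl.
have d0 : 0 < e / (`|L| + 1) by rewrite divr_gt0.
rewrite /prop_near1 /within /=; apply: filterS (nbhsx_ballx x _ d0) => y.
rewrite mballE => xy Ay; apply: le_lt_trans (H x y Ax Ay) _.
apply: (@le_lt_trans _ _ ((`|L| + 1) * mdist x y)).
  apply: ler_wpM2r; first exact: mdist_ge0.
  by have := ler_norm L; lra.
by rewrite mulrC -ltr_pdivlMr.
Qed.

End FiniteUniform.

(** * Relative separation of the components *)

Section Components.
Context (R : realType) (X : metricType R).
Implicit Types x y z u v : X.

Definition same x y := connected_component [set: X] x y.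

Lemma same_refl x : same x x. Proof. exact: connected_component_refl. Qed.
Lemma same_sym x y : same x y -> same y x. Proof. exact: connected_component_sym. Qed.
Lemma same_trans x y z : same x y -> same y z -> same x z.
Proof. exact: connected_component_trans. Qed.
Lemma same_connected (J : set X) x y : connected J -> J x -> J y -> same x y.
Proof. by move=> cJ Jx Jy; exists J. Qed.

Hypothesis cX : compact [set: X].

Lemma closed_component x : closed (connected_component [set: X] x).
Proof. by apply: component_closed; exact: closedT. Qed.

(** Finitely many pairwise disjoint compact sets have a positive minimal distance. The statement
    speaks of points with distant partners because this is what a blow-up provides. *)
Lemma components_separation (delta : R) : 0 < delta ->
  finite_set [set Y : set X | components X Y /\ (delta%:E <= diam Y)%E] ->
  exists2 c, 0 < c & forall u u' v v', same u u' -> delta <= mdist u u' ->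
    same v v' -> delta <= mdist v v' -> mdist u v < c -> same u v.
Proof.
move=> d0 /finite_seqP[s sE].
have big u u' : same u u' -> delta <= mdist u u' ->
    connected_component [set: X] u \in s.
  move=> uu' du.
  suff : [set` s] (connected_component [set: X] u) by [].
  rewrite -sE; split; first by exists u.
  apply: le_trans (mdist_le_diam (same_refl u) uu').
  by rewrite lee_fin.
pose P (t : set X * set X) c := t.1 `&` t.2 = set0 ->
  forall u v, t.1 u -> t.2 v -> c <= mdist u v.
have [||c c0 H] := @finite_uniform_pos R _ [seq (a, b) | a <- s, b <- s] P.
- by move=> t c c' _ cc' H e u v tu tv; apply: le_trans cc' (H e u v tu tv).
- move=> t /allpairsP[[a b] /= [as_ bs ->]].
  have cl a' : a' \in s -> closed a'.
    move=> a's; have : [set` s] a' by [].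
    by rewrite -sE => -[[x _ <-] _]; exact: closed_component.
  have [e|ne] := pselect (a `&` b = set0); last by exists 1 => // e; case: ne.
  have [c c0 h] := disjoint_closed_dist cX (cl a as_) (cl b bs) e.
  by exists c => // _; exact: h.
exists c => // u u' v v' uu' du vv' dv uv.
have us := big u u' uu' du; have vs := big v v' vv' dv.
apply: contrapT => nuv.
have := H (connected_component [set: X] u, connected_component [set: X] v) _.
rewrite allpairs_f // => /(_ isT) h.
have : c <= mdist u v; last by rewrite leNgt uv.
apply: h => /=; [|exact: same_refl|exact: same_refl].
rewrite -subset0 => z [uz vz]; apply: nuv; apply: same_trans uz _; exact: same_sym.
Qed.

(** The factor 2 pays for replacing the infimum by an actual connected set. *)
Lemma linear_connection (K : R) x y : 1 <= K ->
  (forall Y : set X, components X Y -> linearly_connected K (set_type Y)) ->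
  same x y -> exists J : set X, [/\ connected J, J x, J y &
    forall a b, J a -> J b -> mdist a b <= 2 * K * mdist x y].
Proof.
move=> K1 H xy.
have [<-|nxy] := eqVneq x y.
  exists [set x]; split => //; first exact: connected1.
  by move=> a b -> ->; rewrite mdistxx mulr0.
pose Y := connected_component [set: X] x.
have [_ HY] := H Y (ex_intro2 _ _ x Logic.I erefl).
pose x' : Y := SigSub (mem_set (same_refl x)); pose y' : Y := SigSub (mem_set xy).
have d0 : 0 < mdist x y by rewrite mdist_gt0.
have := HY (mdist x y) x' y' d0 _ (lexx _).
move=> /(_ (mdist_le_diam (x := x') (y := y') Logic.I Logic.I)) h.
have : (ereal_inf [set diam J | J in
    [set J : set Y | [/\ connected J, J x' & J y']]] < (2 * K * mdist x y)%:E)%E.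
  apply: le_lt_trans h _; rewrite lte_fin ltr_pM2r //.
  by rewrite ltr_pMl ?ltr1n // (lt_le_trans ltr01).
move=> /ereal_inf_lt[_ [J [cJ Jx Jy] <-] dJ].
exists (set_val @` J); split.
- apply: connected_continuous_connected => //.
  apply: (@lipschitz_within R _ _ _ _ 1) => a b _ _; by rewrite mul1r.
- by exists x'.
- by exists y'.
- move=> _ _ [a Ja <-] [b Jb <-].
  have := ltW dJ => /diam_leP; apply => //.
  by rewrite !mulr_ge0 ?mdist_ge0 // (le_trans ler01).
Qed.

Lemma component_annulus x z (r : R) : 
  (forall Y : set X, components X Y -> connected [set: set_type Y]) ->
  same x z -> 0 < r -> r <= mdist x z ->
  exists w, [/\ same x w, r / 2 <= mdist x w & mdist x w < r].
Proof.
move=> H xz r0 rz.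
pose Y := connected_component [set: X] x.
have cY := H Y (ex_intro2 _ _ x Logic.I erefl).
pose x' : Y := SigSub (mem_set (same_refl x)); pose z' : Y := SigSub (mem_set xz).
have [w w1 w2] := @connected_annulus R (set_type Y) x' z' r cY r0 rz.
by exists (set_val w); split => //; exact: set_valP.
Qed.

End Components.

Section RelativeSeparation.
Context (R : realType) (X : metricType R) (D0 Kl : R).
Hypotheses (cX : compact [set: X]) (bD : forall x y : X, mdist x y <= D0)
  (Kl1 : 1 <= Kl) (diamX : diam [set: X] = D0%:E)
  (ass : approximately_self_similar X)
  (lin : forall Y : set X, components X Y -> linearly_connected Kl (set_type Y))
  (fin : forall delta : R, 0 < delta ->
     finite_set [set Y : set X | components X Y /\ (delta%:E <= diam Y)%E]).

Let conn (Y : set X) : components X Y -> connected [set: set_type Y].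
Proof. by move=> /lin[]. Qed.

(** A blow-up of the ball of radius [D] about [x1] turns pieces of the two components into subsets
    of components of diameter at least [delta], so close images lie in one component. The delicate
    point is the way back: a connected set [J] joining the images has to be pulled back, but [phi]
    is invertible only over [U], and [J] is not known to lie there. Since [J] is short, its trace on
    the image of a smaller ball is open and closed in [J], so it is all of [J]. *)
Lemma relative_separation : exists2 c : R, 0 < c & forall (x1 u1 x2 u2 : X) D,
  0 < D -> same x1 u1 -> D <= mdist x1 u1 -> same x2 u2 -> D <= mdist x2 u2 ->
  mdist x1 x2 < c * D -> same x1 x2.
Proof.
have Kl0 : 0 < Kl := lt_le_trans ltr01 Kl1.
have [c0 [L0 [c00 L01 H]]] := ass.
have L00 : 0 < L0 := lt_le_trans ltr01 L01.
(* A piece reaching at least [l / 2 = D / (16 * Kl)] from its base point still has this extent after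
   division by [D] and the loss of a factor [L0]. *)
pose delta := (16 * Kl * L0)^-1.
have d0 : 0 < delta by rewrite invr_gt0 !mulr_gt0.
have [cs cs0 sepc] := components_separation cX d0 (fin d0).
(* The three bounds place the images closer than [cs], the point [x2] within [D / 4] of [x1], and
   all of [J] within [(4 * L0)^-1] of [phi x1]. *)
pose c := Num.min (cs / L0) (Num.min 4^-1 (8 * Kl * L0 ^+ 2)^-1).
have cpos : 0 < c.
  have h8 : 0 < 8 * Kl * L0 ^+ 2 by rewrite mulr_gt0 ?exprn_gt0 // mulr_gt0.
  by rewrite /c !lt_min divr_gt0 //= !invr_gt0 h8 andbT.
exists c => // x1 u1 x2 u2 D Dp s1 D1 s2 D2 x12.
have DD : (D%:E <= diam [set: X])%E.
  by rewrite diamX lee_fin; apply: le_trans D1 (bD _ _).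
have [U [phi [oU _ [fU iU sU] bl]]] := H D x1 Dp DD.
pose l := D / (8 * Kl).
have l0 : 0 < l by rewrite divr_gt0 // mulr_gt0.
have lD : l <= D by rewrite ler_pdivrMr ?mulr_gt0 // ler_peMr ?(ltW Dp) // mulr_ege1 // ler1n.
have Kl_l : 2 * Kl * l = D / 4 by rewrite /l; field; rewrite gt_eqF.
have cD4 : c * D <= D / 4.
  by rewrite mulrC ler_pM2l // /c !ge_min lexx orbT.
have x12' : mdist x1 x2 < D / 4 by exact: lt_le_trans cD4.
have piece x u : same x u -> D <= mdist x u -> mdist x1 x < D / 4 ->
    exists z, same (phi x) (phi z) /\ delta <= mdist (phi x) (phi z).
  move=> xu Dxu x1x.
  have [z [xz z1 z2]] := component_annulus conn xu l0 (le_trans lD Dxu).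
  have [J [cJ Jx Jz dJ]] := linear_connection Kl1 lin xz.
  have JB y : J y -> ball x1 D y.
    move=> Jy; rewrite mballE; apply: le_lt_trans (metric_triangle _ x _) _.
    have : mdist x y <= 2 * Kl * l.
      by apply: le_trans (dJ x y Jx Jy) _; rewrite ler_pM2l ?mulr_gt0 // ltW.
    by rewrite Kl_l; lra.
  exists z; split.
    apply: (@same_connected _ _ (phi @` J)); [|by exists x|by exists z].
    apply: connected_continuous_connected => //.
    apply: (@lipschitz_within _ _ _ _ _ (L0 / D)) => a b Ja Jb.
    have /andP[_ h] := bl a b (JB a Ja) (JB b Jb).
    by apply: le_trans h _; rewrite mulrA mulrAC.
  have /andP[h _] := bl x z (JB x Jx) (JB z Jz); apply: le_trans h.
  rewrite /delta; have -> : (16 * Kl * L0)^-1 = L0^-1 * (l / 2 / D).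
    by rewrite /l; field; rewrite !gt_eqF.
  by rewrite ler_pM2l ?invr_gt0 // ler_pM2r ?invr_gt0.
have x11 : mdist x1 x1 < D / 4 by rewrite mdistxx divr_gt0.
have [z1 [p1 q1]] := piece x1 u1 s1 D1 x11.
have [z2 [p2 q2]] := piece x2 u2 s2 D2 x12'.
have B1 : ball x1 D x1 by rewrite mballE mdistxx.
have B2 : ball x1 D x2 by rewrite mballE; lra.
have phi12 : mdist (phi x1) (phi x2) <= L0 * (mdist x1 x2 / D).
  by have /andP[] := bl x1 x2 B1 B2.
have phi12c : mdist (phi x1) (phi x2) < L0 * c.
  by apply: le_lt_trans phi12 _; rewrite ltr_pM2l // ltr_pdivrMr.
have sphi : same (phi x1) (phi x2).
  apply: sepc p1 q1 p2 q2 _; apply: lt_le_trans phi12c _.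
  by rewrite mulrC -ler_pdivlMr // /c ge_min lexx.
have [J [cJ Jx1 Jx2 dJ]] := linear_connection Kl1 lin sphi.
have dJ' u : J u -> mdist (phi x1) u <= (4 * L0)^-1.
  move=> Ju; apply: le_trans (dJ _ _ Jx1 Ju) _.
  apply: (@le_trans _ _ (2 * Kl * (L0 * c))).
    by rewrite ler_pM2l ?mulr_gt0 // ltW.
  have : c <= (8 * Kl * L0 ^+ 2)^-1 by rewrite /c !ge_min lexx !orbT.
  move=> h; apply: (@le_trans _ _ (2 * Kl * (L0 * (8 * Kl * L0 ^+ 2)^-1))).
    by rewrite !ler_pM2l ?mulr_gt0.
  by rewrite le_eqVlt; apply/orP; left; apply/eqP; field; rewrite !gt_eqF.
have inv y z : ball x1 D y -> ball x1 D z ->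
    mdist y z <= L0 * D * mdist (phi y) (phi z).
  move=> By Bz; have /andP[h _] := bl y z By Bz.
  by move: h; rewrite ler_pdivrMl // ler_pdivrMr // mulrAC.
have Dh : 0 < D / 2 by rewrite divr_gt0.
have L0D : 0 < L0 * D by rewrite mulr_gt0.
pose C := phi @` ball x1 (D / 2).
have sub2 y : mdist x1 y < D / 2 -> ball x1 D y by rewrite mballE; lra.
have openC : open C.
  apply/open_mdistP => _ [y + <-]; rewrite mballE => x1y.
  have By := sub2 y x1y.
  have [e e0 eU] := (open_mdistP U).1 oU (phi y) (fU y By).
  pose e' := (D / 2 - mdist x1 y) / (L0 * D).
  have e'0 : 0 < e' by rewrite divr_gt0 // subr_gt0.
  exists (Num.min e e'); first by rewrite lt_min e0.
  move=> v; rewrite lt_min => /andP[ve ve'].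
  have [y' By' E] := sU v (eU v ve); exists y' => //; rewrite mballE.
  apply: le_lt_trans (metric_triangle _ y _) _.
  have := inv y y' By By'; rewrite E => h.
  move: ve'; rewrite ltr_pdivlMr // mulrC => ve'.
  by have := le_lt_trans h ve'; lra.
pose F := [set y | mdist x1 y <= D / 4].
have clF : closed F.
  rewrite -(setCK F); apply: open_closedC; apply/open_mdistP => y.
  rewrite /F /setC /= => /negP; rewrite -ltNge => Dy.
  exists (mdist x1 y - D / 4); first by rewrite subr_gt0.
  move=> z yz; apply/negP; rewrite -ltNge.
  by have := metric_triangle x1 z y; rewrite (metric_sym z); lra.
have FB y : F y -> ball x1 D y by rewrite /F /= mballE; lra.
have Lip A : (forall y, A y -> ball x1 D y) -> {within A, continuous phi}.
  move=> AB; apply: (@lipschitz_within _ _ _ _ _ (L0 / D)) => a b Aa Ab.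
  have /andP[_ h] := bl a b (AB a Aa) (AB b Ab).
  by apply: le_trans h _; rewrite mulrA mulrAC.
have cC' : closed (phi @` F).
  apply: compact_closed; first exact: metric_hausdorff.
  apply: continuous_compact; first exact: Lip.
  exact: subclosed_compact clF cX _.
(* Points of [J] with a preimage at distance below [D / 2] have one at distance at most [D / 4]. So
   the same trace comes from the open set [C] and from a compact image. *)
have JC' : J `&` C = J `&` (phi @` F).
  apply/seteqP; split => u [Ju [y yB E]]; split => //; exists y => //.
  - have By : ball x1 D y by apply: sub2; move: yB; rewrite mballE.
    rewrite /F /=; apply: le_trans (inv x1 y B1 By) _; rewrite E.
    apply: (@le_trans _ _ (L0 * D * (4 * L0)^-1)).
      by rewrite ler_pM2l // dJ'.
    by rewrite le_eqVlt; apply/orP; left; apply/eqP; field; rewrite gt_eqF.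
  - by move: yB; rewrite /F /= mballE; lra.
have JE : J `&` C = J.
  apply: cJ.
  - by exists (phi x1); split => //; exists x1 => //; rewrite mballE mdistxx.
  - by exists C.
  - by exists (phi @` F).
have [psi psiP] : exists psi : X -> X, forall u, J u -> ball x1 D (psi u) /\ phi (psi u) = u.
  have h u : exists y, J u -> ball x1 D y /\ phi y = u.
    have [Ju|nJ] := pselect (J u); last by exists u.
    have : (J `&` C) u by rewrite JE.
    move=> [_ [y yB E]]; exists y => _; split => //; apply: sub2.
    by move: yB; rewrite mballE.
  by have [psi hp] := choice h; exists psi.
have psi_id x : J (phi x) -> ball x1 D x -> psi (phi x) = x.
  move=> Jx Bx; have [h1 h2] := psiP _ Jx.
  apply/mdist_positivity/eqP; rewrite eq_le mdist_ge0 andbT.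
  by apply: le_trans (inv _ _ h1 Bx) _; rewrite h2 mdistxx mulr0.
apply: (@same_connected _ _ (psi @` J)).
- apply: connected_continuous_connected => //.
  apply: (@lipschitz_within _ _ _ _ _ (L0 * D)) => a b Ja Jb.
  have [a1 a2] := psiP a Ja; have [b1 b2] := psiP b Jb.
  by apply: le_trans (inv _ _ a1 b1) _; rewrite a2 b2.
- by exists (phi x1) => //; exact: psi_id.
- by exists (phi x2) => //; exact: psi_id.
Qed.

End RelativeSeparation.

(** * Coarse components and charts *)

Section Chained.
Context (R : realType) (X : metricType R).
Implicit Types (x y z : X) (s S A : R) (k : nat).

(** The existence of a finite chain of steps shorter than [s], expressed as membership in every set
    closed under such steps. *)
Definition chained s x y := forall W : set X, W x ->
  (forall a b, W a -> mdist a b < s -> W b) -> W y.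

Lemma chained_refl s x : chained s x x. Proof. by move=> W. Qed.

Lemma chained_trans s x y z : chained s x y -> chained s y z -> chained s x z.
Proof. by move=> xy yz W Wx HW; apply: yz => //; exact: xy. Qed.

Lemma chained_step s x y : mdist x y < s -> chained s x y.
Proof. by move=> xy W Wx HW; exact: HW xy. Qed.

Lemma chained_sym s x y : chained s x y -> chained s y x.
Proof.
move=> xy; apply: (xy [set z | chained s z x]) => [|a b ax ab].
  exact: chained_refl.
by apply: chained_trans ax; apply: chained_step; rewrite metric_sym.
Qed.

Lemma chained_le s s' x y : s <= s' -> chained s x y -> chained s' x y.
Proof. by move=> ss xy W Wx HW; apply: xy => // a b Wa ab; apply: HW Wa (lt_le_trans ab ss). Qed.

Lemma not_chained s x y : ~ chained s x y -> s <= mdist x y.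
Proof. by move=> n; rewrite leNgt; apply/negP => /chained_step. Qed.

Definition sc S k := S / 2 ^+ k.

(* The coarse component of x at scale k is a small ball in the good case; in the
   bad one it follows a component of X of large relative diameter. *)
Definition good S A k x := forall y z,
  chained (sc S k) x y -> chained (sc S k) x z -> mdist y z <= A * sc S k.

Lemma scS S k : sc S k = 2 * sc S k.+1.
Proof. by rewrite /sc exprS; field; rewrite expf_neq0. Qed.

Lemma sc_gt0 S k : 0 < S -> 0 < sc S k.
Proof. by move=> S0; rewrite divr_gt0 // exprn_gt0. Qed.

Lemma sc_le S k l : 0 < S -> (k <= l)%N -> sc S l <= sc S k.
Proof.
move=> S0 kl; rewrite /sc ler_pM2l // lef_pV2 ?posrE ?exprn_gt0 //.
by apply: ler_weXn2l => //; rewrite ler1n.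
Qed.

Lemma sc_small S e : 0 < S -> 0 < e -> exists k, sc S k < e.
Proof. by move=> S0 e0; exact: exists_geom_lt. Qed.

Lemma chained_anti S k l x y : 0 < S -> (k <= l)%N ->
  chained (sc S l) x y -> chained (sc S k) x y.
Proof. by move=> S0 kl; apply: chained_le; exact: sc_le. Qed.

Lemma good_chained S A k x y : chained (sc S k) x y -> good S A k x -> good S A k y.
Proof.
by move=> xy g u v yu yv; apply: g; [exact: chained_trans yu|exact: chained_trans yv].
Qed.

Lemma good_chained_le S A k l x y : 0 < S -> (k <= l)%N ->
  chained (sc S l) x y -> good S A k x -> good S A k y.
Proof. by move=> S0 kl xy; apply: good_chained; exact: chained_anti xy. Qed.

Lemma badP S A k x : ~ good S A k x -> exists y z,
  [/\ chained (sc S k) x y, chained (sc S k) x z & A * sc S k < mdist y z].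
Proof.
move=> n; apply: contrapT => H; apply: n => y z xy xz.
by rewrite leNgt; apply/negP => yz; apply: H; exists y, z.
Qed.

End Chained.

Section Structure.
Context (R : realType) (X : metricType R) (D0 Kl Ks : R).
Hypotheses (cX : compact [set: X]) (D00 : 0 < D0) (bD : forall x y : X, mdist x y <= D0)
  (Kl1 : 1 <= Kl) (Ks1 : 1 <= Ks) (diamX : diam [set: X] = D0%:E)
  (ass : approximately_self_similar X)
  (lin : forall Y : set X, components X Y -> linearly_connected Kl (set_type Y))
  (fin : forall delta : R, 0 < delta ->
     finite_set [set Y : set X | components X Y /\ (delta%:E <= diam Y)%E])
  (cov : forall r : R, 0 < r -> (r%:E <= diam [set: X])%E ->
       exists W_ : set (set X), \bigcup_(W in W_) W = [set: X] /\
         forall W : set X, W_ W ->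
           [/\ clopen W,
               ((r / Ks)%:E <= set_dist W (~` W))%E &
               exists2 Y : set X, components X Y &
                 Y `<=` W /\ W `<=` neighborhood r Y]).

(** Steps shorter than [s] cannot leave a set at distance at least [s] from its complement; the
    covering for the radius [Ks * s] provides one. *)
Lemma chained_near_component (s : R) (x : X) : 0 < s -> Ks * s <= D0 ->
  exists w, forall y, chained s x y -> exists2 z, same w z & mdist y z < Ks * s.
Proof.
move=> s0 sD; have Ks0 : 0 < Ks := lt_le_trans ltr01 Ks1.
have r0 : 0 < Ks * s by rewrite mulr_gt0.
have [|W_ [cW H]] := cov r0; first by rewrite diamX lee_fin.
have : (\bigcup_(W in W_) W) x by rewrite cW.
move=> [W WW Wx]; have [_ dW [Y [w _ <-] [YW WY]]] := H W WW.
exists w => y xy.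
have : W y.
  apply: xy => // a b Wa ab; apply: contrapT => nWb.
  have : (set_dist W (~` W) <= (mdist a b)%:E)%E.
    by apply: ereal_inf_lbound; exists a => //; exists b.
  move=> /(le_trans dW); rewrite lee_fin mulrC mulKf ?gt_eqF //.
  by rewrite leNgt ab.
by move=> /WY[z Yz]; rewrite mballE metric_sym => yz; exists z.
Qed.

(** The charts use balls larger than the class they describe, so radii beyond the diameter occur.
    There the identity is a chart, with a constant depending on [Rmax] and [D0]. *)
Lemma self_similar_extended (Rmax : R) : 0 < Rmax -> exists2 L : R, 1 <= L &
  forall r (x : X), 0 < r -> r <= Rmax -> exists phi : X -> X,
    forall y z, mdist x y < r -> mdist x z < r ->
      L^-1 * (mdist y z / r) <= mdist (phi y) (phi z) <= L * (mdist y z / r).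
Proof.
move=> R0; have [c0 [L0 [c00 L01 H]]] := ass.
have L00 : 0 < L0 := lt_le_trans ltr01 L01.
pose L := L0 + Rmax + D0^-1.
have iD : 0 < D0^-1 by rewrite invr_gt0.
have L0L : L0 <= L by rewrite /L; lra.
have L1 : 1 <= L by exact: le_trans L0L.
have LL : 0 < L := lt_le_trans ltr01 L1.
exists L => // r x r0 rR.
have [rD|Dr] := leP r D0.
  have [|U [phi [_ _ _ bl]]] := H r x r0; first by rewrite diamX lee_fin.
  exists phi => y z xy xz.
  have /andP[h1 h2] : L0^-1 * (mdist y z / r) <= mdist (phi y) (phi z) <= L0 * (mdist y z / r).
    by apply: bl; rewrite mballE.
  have q0 : 0 <= mdist y z / r by rewrite divr_ge0 ?mdist_ge0 // ltW.
  apply/andP; split.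
    by apply: le_trans h1; apply: ler_wpM2r => //; rewrite lef_pV2 ?posrE.
  by apply: le_trans h2 _; exact: ler_wpM2r.
exists idfun => y z _ _ /=.
have d0 := mdist_ge0 y z.
have -> : L^-1 * (mdist y z / r) = mdist y z * (L * r)^-1 by rewrite invfM; ring.
have -> : L * (mdist y z / r) = mdist y z * (L / r) by ring.
apply/andP; split.
  rewrite ler_piMr // invf_le1 ?mulr_gt0 //.
  apply: (@le_trans _ _ (D0^-1 * D0)); first by rewrite mulVf ?gt_eqF.
  by apply: ler_pM => //; rewrite ?(ltW iD) ?(ltW D00) ?(ltW Dr) // /L; lra.
rewrite ler_peMr // ler_pdivlMr // mul1r; apply: le_trans rR _.
by rewrite /L; lra.
Qed.

(** [yf] projects a bad class to the component that it follows, and [psi] is this projection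
    followed by a blow-up to unit size. A point that stays bad down to level [l] moves by at most
    [Ks * sc S l] under the projection, which explains the two error terms. *)
Lemma bad_class_charts : exists S A Lam delta : R,
  [/\ (forall x y : X, mdist x y < S), [/\ 0 < S, 1 <= A, 1 <= Lam & 0 < delta] &
  forall j x0, ~ good S A j x0 -> good S A j.-1 x0 -> exists psi : X -> X,
  [/\ forall x x', chained (sc S j) x0 x -> chained (sc S j) x0 x' -> same (psi x) (psi x'),
     exists x x', [/\ chained (sc S j) x0 x, chained (sc S j) x0 x' &
       delta <= mdist (psi x) (psi x')] &
     forall x x' l l', chained (sc S j) x0 x -> chained (sc S j) x0 x' ->
       (j <= l)%N -> (forall m, (j <= m <= l)%N -> ~ good S A m x) ->
       (j <= l')%N -> (forall m, (j <= m <= l')%N -> ~ good S A m x') ->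
       sc S j * mdist (psi x) (psi x') <= Lam * (mdist x x' + sc S l + sc S l') /\
       mdist x x' <= Lam * (sc S j * mdist (psi x) (psi x') + sc S l + sc S l')]].
Proof.
have [c c0 RS] := relative_separation cX bD Kl1 diamX ass lin fin.
have Ks0 : 0 < Ks := lt_le_trans ltr01 Ks1.
have Kl0 : 0 < Kl := lt_le_trans ltr01 Kl1.
(* [S] strictly exceeds all distances. In [A], the term [2 * Ks] absorbs the projection of two
   points, and [8 * Ks / c] leaves a component so large that [RS] identifies the candidates found at
   consecutive scales. *)
pose S := 2 * D0; pose A := 2 * Ks + 8 * Ks / c.
have S0 : 0 < S by rewrite mulr_gt0.
have Kc : 0 < 8 * Ks / c by rewrite divr_gt0 // mulr_gt0.
have A2 : 2 * Ks <= A by rewrite lerDl ltW.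
have A1 : 1 <= A by have := Ks1; lra.
(* In units of the scale, the radius of a ball that contains the projections and the connected sets
   joining them: [2 * A + Ks] reaches a projection, and two projections are at most [2 * A + 2 * Ks]
   apart. *)
pose C' := 2 * A + Ks + 2 * Kl * (2 * A + 2 * Ks) + 1.
have C'0 : 0 < C'.
  have : 0 <= 2 * Kl * (2 * A + 2 * Ks) by rewrite !mulr_ge0 //; lra.
  by rewrite /C'; lra.
have [|L L1 SS] := self_similar_extended (Rmax := C' * S); first by rewrite mulr_gt0.
have L0 : 0 < L := lt_le_trans ltr01 L1.
pose delta := 8 * Ks / c / (L * C').
have d0 : 0 < delta by rewrite divr_gt0 // mulr_gt0.
pose Lam := L * Ks / C' + L * C' + 2 * Ks + L / C'.
have bad_D k (x : X) : ~ good S A k x -> A * sc S k < D0.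
  by move=> /badP[y [z [_ _ h]]]; apply: lt_le_trans (bD y z); exact: h.
have nearc k (x : X) : ~ good S A k x -> exists w, forall y, chained (sc S k) x y ->
    exists2 z, same w z & mdist y z < Ks * sc S k.
  move=> /bad_D h; apply: chained_near_component; first exact: sc_gt0.
  apply: le_trans (ltW h); rewrite ler_pM2r ?sc_gt0 //; have := Ks0; lra.
pose near k (x w : X) := forall y, chained (sc S k) x y ->
    exists2 z, same w z & mdist y z < Ks * sc S k.
have near_self k x w : near k x w -> exists2 z, same w z & mdist x z < Ks * sc S k.
  by move=> n; apply: n; exact: chained_refl.
have big k x w : ~ good S A k x -> near k x w -> forall z, same w z ->
    exists2 u, same z u & 4 * Ks / c * sc S k <= mdist z u.
  move=> /badP[y [y' [xy xy' h]]] nw z wz.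
  have [u wu yu] := nw y xy; have [u' wu' yu'] := nw y' xy'.
  have t1 := metric_triangle y u y'; have t2 := metric_triangle u u' y'.
  have t3 := metric_triangle u z u'.
  rewrite (metric_sym u' y') (metric_sym u z) in t2 t3.
  have E : A * sc S k = 2 * (Ks * sc S k) + 2 * (4 * Ks / c * sc S k).
    by rewrite /A; ring.
  have [zu|zu] := leP (4 * Ks / c * sc S k) (mdist z u).
    by exists u => //; apply: same_trans wu; exact: same_sym.
  exists u'; first by apply: same_trans wu'; exact: same_sym.
  by rewrite E in h; lra.
(* The projections of [x] at the two scales are less than [3 * (Ks * sc S k.+1)] apart, below the
   [c * D = 4 * (Ks * sc S k.+1)] that [RS] allows. *)
have uniq k x w w' : ~ good S A k x -> ~ good S A k.+1 x -> near k x w ->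
    near k.+1 x w' -> same w w'.
  move=> b1 b2 n1 n2.
  have [z wz xz] := near_self _ _ _ n1; have [z' wz' xz'] := near_self _ _ _ n2.
  have [u zu du] := big k x w b1 n1 z wz; have [u' zu' du'] := big k.+1 x w' b2 n2 z' wz'.
  have s1 := scS S k; have sp := sc_gt0 k.+1 S0.
  have Kc4 : 0 < 4 * Ks / c by rewrite divr_gt0 // mulr_gt0.
  pose D := 4 * Ks / c * sc S k.+1.
  have Dp : 0 < D by rewrite mulr_gt0.
  suff zz' : same z z'.
    by apply: same_trans wz _; apply: same_trans zz' _; exact: same_sym.
  apply: (RS z u z' u' D) => //.
    by apply: le_trans du; rewrite ler_pM2l // s1; lra.
  have -> : c * D = 4 * (Ks * sc S k.+1) by rewrite /D; field; rewrite gt_eqF.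
  have t := metric_triangle z x z'; rewrite (metric_sym z x) in t.
  have kp : 0 < Ks * sc S k.+1 by rewrite mulr_gt0.
  have e1 : Ks * sc S k = 2 * (Ks * sc S k.+1) by rewrite s1; ring.
  by rewrite e1 in xz; lra.
exists S, A, Lam, delta; split.
- by move=> x y; apply: le_lt_trans (bD x y) _; rewrite /S ltr_pMl // ltr1n.
- split => //; rewrite /Lam.
  have q1 : 0 <= L * Ks / C' by rewrite divr_ge0 ?mulr_ge0 // ltW.
  have q2 : 0 <= L * C' by rewrite mulr_ge0 // ltW.
  have q3 : 0 <= L / C' by rewrite divr_ge0 // ltW.
  by have := Ks1; lra.
move=> j x0 bj gj.
have [w nw] := nearc j x0 bj.
set sj := sc S j; have sj0 : 0 < sj by exact: sc_gt0.
pose cl := chained sj x0.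
have badcl x : cl x -> ~ good S A j x.
  by move=> cx gx; apply: bj; apply: good_chained gx; exact: chained_sym.
have claim1 x l : cl x -> (j <= l)%N ->
    (forall m, (j <= m <= l)%N -> ~ good S A m x) -> near l x w.
  move=> cx /subnKC <-; elim: (l - j)%N => [|n IH] H.
    by rewrite addn0 => y xy; apply: nw; exact: chained_trans xy.
  rewrite addnS in H *.
  have nIH : near (j + n)%N x w.
    by apply: IH => m /andP[jm mn]; apply: H; rewrite jm (leq_trans mn).
  have b1 : ~ good S A (j + n) x by apply: H; rewrite leq_addr leqnSn.
  have b2 : ~ good S A (j + n).+1 x by apply: H; rewrite leqnn (leq_trans (leq_addr n j)) // leqnSn.
  have [w' nw'] := nearc _ _ b2.
  have ww' := uniq _ _ _ _ b1 b2 nIH nw'.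
  move=> y xy; have [z wz yz] := nw' y xy; exists z => //; exact: same_trans wz.
(* If [x] becomes good, a projection at the last bad level serves for all earlier ones. If it never
   does, [x] lies in the component itself, which is closed. *)
have [yf yfP] : exists yf : X -> X, forall x, cl x -> same w (yf x) /\
    forall l, (j <= l)%N -> (forall m, (j <= m <= l)%N -> ~ good S A m x) ->
      mdist x (yf x) <= Ks * sc S l.
  suff h x : exists y, cl x -> same w y /\
      forall l, (j <= l)%N -> (forall m, (j <= m <= l)%N -> ~ good S A m x) ->
      mdist x y <= Ks * sc S l.
    by have [yf hy] := choice h; exists yf.
  have [cx|] := pselect (cl x); last by exists x.
  have [[l1 gl1]|nog] := pselect (exists l, (j <= l)%N && `[< good S A l x >]).
    have ex : exists l, (j <= l)%N && `[< good S A l x >] by exists l1.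
    case: (ex_minnP ex) => l0 /andP[jl0 /asboolP gl0] l0min {l1 gl1 ex}.
    have jl0' : (j < l0)%N.
      by rewrite ltn_neqAle jl0 andbT; apply/eqP => E; apply: (badcl x cx); rewrite E.
    case: l0 gl0 jl0 jl0' l0min => // l1 gl0 _ jl1 l0min.
    have bl1 m : (j <= m <= l1)%N -> ~ good S A m x.
      move=> /andP[jm ml] gm; have := l0min m; rewrite jm (asboolT gm) => /(_ isT).
      by rewrite ltnNge ml.
    have [z wz xz] := near_self _ _ _ (claim1 x l1 cx jl1 bl1).
    exists z => _; split => // l jl bl; apply: (le_trans (ltW xz)).
    rewrite ler_pM2l //; apply: sc_le => //; rewrite leqNgt; apply/negP => ll.
    by apply: (bl l1.+1) => //; rewrite ll (ltnW jl1).
  exists x => _; split; last by move=> l _ _; rewrite mdistxx mulr_ge0 ?(ltW Ks0) // ltW // sc_gt0.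
  apply: (closed_mdist (closed_component (X := X) (x := w))) => e e0.
  have [|k ke] := @sc_small R S (e / Ks) S0; first by rewrite divr_gt0.
  have [z wz xz] : exists2 z, same w z & mdist x z < Ks * sc S (j + k)%N.
    apply: near_self; apply: claim1 => //; first exact: leq_addr.
    by move=> m /andP[jm _] gm; apply: nog; exists m; rewrite jm /=; exact/asboolP.
  exists z => //; apply: lt_le_trans xz _; rewrite mulrC -ler_pdivlMr //.
  by apply: le_trans (ltW ke); apply: sc_le => //; exact: leq_addl.
(* Level 0 cannot be bad, so [j.-1] is really the previous level; its being good bounds the diameter
   of the class. *)
have jpos : sc S j.-1 = 2 * sj.
  case: j bj gj @sj {sj0 cl badcl claim1 nw yf yfP} => [|j'] bj gj.
    exfalso; have := bad_D _ _ bj; rewrite /sc expr0 divr1 => h.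
    have : D0 <= A * S by rewrite /S mulrA ler_peMl ?(ltW D00) // mulr_ege1 // ler1n.
    by rewrite leNgt h.
  exact: scS.
have clj x : cl x -> chained (sc S j.-1) x0 x.
  by apply: chained_le; rewrite jpos; have := sj0; lra.
have dcl x x' : cl x -> cl x' -> mdist x x' <= 2 * A * sj.
  move=> cx cx'; have := gj x x' (clj x cx) (clj x' cx').
  by rewrite jpos mulrCA mulrA.
have jj x m : cl x -> (j <= m <= j)%N -> ~ good S A m x.
  by move=> cx h; have -> : m = j by [apply/eqP; rewrite eqn_leq andbC]; exact: badcl.
have yfj x : cl x -> mdist x (yf x) <= Ks * sj.
  by move=> cx; apply: (yfP x cx).2 => // m; exact: jj.
have c00 : cl x0 by exact: chained_refl.
set r := C' * sj; have r0 : 0 < r by rewrite mulr_gt0.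
have rS : r <= C' * S.
  rewrite ler_pM2l // /sj /sc ler_pdivrMr ?exprn_gt0 // ler_peMr ?(ltW S0) //.
  by rewrite exprn_ege1 // ler1n.
have [phi phiP] := SS r x0 r0 rS.
have yf0 x : cl x -> mdist x0 (yf x) <= (2 * A + Ks) * sj.
  move=> cx; apply: le_trans (metric_triangle _ x _) _; rewrite mulrDl.
  by apply: lerD; [exact: dcl|exact: yfj].
have yfyf x x' : cl x -> cl x' -> mdist (yf x) (yf x') <= (2 * A + 2 * Ks) * sj.
  move=> cx cx'.
  have t1 := metric_triangle (yf x) x (yf x'); have t2 := metric_triangle x x' (yf x').
  rewrite (metric_sym (yf x) x) in t1.
  have E : (2 * A + 2 * Ks) * sj = 2 * A * sj + 2 * (Ks * sj) by ring.
  have := dcl x x' cx cx'; have := yfj x cx; have := yfj x' cx'.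
  by rewrite E; lra.
have KAs : 0 <= 2 * Kl * ((2 * A + 2 * Ks) * sj).
  have AK : 0 <= 2 * A + 2 * Ks by have := A1; have := Ks1; lra.
  by apply: mulr_ge0; apply: mulr_ge0 => //; exact: ltW.
have rE : r = (2 * A + Ks) * sj + 2 * Kl * ((2 * A + 2 * Ks) * sj) + sj.
  by rewrite /r /C'; ring.
have inB x : cl x -> mdist x0 (yf x) < r.
  by move=> cx; apply: le_lt_trans (yf0 x cx) _; rewrite rE; lra.
have psi_lo x x' : cl x -> cl x' -> L^-1 * (mdist (yf x) (yf x') / r) <=
    mdist (phi (yf x)) (phi (yf x')) <= L * (mdist (yf x) (yf x') / r).
  by move=> cx cx'; apply: phiP; exact: inB.
exists (phi \o yf); split => /=.
- move=> x x' cx cx'.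
  have yy : same (yf x) (yf x').
    by apply: same_trans (same_sym (yfP x cx).1) (yfP x' cx').1.
  have [J [cJ Jx Jx' dJ]] := linear_connection Kl1 lin yy.
  have JB a : J a -> mdist x0 a < r.
    move=> Ja; apply: le_lt_trans (metric_triangle _ (yf x) _) _.
    have h1 := yf0 x cx.
    have h2 : mdist (yf x) a <= 2 * Kl * ((2 * A + 2 * Ks) * sj).
      apply: le_trans (dJ _ _ Jx Ja) _; apply: ler_wpM2l; last exact: yfyf.
      by rewrite mulr_ge0 // ltW.
    by rewrite rE; lra.
  apply: (@same_connected _ _ (phi @` J)); [|by exists (yf x)|by exists (yf x')].
  apply: connected_continuous_connected => //.
  apply: (@lipschitz_within _ _ _ _ _ (L / r)) => a b Ja Jb.
  have /andP[_ h] := phiP a b (JB a Ja) (JB b Jb).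
  by apply: le_trans h _; rewrite mulrA mulrAC.
- have [x [x' [cx cx' h]]] := badP bj.
  exists x, x'; split => //; have /andP[h1 _] := psi_lo x x' cx cx'.
  apply: le_trans h1.
  have -> : delta = L^-1 * (8 * Ks / c * sj / r) by rewrite /delta /r; field; rewrite !gt_eqF.
  rewrite ler_pM2l ?invr_gt0 // ler_pM2r ?invr_gt0 //.
  have t1 := metric_triangle x (yf x) x'; have t2 := metric_triangle (yf x) (yf x') x'.
  rewrite (metric_sym (yf x') x') in t2.
  have := yfj x cx; have := yfj x' cx'.
  have E : A * sj = 2 * (Ks * sj) + 8 * Ks / c * sj by rewrite /A; ring.
  by move: h; rewrite -/sj E; lra.
- move=> x x' l l' cx cx' jl bl jl' bl'.
  have h1 := (yfP x cx).2 l jl bl; have h2 := (yfP x' cx').2 l' jl' bl'.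
  have /andP[p1 p2] := psi_lo x x' cx cx'.
  have sl := sc_gt0 l S0; have sl' := sc_gt0 l' S0.
  set dp := mdist (phi (yf x)) (phi (yf x')) in p1 p2 *.
  have dp0 : 0 <= dp by exact: mdist_ge0.
  have q1 : 0 <= L * Ks / C' by rewrite divr_ge0 ?mulr_ge0 // ltW.
  have q2 : 0 <= L * C' by rewrite mulr_ge0 // ltW.
  have q3 : 0 <= L / C' by rewrite divr_ge0 // ltW.
  have dxx := mdist_ge0 x x'.
  have t1 := metric_triangle (yf x) x (yf x'); have t2 := metric_triangle x x' (yf x').
  have t3 := metric_triangle x (yf x) x'; have t4 := metric_triangle (yf x) (yf x') x'.
  rewrite (metric_sym (yf x) x) in t1; rewrite (metric_sym (yf x') x') in t4.
  split.
    apply: (@le_trans _ _ (L / C' * mdist (yf x) (yf x'))).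
      apply: (@le_trans _ _ (sj * (L * (mdist (yf x) (yf x') / r)))).
        by rewrite ler_pM2l.
      by rewrite le_eqVlt; apply/orP; left; apply/eqP; rewrite /r; field; rewrite !gt_eqF.
    apply: (@le_trans _ _ (L / C' * (mdist x x' + Ks * sc S l + Ks * sc S l'))).
      by apply: ler_wpM2l => //; lra.
    rewrite !mulrDr; apply: lerD; first apply: lerD.
    + by apply: ler_wpM2r => //; rewrite /Lam; have := Ks1; lra.
    + rewrite mulrA (mulrAC L); apply: ler_wpM2r; first exact: ltW.
      by rewrite /Lam; have := Ks1; lra.
    + rewrite mulrA (mulrAC L); apply: ler_wpM2r; first exact: ltW.
      by rewrite /Lam; have := Ks1; lra.
  have p3 : mdist (yf x) (yf x') <= L * C' * (sj * dp).
    move: p1; rewrite ler_pdivrMl // ler_pdivrMr // => /le_trans; apply.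
    by rewrite le_eqVlt; apply/orP; left; apply/eqP; rewrite /r; ring.
  apply: (@le_trans _ _ (L * C' * (sj * dp) + Ks * sc S l + Ks * sc S l')); first lra.
  have sdp : 0 <= sj * dp by rewrite mulr_ge0 // ltW.
  rewrite (mulrDr Lam) (mulrDr Lam); apply: lerD; first apply: lerD.
  + by apply: ler_wpM2r => //; rewrite /Lam; have := Ks1; lra.
  + by apply: ler_wpM2r; [exact: ltW|rewrite /Lam; have := Ks1; lra].
  + by apply: ler_wpM2r; [exact: ltW|rewrite /Lam; have := Ks1; lra].
Qed.

End Structure.

(** * Model distances on the large components *)

Section Models.
Context (R : realType) (X : metricType R).
Implicit Types (Z : set X) (th : X -> X -> R) (z w : X) (t T : R).

(* The theta-size of the ball of Z with centre z and radius T * t. *)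
Definition modulus Z th T z t := sup [set th z w | w in [set w | Z w /\ mdist z w <= T * t]].

(** [th] is a function on all of [X], of interest on [Z] only. Quasisymmetry is recorded in the form
    in which it is used, through sizes of balls: doubling, decay, comparison with distances. The
    bound [3 * th <= 1] leaves room for two gauges in a node distance that must not exceed 1. *)
Record model Z th (T q B k : R) : Prop := Model {
  model_ge0 : forall z w, 0 <= th z w ;
  model_xx : forall z, th z z = 0 ;
  model_sym : forall z w, th z w = th w z ;
  model_tri : forall z w v, th z v <= th z w + th w v ;
  model_le : forall z w, 3 * th z w <= 1 ;
  model_double : forall z t, Z z -> 0 < t ->
    modulus Z th T z (2 * t) <= B * modulus Z th T z t ;
  model_decay : forall z t n, Z z -> 0 < t -> t <= 1 ->
    modulus Z th T z (t / 2 ^+ n) <= B * k ^+ n * modulus Z th T z t ;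
  model_far : forall z w t, Z z -> Z w -> 0 < t -> T * t <= mdist z w ->
    modulus Z th T z t <= B * th z w ;
  model_unit : forall z, Z z -> 1 <= B * modulus Z th T z 1 ;
  model_packing : packing th q B
}.

Lemma modulus_bounds Z th T z t : (forall z w, 0 <= th z w) ->
  (forall z w, 3 * th z w <= 1) -> (forall z, th z z = 0) -> Z z -> 0 <= T * t ->
  [/\ forall w, Z w -> mdist z w <= T * t -> th z w <= modulus Z th T z t,
      forall c, (forall w, Z w -> mdist z w <= T * t -> th z w <= c) ->
        modulus Z th T z t <= c & 0 <= modulus Z th T z t].
Proof.
move=> t0 t1 tz Zz Tt; set S := [set th z w | w in [set w | Z w /\ mdist z w <= T * t]].
have S0 : S !=set0 by exists (th z z), z => //; split => //; rewrite mdistxx.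
have hS : has_sup S.
  by split => //; exists 1 => _ [w _ <-]; have := t1 z w; have := t0 z w; lra.
have up w : Z w -> mdist z w <= T * t -> th z w <= modulus Z th T z t.
  by move=> Zw zw; apply: ub_le_sup; [case: hS|exists w].
split => //.
- by move=> c H; apply: ge_sup => // _ [w [Zw zw] <-]; exact: H.
- by rewrite -(tz z); apply: up => //; rewrite mdistxx.
Qed.

Lemma model_weaken Z th T q B k q' B' k' : 0 <= T -> 0 <= B -> q <= q' -> B <= B' ->
  0 <= k -> k <= k' -> model Z th T q B k -> model Z th T q' B' k'.
Proof.
move=> T0 B0 qq BB k0 kk [m0 mx ms mt ml md mc mf mu mp].
have U0 z t : Z z -> 0 < t -> 0 <= modulus Z th T z t.
  by move=> Zz t0; have [|_ _] := @modulus_bounds Z th T z t m0 ml mx Zz; rewrite ?mulr_ge0 // ltW.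
split => //.
- move=> z t Zz t0; apply: le_trans (md z t Zz t0) _; apply: ler_wpM2r => //; exact: U0.
- move=> z t n Zz t0 t1; apply: le_trans (mc z t n Zz t0 t1) _.
  apply: ler_wpM2r; first exact: U0.
  by apply: ler_pM; rewrite ?exprn_ge0 //; apply: lerXn2r; rewrite ?nnegrE // (le_trans k0).
- move=> z w t Zz Zw t0 h; apply: le_trans (mf z w t Zz Zw t0 h) _; exact: ler_wpM2r.
- by move=> z Zz; apply: le_trans (mu z Zz) _; apply: ler_wpM2r => //; exact: U0.
- exact: packing_weaken mp.
Qed.

Hypothesis cX : compact [set: X].

(** Since [u] and [u'] are [delta] apart, each [z] in [Z] has a point of [Z] at distance at least
    [T = delta / 2], so by connectedness the annuli about [z] of radius up to [T] are not empty.
    Quasisymmetry compares all sizes with the distance from [z] to a point of such an annulus. *)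
Lemma exists_model (z0 u u' : X) (delta q C : R)
    (theta : distance R (connected_component [set: X] z0)) :
  0 < delta -> same z0 u -> same z0 u' -> delta <= mdist u u' ->
  connected [set: connected_component [set: X] z0] ->
  1 <= C -> packing theta q C ->
  quasisymmetric (idfun : connected_component [set: X] z0 -> remetric theta) ->
  exists th B k, [/\ 1 <= B, 0 < k < 1 &
    model (connected_component [set: X] z0) th (delta / 2) q B k].
Proof.
move=> d0 zu zu' duu cZ C1 pk qs.
set Z := connected_component [set: X] z0 in theta cZ pk qs *.
set T := delta / 2; have T0 : 0 < T by rewrite divr_gt0.
pose b0 : Z := SigSub (mem_set (same_refl z0)).
pose pr (x : X) : Z := insubd b0 x.
have prE x : Z x -> set_val (pr x) = x.
  by move=> Zx; rewrite /pr set_valE /= insubdK //; exact: mem_set.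
have cZt : compact [set: Z].
  by apply: compact_set_type; apply: subclosed_compact (@closed_component R X z0) cX _.
have [D1 D10 bD1] := compact_bounded (quasisymmetric_compact cZt qs).
have {}bD1 (a b : Z) : theta a b <= D1 := bD1 a b.
have [D0 D00 bD] := compact_bounded cX.
have th_ge0 (a b : Z) : 0 <= theta a b by exact: (mdist_ge0 (a : remetric theta) b).
have th_gt0 (a b : Z) : a != b -> 0 < theta a b.
  by move=> ab; have := mdist_gt0 (a : remetric theta) b; rewrite ab.
pose s := (3 * D1)^-1; have s0 : 0 < s by rewrite invr_gt0 mulr_gt0.
pose th x y := s * theta (pr x) (pr y).
have [_ [eta [[eA _ eS] _ me] H]] := qs.
have {}H (z w v : X) : Z z -> Z w -> Z v -> z != w ->
    th z v <= eta (mdist z v / mdist z w) * th z w.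
  move=> Zz Zw Zv zw; have zw' : pr z != pr w.
    by apply: contraNneq zw => e; rewrite -(prE z Zz) -(prE w Zw) e.
  have h := H (pr z) (pr w) (pr v) zw'.
  change (is_true (theta (pr z) (pr v) / theta (pr z) (pr w) <=
    eta (mdist (set_val (pr z)) (set_val (pr v)) /
         mdist (set_val (pr z)) (set_val (pr w))))) in h.
  rewrite !prE // ler_pdivrMr ?th_gt0 // in h.
  by rewrite /th mulrCA; apply: ler_wpM2l => //; exact: ltW.
have e_ge0 t : 0 <= t -> 0 <= eta t.
  by move=> t0; have := eA t; rewrite /= !in_itv /= !andbT; apply.
have e_mono a b : 0 <= a -> a <= b -> eta a <= eta b.
  by move=> a0; rewrite le_eqVlt => /orP[/eqP ->//|ab]; apply/ltW/me.
have m0 z w : 0 <= th z w by rewrite mulr_ge0 // ltW.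
have mx z : th z z = 0 by rewrite /th distxx mulr0.
have ms z w : th z w = th w z by rewrite /th dist_sym.
have mt z w v : th z v <= th z w + th w v.
  by rewrite -mulrDr; apply: ler_wpM2l; [exact: ltW|exact: dist_triangle].
have ml z w : 3 * th z w <= 1.
  rewrite /th /s mulrA invfM mulrA mulfV // mul1r mulrC ler_pdivrMr //.
  by rewrite mul1r.
have UB z t (Zz : Z z) (t0 : 0 < t) : _ :=
  @modulus_bounds Z th T z t m0 ml mx Zz (ltW (mulr_gt0 T0 t0)).
pose U := modulus Z th T.
have ann z t : Z z -> 0 < t -> t <= 1 ->
    exists w, [/\ Z w, T * t / 2 <= mdist z w, mdist z w < T * t & z != w].
  move=> Zz t0 t1.
  have Tt0 : 0 < T * t by rewrite mulr_gt0.
  have [v Zv Tv] : exists2 v, Z v & T <= mdist z v.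
    have [h|h] := leP T (mdist z u); first by exists u.
    exists u' => //; have := metric_triangle u z u'; rewrite (metric_sym u z).
    by move: h duu; rewrite /T; lra.
  pose z' : Z := SigSub (mem_set Zz); pose v' : Z := SigSub (mem_set Zv).
  have [|w w1 w2] := @connected_annulus R (set_type Z) z' v' (T * t) cZ Tt0.
    by apply: le_trans Tv; rewrite ler_piMr // ltW.
  exists (set_val w); split => //; first exact: set_valP.
  by rewrite -mdist_gt0; apply: lt_le_trans w1; rewrite divr_gt0.
have grow z t tau : Z z -> 0 < t -> t <= 1 -> 0 < tau -> U z (tau * t) <= eta (2 * tau) * U z t.
  move=> Zz t0 t1 tau0; have [w [Zw w1 w2 zw]] := ann z t Zz t0 t1.
  have [_ ub _] := UB z (tau * t) Zz (mulr_gt0 tau0 t0).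
  have [up _ _] := UB z t Zz t0.
  have Tt0 : 0 < T * t by rewrite mulr_gt0.
  apply: ub => v Zv zv; apply: le_trans (H z w v Zz Zw Zv zw) _.
  apply: ler_pM => //; first by rewrite e_ge0 // divr_ge0 // mdist_ge0.
    apply: e_mono; first by rewrite divr_ge0 // mdist_ge0.
    have dw : 0 < mdist z w by rewrite mdist_gt0.
    rewrite ler_pdivrMr //; apply: (le_trans zv).
    have -> : T * (tau * t) = 2 * tau * (T * t / 2) by field.
    by rewrite ler_pM2l // mulr_gt0.
  by apply: up => //; exact: ltW.
have far1 z w : Z z -> Z w -> th z w <= eta (2 * D0 / T) * U z 1.
  move=> Zz Zw; have [v [Zv v1 v2 zv]] := ann z 1 Zz ltr01 (lexx 1).
  have [up _ _] := UB z 1 Zz ltr01.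
  have dv : 0 < mdist z v by rewrite mdist_gt0.
  apply: le_trans (H z v w Zz Zv Zw zv) _; apply: ler_pM => //.
  - by rewrite e_ge0 // divr_ge0 // mdist_ge0.
  - apply: e_mono; first by rewrite divr_ge0 // mdist_ge0.
    rewrite ler_pdivrMr //; apply: le_trans (bD z w) _.
    have -> : 2 * D0 / T * mdist z v = D0 * (mdist z v / (T * 1 / 2)).
      by field; rewrite gt_eqF.
    by rewrite ler_peMr ?(ltW D00) // ler_pdivlMr ?mul1r // mulr1 divr_gt0.
  - by apply: up => //; exact: ltW.
have U_mono z t t' : Z z -> 0 < t -> t <= t' -> U z t <= U z t'.
  move=> Zz t0 tt; have [_ ub _] := UB z t Zz t0.
  have [up _ _] := UB z t' Zz (lt_le_trans t0 tt).
  apply: ub => w Zw zw; apply: up => //; apply: le_trans zw _.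
  by rewrite ler_pM2l.
(* Dividing the radius by [2^m] at least halves the modulus, since [eta] is small near 0; the rate
   for a single halving is then [k = 2^(- 1 / m)]. *)
have [m [m_gt0 hm]] : exists m : nat, (0 < m)%N /\ eta (2 * (2 ^+ m)^-1) <= 2^-1.
  have [r r0 er] : exists2 r, 0 < r & eta r = 2^-1.
    have /eS[r] : `[0, +oo[%classic (2^-1 : R) by rewrite /= in_itv /= andbT invr_ge0.
    have eta00 : eta 0 = 0.
      have /eS[a] : `[0, +oo[%classic (0 : R) by rewrite /= in_itv /= lexx.
      rewrite /= in_itv /= andbT le_eqVlt => /orP[/eqP <- //|a0 ea].
      by have := me _ _ (lexx 0) a0; rewrite ea ltNge e_ge0.
    rewrite /= in_itv /= andbT le_eqVlt => /orP[/eqP <-|r0 er]; last by exists r.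
    by rewrite eta00 => /eqP; rewrite eq_sym invr_eq0 pnatr_eq0.
  have [|||n hn] := @exists_geom_lt R 2 1 (r / 2); [by []|exact: ltr01|by rewrite divr_gt0|].
  exists n.+1; split => //; rewrite -er; apply: e_mono.
    by rewrite mulr_ge0 // invr_ge0 exprn_ge0.
  rewrite -ler_pdivlMl // mulrC; apply: ltW; apply: le_lt_trans hn.
  rewrite div1r lef_pV2 ?posrE ?exprn_gt0 // exprS ler_peMl ?exprn_ge0 // ler1n //.
pose k : R := 2^-1 `^ m%:R^-1.
have mR : 0 < m%:R :> R by rewrite ltr0n.
have k0 : 0 < k by rewrite powR_gt0 // invr_gt0.
have k1 : k < 1.
  have := @gt0_ltr_powR R m%:R^-1 _ 2^-1 1; rewrite powR1; apply.
  - by rewrite invr_gt0.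
  - by rewrite nnegrE invr_ge0.
  - by rewrite nnegrE.
  - by rewrite invf_lt1 // ltr1n.
have km : k ^+ m = 2^-1.
  by rewrite /k -powR_mulrn ?powR_ge0 // -powRrM mulVf ?gt_eqF // powRr1 // invr_ge0.
have decay z t n : Z z -> 0 < t -> t <= 1 -> U z (t / 2 ^+ n) <= 2 * k ^+ n * U z t.
  move=> Zz t0 t1.
  have U0 r : 0 < r -> 0 <= U z r by move=> r0; have [_ _] := UB z r Zz r0.
  have pos i : 0 < t / 2 ^+ i by rewrite divr_gt0 // exprn_gt0.
  have le1 i : t / 2 ^+ i <= 1.
    rewrite ler_pdivrMr ?exprn_gt0 // mul1r; apply: (le_trans t1).
    by rewrite exprn_ege1 // ler1n.
  have steps i : U z (t / 2 ^+ (m * i)) <= k ^+ (m * i) * U z t.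
    elim: i => [|i IH]; first by rewrite muln0 !expr0 divr1 mul1r.
    rewrite mulnS !exprD.
    have -> : t / (2 ^+ m * 2 ^+ (m * i)) = (2 ^+ m)^-1 * (t / 2 ^+ (m * i)).
      by rewrite invfM; ring.
    apply: le_trans (grow z _ _ Zz (pos _) (le1 _) _) _.
      by rewrite invr_gt0 exprn_gt0.
    rewrite -mulrA; apply: ler_pM => //; [|exact: U0|by rewrite km].
    by rewrite e_ge0 // mulr_ge0 // invr_ge0 exprn_ge0.
  have nE : n = (m * (n %/ m) + n %% m)%N by rewrite mulnC -divn_eq.
  have rm : (n %% m < m)%N by rewrite ltn_mod.
  rewrite nE; move: (n %/ m)%N (n %% m)%N rm {nE} => i r rm.
  apply: (@le_trans _ _ (U z (t / 2 ^+ (m * i)))).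
    apply: U_mono => //; rewrite ler_pM2l // lef_pV2 ?posrE ?exprn_gt0 //.
    by apply: ler_weXn2l; rewrite ?ler1n // leq_addr.
  apply: le_trans (steps _) _; apply: ler_wpM2r; first exact: U0.
  rewrite exprD mulrCA ler_peMr ?exprn_ge0 ?(ltW k0) //.
  rewrite -ler_pdivrMl // mulr1 -km; apply: ler_wiXn2l; rewrite ?(ltW k0) ?(ltW k1) //.
  exact: ltnW.
have far z w t : Z z -> Z w -> 0 < t -> T * t <= mdist z w -> U z t <= eta 1 * th z w.
  move=> Zz Zw t0 h; have [_ ub _] := UB z t Zz t0.
  have dw : 0 < mdist z w by apply: lt_le_trans h; rewrite mulr_gt0.
  apply: ub => v Zv zv; apply: le_trans (H z w v Zz Zw Zv _) _; first by rewrite -mdist_gt0.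
  apply: ler_wpM2r => //; apply: e_mono; first by rewrite divr_ge0 // mdist_ge0.
  by rewrite ler_pdivrMr // mul1r; exact: le_trans zv h.
pose b := th u u'.
have b00 : 0 < b.
  rewrite mulr_gt0 // th_gt0 //; apply/eqP => e.
  have : u = u' by rewrite -(prE u zu) e prE.
  by move=> uu; move: duu; rewrite uu mdistxx leNgt d0.
pose E := eta (2 * D0 / T).
have E0 : 0 <= E by rewrite e_ge0 // divr_ge0 ?(ltW T0) // mulr_ge0 // ltW.
have unit z : Z z -> b / 2 <= E * U z 1.
  move=> Zz; have h1 := far1 z u Zz zu; have h2 := far1 z u' Zz zu'.
  have := mt u z u'; rewrite (ms u z) -/b => h3.
  by rewrite /E; lra.
pose B := C + eta 4 + E + 2 + eta 1 + 2 * E / b.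
have e4 : 0 <= eta 4 by exact: e_ge0.
have e1 : 0 <= eta 1 by exact: e_ge0.
have eb : 0 <= 2 * E / b by rewrite divr_ge0 ?(ltW b00) // mulr_ge0.
exists th, B, k; split; [by rewrite /B; lra|by rewrite k0 k1|].
have UU z t : Z z -> 0 < t -> 0 <= U z t by move=> Zz t0; have [_ _] := UB z t Zz t0.
split => //.
- move=> z t Zz t0; rewrite -/(U z (2 * t)) -/(U z t).
  have [t1|t1] := leP t 1.
    apply: le_trans (grow z t 2 Zz t0 t1 _) _ => //.
    have -> : 2 * 2 = 4 :> R by ring.
    by apply: ler_wpM2r; [exact: UU|rewrite /B; lra].
  have t20 : 0 < 2 * t by rewrite mulr_gt0.
  have [_ ub _] := UB z (2 * t) Zz t20.
  apply: ub => w Zw _; apply: le_trans (far1 z w Zz Zw) _.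
  apply: ler_pM => //; [exact: UU|rewrite /B -/E; lra|].
  by apply: U_mono => //; exact: ltW.
- move=> z t n Zz t0 t1; apply: le_trans (decay z t n Zz t0 t1) _.
  apply: ler_wpM2r; first exact: UU.
  by apply: ler_wpM2r; [rewrite exprn_ge0 // ltW|rewrite /B; have := C1; lra].
- move=> z w t Zz Zw t0 h; apply: le_trans (far z w t Zz Zw t0 h) _.
  by apply: ler_wpM2r => //; rewrite /B; have := C1; lra.
- move=> z Zz; have h := unit z Zz; rewrite -/(U z 1).
  apply: (@le_trans _ _ (2 * E / b * U z 1)).
    have -> : 2 * E / b * U z 1 = (E * U z 1) / (b / 2) by field; rewrite gt_eqF.
    by rewrite ler_pdivlMr ?divr_gt0 // mul1r.
  by apply: ler_wpM2r; [exact: UU|rewrite /B; have := C1; lra].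
- apply: (@packing_weaken R X th q q C B) => //.
  + by apply: le_trans C1.
  + by rewrite /B; lra.
  move=> x rho r t r0 rr ut t1 t2.
  have inj : {in t &, injective pr}.
    move=> y v yt vt e; apply/eqP/negPn/negP => yv.
    by have := t2 y v yt vt yv; rewrite /th e distxx mulr0 leNgt r0.
  rewrite -(size_map pr).
  have -> : rho / r = (rho / s) / (r / s) by field; rewrite !gt_eqF.
  apply: (pk (pr x)).
  + by rewrite divr_gt0.
  + by rewrite ler_pM2r // invr_gt0.
  + by rewrite map_inj_in_uniq.
  + by move=> _ /mapP[y yt ->]; rewrite ltr_pdivlMr // mulrC; exact: t1.
  + move=> _ _ /mapP[y yt ->] /mapP[v vt ->] ne.
    rewrite ler_pdivrMr // mulrC; apply: t2 => //.
    by apply: contraNneq ne => ->.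
Qed.

(** One number [c] encodes three constants: the gap between exponent and [p], the inverse of [B],
    and [1 - k]. Decreasing [c] weakens all three, so a minimum over the finitely many large
    components serves for all. *)
Lemma exists_uniform_models (p delta : R) : 0 < p -> 0 < delta ->
  (forall Y : set X, components X Y -> connected [set: set_type Y]) ->
  finite_set [set Y : set X | components X Y /\ (delta%:E <= diam Y)%E] ->
  (forall Y : set X, components X Y -> (dim_AR (set_type Y) < p%:E)%E) ->
  exists c, [/\ 0 < c, c <= 2^-1, c < p & forall z0 u u', same z0 u -> same z0 u' ->
    delta <= mdist u u' -> exists th,
    model (connected_component [set: X] z0) th (delta / 2) (p - c) c^-1 (1 - c)].
Proof.
move=> p0 d0 cY /finite_seqP[s sE] dY.
pose P (Y : set X) c := c <= 2^-1 /\ (c < p /\ (forall z0 u u', Y = connected_component [set: X] z0 ->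
  same z0 u -> same z0 u' -> delta <= mdist u u' -> exists th,
  model Y th (delta / 2) (p - c) c^-1 (1 - c))).
have [||c c0 H] := @finite_uniform_pos R _ s P.
- move=> Y c c' c'0 cc [c2 [cp h]]; split; first exact: le_trans cc c2.
  split; first exact: le_lt_trans cc cp.
  move=> z0 u u' e zu zu' duu; have [th hth] := h z0 u u' e zu zu' duu.
  exists th; apply: model_weaken hth.
  + by rewrite divr_ge0 // ltW.
  + by rewrite invr_ge0 (le_trans (ltW c'0)).
  + by rewrite lerD2l lerN2.
  + by rewrite lef_pV2 ?posrE // (lt_le_trans c'0).
  + by rewrite subr_ge0 (le_trans c2) // invf_le1 // ler1n.
  + by rewrite lerD2l lerN2.
- move=> Y Ys; have [[x0 _ Yx0] _] : [set Y : set X | components X Y /\ (delta%:E <= diam Y)%E] Y.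
    by rewrite sE.
  have compY : components X Y by exists x0.
  have dpos : 0 < Num.min (2^-1) (p / 2) by rewrite lt_min invr_gt0 divr_gt0 // ltr0n.
  have [[u [u' [zu zu' duu]]]|none] := pselect (exists u u' : X,
      [/\ same x0 u, same x0 u' & delta <= mdist u u']); last first.
    exists (Num.min (2^-1) (p / 2)) => //; split; first by rewrite ge_min lexx.
    split; first by rewrite gt_min ltr_pdivrMr // ltr_pMr // ltr1n orbT.
    move=> z0 u u' e zu zu' duu; exfalso; apply: none; exists u, u'; split => //.
      by have : Y u by [rewrite e]; rewrite -Yx0.
    by have : Y u' by [rewrite e]; rewrite -Yx0.
  have [|||theta [q [C [q0 qp C1 pk qs]]]] := @dim_AR_lt R (set_type (connected_component [set: X] x0)) p.
  + by apply: compact_set_type; apply: subclosed_compact (@closed_component R X x0) cX _.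
  + exists (SigSub (mem_set zu)), (SigSub (mem_set zu')); apply/eqP => e.
    have : u = u' by exact: (congr1 set_val e).
    by move=> uu; move: duu; rewrite uu mdistxx leNgt d0.
  + by rewrite Yx0; exact: dY.
  have cYx : connected [set: connected_component [set: X] x0] by rewrite Yx0; exact: cY.
  have [th [B [k [B1 /andP[k0 k1] m]]]] := exists_model d0 zu zu' duu cYx C1 pk qs.
  have B0 : 0 < B by exact: lt_le_trans B1.
  pose c := Num.min (Num.min 2^-1 (p / 2)) (Num.min (p - q) (Num.min B^-1 (1 - k))).
  have c0 : 0 < c by rewrite /c lt_min dpos !lt_min !subr_gt0 qp invr_gt0 B0 k1.
  exists c => //; split; first by rewrite /c !ge_min lexx.
  split.
    by rewrite /c !gt_min ltr_pdivrMr // ltr_pMr // ltr1n !orbT.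
  move=> z0 v v' e zv zv' dvv; exists th.
  rewrite -Yx0; apply: model_weaken m.
  + by rewrite divr_ge0 // ltW.
  + exact: ltW.
  + have : c <= p - q by rewrite /c !ge_min lexx !orbT.
    by lra.
  + have : c <= B^-1 by rewrite /c !ge_min lexx !orbT.
    by rewrite -{1}(invrK c) lef_pV2 ?posrE ?invr_gt0.
  + exact: ltW.
  + have : c <= 1 - k by rewrite /c !ge_min lexx !orbT.
    by lra.
have Hs z0 u u' : same z0 u -> same z0 u' -> delta <= mdist u u' ->
    connected_component [set: X] z0 \in s.
  move=> zu zu' duu; suff : [set` s] (connected_component [set: X] z0) by [].
  rewrite -sE; split; first by exists z0.
  by apply: le_trans (mdist_le_diam zu zu'); rewrite lee_fin.
pose c' := Num.min c (Num.min 2^-1 (p / 2)).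
have c'0 : 0 < c' by rewrite !lt_min c0 invr_gt0 divr_gt0 // ltr0n.
exists c'; split => //.
- by rewrite /c' !ge_min lexx orbT.
- by rewrite /c' !gt_min [X in _ || (_ || X)]ltr_pdivrMr // ltr_pMr // ltr1n !orbT.
move=> z0 u u' zu zu' duu.
have [h1 [h2 h3]] := H _ (Hs _ _ _ zu zu' duu).
have [th m] := h3 z0 u u' erefl zu zu' duu.
have cc : c' <= c by rewrite /c' ge_min lexx.
exists th; apply: model_weaken m.
+ by rewrite divr_ge0 // ltW.
+ by rewrite invr_ge0 ltW.
+ by rewrite lerD2l lerN2.
+ by rewrite lef_pV2 ?posrE.
+ by rewrite subr_ge0 (le_trans h1) // invf_le1 // ler1n.
+ by rewrite lerD2l lerN2.
Qed.

End Models.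

Section ModulusEstimates.
Context (R : realType) (X : metricType R).
Implicit Types (Z : set X) (th : X -> X -> R) (z w : X) (t a T B q k : R).

Section OneModel.
Variables (Z : set X) (th : X -> X -> R) (T q B k : R).
Hypotheses (T0 : 0 < T) (B1 : 1 <= B) (m : model Z th T q B k).
Local Notation U := (modulus Z th T).

Let bnd z t (Zz : Z z) (t0 : 0 <= t) := @modulus_bounds R X Z th T z t
  (model_ge0 m) (model_le m) (model_xx m) Zz (mulr_ge0 (ltW T0) t0).

Lemma modulus_ge0 z t : Z z -> 0 <= t -> 0 <= U z t.
Proof. by move=> Zz t0; have [_ _] := bnd Zz t0. Qed.

Lemma modulus_ge z w t : Z z -> Z w -> 0 <= t -> mdist z w <= T * t -> th z w <= U z t.
Proof. by move=> Zz Zw t0; have [+ _ _] := bnd Zz t0; apply. Qed.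

Lemma modulus_le z t b : Z z -> 0 <= t ->
  (forall w, Z w -> mdist z w <= T * t -> th z w <= b) -> U z t <= b.
Proof. by move=> Zz t0; have [_ + _] := bnd Zz t0; apply. Qed.

Lemma modulus_le3 z t : Z z -> 0 <= t -> 3 * U z t <= 1.
Proof.
move=> Zz t0; rewrite -ler_pdivlMl // mulr1; apply: modulus_le => // w _ _.
by have := model_le m z w; lra.
Qed.

Lemma modulus_mono z t t' : Z z -> 0 <= t -> t <= t' -> U z t <= U z t'.
Proof.
move=> Zz t0 tt; apply: modulus_le => // w Zw zw; apply: modulus_ge => //.
  exact: le_trans tt.
by apply: le_trans zw _; rewrite ler_pM2l.
Qed.

Lemma modulus_pow z t n : Z z -> 0 < t -> U z (2 ^+ n * t) <= B ^+ n * U z t.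
Proof.
move=> Zz t0; elim: n => [|n IH]; first by rewrite !expr0 !mul1r.
rewrite !exprS -!mulrA; apply: le_trans (model_double m _ _) _ => //.
  by rewrite mulr_gt0 // exprn_gt0.
by rewrite ler_pM2l // (lt_le_trans ltr01).
Qed.

Lemma modulus_gt0 z t : Z z -> 0 < t -> 0 < U z t.
Proof.
move=> Zz t0; have B0 : 0 < B := lt_le_trans ltr01 B1.
have [|n hn] := @exists_geom_lt R 2 1 t _ ltr01 t0; first by [].
have h : 1 <= 2 ^+ n * t.
  by move: hn; rewrite ltr_pdivrMr ?exprn_gt0 // mulrC => /ltW.
have := model_unit m Zz; have := modulus_pow n Zz t0.
have := modulus_mono Zz ler01 h => h1 h2 h3.
rewrite lt_neqAle modulus_ge0 ?(ltW t0) // andbT; apply/eqP => E.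
move: h2; rewrite -E mulr0 => h2.
have : B * U z 1 <= 0 by rewrite pmulr_rle0 // (le_trans h1).
by lra.
Qed.

End OneModel.

Lemma pow2_bound a : exists n : nat, a <= 2 ^+ n.
Proof.
have [a0|a0] := ltP 0 a; last by exists 0%N; rewrite expr0 (le_trans a0).
have [|n hn] := @exists_geom_lt R 2 a 1 _ a0 ltr01; first by [].
by exists n; move: hn; rewrite ltr_pdivrMr ?exprn_gt0 // mul1r => /ltW.
Qed.

Lemma modulus_scale B T a : 0 < T -> 1 <= B -> 0 < a -> exists2 C, 1 <= C &
  forall Z th q k z t, model Z th T q B k -> Z z -> 0 < t ->
    modulus Z th T z (a * t) <= C * modulus Z th T z t.
Proof.
move=> T0 B1 a0; have [n an] := pow2_bound a.
exists (B ^+ n); first by rewrite exprn_ege1.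
move=> Z th q k z t m Zz t0; apply: le_trans (modulus_pow B1 m n Zz t0).
apply: (modulus_mono T0 m) => //; first by rewrite mulr_ge0 // ltW.
by rewrite ler_pM2r.
Qed.

Lemma modulus_near B T a : 0 < T -> 1 <= B -> 0 < a -> exists2 C, 1 <= C &
  forall Z th q k z w t, model Z th T q B k -> Z z -> Z w -> 0 < t ->
    mdist z w <= a * t -> th z w <= C * modulus Z th T z t.
Proof.
move=> T0 B1 a0; have aT : 0 < a / T by rewrite divr_gt0.
have [C C1 H] := modulus_scale T0 B1 aT.
exists C => // Z th q k z w t m Zz Zw t0 zw.
apply: le_trans (H _ _ _ _ _ _ m Zz t0).
apply: (modulus_ge T0 m) => //; first by rewrite mulr_ge0 // ltW.
by rewrite mulrA (mulrC T) divfK // gt_eqF.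
Qed.

Lemma modulus_move B T a : 0 < T -> 1 <= B -> 0 < a -> exists2 C, 1 <= C &
  forall Z th q k z w t, model Z th T q B k -> Z z -> Z w -> 0 < t ->
    mdist z w <= a * t -> modulus Z th T w t <= C * modulus Z th T z t.
Proof.
move=> T0 B1 a0; have aT : 0 < a + T by rewrite addr_gt0.
have [C C1 H] := modulus_near T0 B1 aT.
exists (2 * C); first by rewrite mulr_ege1 // ler1n.
move=> Z th q k z w t m Zz Zw t0 zw; apply: (modulus_le T0 m) => //; first exact: ltW.
move=> v Zv wv; apply: le_trans (model_tri m w z v) _; rewrite (model_sym m w).
have h1 : th z w <= C * modulus Z th T z t.
  apply: (H _ _ _ _ _ _ _ m) => //; apply: le_trans zw _.
  by rewrite ler_pM2r // lerDl ltW.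
have h2 : th z v <= C * modulus Z th T z t.
  apply: (H _ _ _ _ _ _ _ m) => //; apply: le_trans (metric_triangle _ w _) _.
  by rewrite mulrDl lerD.
by rewrite -mulrA; lra.
Qed.

Lemma modulus_far B T a : 0 < T -> 1 <= B -> 0 < a -> exists2 C, 1 <= C &
  forall Z th q k z w t, model Z th T q B k -> Z z -> Z w -> 0 < t ->
    a * t <= mdist z w -> modulus Z th T z t <= C * th z w.
Proof.
move=> T0 B1 a0; have Ta : 0 < T / a by rewrite divr_gt0.
have [C C1 H] := modulus_scale T0 B1 Ta.
exists (C * B); first by rewrite mulr_ege1.
move=> Z th q k z w t m Zz Zw t0 zw.
have t'0 : 0 < a / T * t by rewrite mulr_gt0 // divr_gt0.
have := H _ _ _ _ _ _ m Zz t'0.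
have -> : T / a * (a / T * t) = t by field; rewrite !gt_eqF.
move=> /le_trans; apply; rewrite -(mulrA C) ler_pM2l ?(lt_le_trans ltr01) //.
apply: (model_far m) => //.
by rewrite mulrA (mulrC T) divfK // gt_eqF.
Qed.

(* This is what bounds the number of children of a node that have comparable
   gauges and are close in the model: they live at comparable scales, so that
   the doubling property counts them. *)
Lemma modulus_comparable B T k S : 0 < T -> 1 <= B -> 0 < k < 1 -> 0 < S ->
  exists2 C, 1 <= C & forall Z th q z w u n1 n2, model Z th T q B k ->
    (forall x y : X, mdist x y < S) -> Z z -> Z w ->
    let U := modulus Z th T in let t n := (2 ^+ n)^-1 in
    th z w <= 2 * u -> u <= 2 * U z (t n1) -> U z (t n1) <= u ->
    u <= 2 * U w (t n2) -> U w (t n2) <= u -> 0 < u ->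
    mdist z w <= C * t n1 /\ t n2 <= C * t n1.
Proof.
move=> T0 B1 /andP[k0 k1] S0; have B0 : 0 < B := lt_le_trans ltr01 B1.
have kpow e : 0 < e -> exists n, k ^+ n < e.
  move=> e0; have : (fun n => k ^+ n) @ \oo --> (0 : R).
    by apply: cvg_expr; rewrite ger0_norm // ltW.
  move=> /cvgrPdist_lt/(_ _ e0)[N _ H]; exists N.
  by have := H N (leqnn N); rewrite /= sub0r normrN ger0_norm // exprn_ge0 // ltW.
have B4 : 0 < (4 * B * B)^-1 by rewrite invr_gt0 !mulr_gt0.
have [m1 hm1] := kpow _ B4.
(* If [w] were farther from [z] than this multiple of the radius, [m1] halvings would make the
   modulus too small against [th z w]. The summand [S] covers the case where the enlarged radius
   exceeds 1, out of reach of the decay. *)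
pose a := (T + S) * 2 ^+ m1.
have a0 : 0 < a by rewrite mulr_gt0 ?addr_gt0 // exprn_gt0.
have [V V1 HV] := modulus_move T0 B1 a0.
have V0 : 0 < V := lt_le_trans ltr01 V1.
have BV : 0 < (2 * B * V)^-1 by rewrite invr_gt0 !mulr_gt0.
have [m2 hm2] := kpow _ BV.
have p2 n : 0 < (2 ^+ n)^-1 :> R by rewrite invr_gt0 exprn_gt0.
have p21 n : (2 ^+ n)^-1 <= 1 :> R.
  by rewrite invf_le1 ?exprn_gt0 // exprn_ege1 // ler1n.
have near Z th q z w u n1 : model Z th T q B k ->
    (forall x y : X, mdist x y < S) -> Z z -> Z w -> th z w <= 2 * u ->
    u <= 2 * modulus Z th T z (2 ^+ n1)^-1 -> 0 < u ->
    mdist z w <= a * (2 ^+ n1)^-1.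
  move=> m bS Zz Zw zw h1 u0.
  have [big|small] := leP 1 (2 ^+ m1 * (2 ^+ n1)^-1 : R).
    rewrite /a -mulrA; apply: (@le_trans _ _ (T + S)).
      by have := bS z w; lra.
    by rewrite ler_peMr // addr_ge0 // ltW.
  rewrite leNgt; apply/negP => far.
  pose t' : R := 2 ^+ m1 * (2 ^+ n1)^-1.
  have t'0 : 0 < t' by rewrite mulr_gt0 // exprn_gt0.
  have h2 : modulus Z th T z t' <= B * th z w.
    apply: (model_far m) => //; apply: le_trans (ltW far).
    by rewrite /a -mulrA -/t' ler_pM2r // lerDl ltW.
  have h3 := model_decay m m1 Zz t'0 (ltW small).
  have E : t' / 2 ^+ m1 = (2 ^+ n1)^-1.
    by rewrite /t' mulrAC mulfV ?mul1r // gt_eqF // exprn_gt0.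
  rewrite E in h3.
  have : u < u; last by rewrite ltxx.
  apply: le_lt_trans h1 _.
  apply: (@le_lt_trans _ _ (2 * (B * k ^+ m1 * (B * (2 * u))))).
    rewrite ler_pM2l //; apply: le_trans h3 _.
    rewrite ler_pM2l ?mulr_gt0 ?exprn_gt0 //; apply: le_trans h2 _.
    by rewrite ler_pM2l.
  have -> : 2 * (B * k ^+ m1 * (B * (2 * u))) = k ^+ m1 * (4 * B * B) * u by ring.
  by rewrite gtr_pMl // -ltr_pdivlMr ?mulr_gt0 // div1r.
exists (a + 2 ^+ m2); first by apply: ler_wpDl; [exact: ltW|rewrite exprn_ege1 // ler1n].
move=> Z th q z w u n1 n2 m bS Zz Zw U t zw h1 h2 h3 h4 u0.
have tp n : 0 < t n by exact: p2.
have d1 := near _ _ _ _ _ _ _ m bS Zz Zw zw h1 u0.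
have wz : th w z <= 2 * u by rewrite (model_sym m).
have d2 := near _ _ _ _ _ _ _ m bS Zw Zz wz h3 u0.
split; first by apply: le_trans d1 _; rewrite ler_pM2r ?tp // lerDl exprn_ge0.
rewrite leNgt; apply/negP => lt12.
have lt12' : 2 ^+ m2 * t n1 < t n2.
  by apply: le_lt_trans lt12; rewrite ler_pM2r ?tp // lerDr ltW.
have n12 : (n2 + m2 < n1)%N.
  rewrite ltnNge; apply/negP => n12.
  move: lt12'; apply/negP; rewrite -leNgt /t.
  rewrite -ler_pdivrMl ?exprn_gt0 // -invfM -exprD lef_pV2 ?posrE ?exprn_gt0 //.
  by apply: ler_weXn2l; rewrite ?ler1n // addnC.
have E : t n1 = t n2 / 2 ^+ (n1 - n2).
  by rewrite /t -invfM -exprD subnKC // (leq_trans (leq_addr m2 n2)) // ltnW.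
have h5 := model_decay m (n1 - n2) Zz (p2 n2) (p21 n2); rewrite -/(t n2) -E in h5.
have h6 : U z (t n2) <= V * u.
  apply: le_trans (ler_wpM2l (ltW V0) h4).
  exact: (HV _ _ _ _ _ _ _ m Zw Zz (tp n2) d2).
have h7 : k ^+ (n1 - n2) <= k ^+ m2.
  apply: ler_wiXn2l; rewrite ?(ltW k0) ?(ltW k1) //.
  rewrite leq_subRL; [exact: ltnW n12|exact: leq_trans (leq_addr m2 n2) (ltnW n12)].
have u1 : 0 <= U z (t n2) := modulus_ge0 T0 m Zz (ltW (tp n2)).
have h8 : B * k ^+ (n1 - n2) <= B * k ^+ m2 := ler_wpM2l (ltW B0) h7.
have b0 : 0 <= B * k ^+ (n1 - n2) := mulr_ge0 (ltW B0) (exprn_ge0 _ (ltW k0)).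
have h9 := ler_wpM2l (ler0n R 2) (le_trans h5 (ler_pM b0 u1 h8 h6)).
have h10 : u <= 2 * (B * k ^+ m2 * (V * u)) := le_trans h1 h9.
have h11 : k ^+ m2 * (2 * B * V) < 1 by rewrite -ltr_pdivlMr ?mulr_gt0 // div1r.
have h12 : 0 < (1 - k ^+ m2 * (2 * B * V)) * u by rewrite mulr_gt0 // subr_gt0.
by lra.
Qed.

End ModulusEstimates.

(** * Counting separated points by doubling *)

Section Doubling.
Context (R : realType) (X : metricType R).

(** Halving the radius [m] times leaves balls too small to contain two points of the sequence. *)
Lemma doubling_count (a : R) : doubling X -> exists N : nat,
  forall (x : X) (r : R) (s : seq X), 0 < r -> uniq s ->
    {in s, forall y, mdist x y < a * r} ->
    {in s &, forall y z, y != z -> r <= mdist y z} -> (size s <= N)%N.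
Proof.
move=> [n dbl].
have main m (x : X) (r : R) (s : seq X) : 0 < r -> uniq s ->
    {in s, forall y, mdist x y < 2 ^+ m * r} ->
    {in s &, forall y z, y != z -> 2 * r <= mdist y z} -> (size s <= n ^ m)%N.
  move=> r0; elim: m x s => [|m IH] x s us s1 s2.
    rewrite expn0; case: s us s1 s2 => [|y [|z s]] //= /andP[yz _] s1 s2.
    have ne : y != z by apply: contraNneq yz => ->; rewrite inE eqxx.
    have := s2 y z; rewrite !inE !eqxx orbT => /(_ isT isT ne).
    have := s1 y; have := s1 z; rewrite !inE !eqxx orbT expr0 mul1r.
    move=> /(_ isT) h1 /(_ isT) h2; have := metric_triangle y x z.
    by rewrite (metric_sym y x) => h3 h4; exfalso; lra.
  have R0 : 0 < 2 ^+ m.+1 * r by rewrite mulr_gt0 // exprn_gt0.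
  have [c cn cov] := dbl x _ R0.
  have E : 2 ^+ m.+1 * r / 2 = 2 ^+ m * r by rewrite exprS; field.
  rewrite E in cov.
  have H : {in s, forall y, exists2 z, z \in c & mdist z y < 2 ^+ m * r}.
    move=> y ys; have [|z /= zc] := cov y; first by rewrite mballE s1.
    by rewrite mballE; exists z.
  apply: leq_trans (size_le_cover H) _.
  apply: (@leq_trans (\sum_(z <- c) n ^ m)%N).
    apply: leq_sum => z _; apply: (IH z).
    - by rewrite filter_uniq.
    - by move=> y; rewrite mem_filter => /andP[].
    - by move=> y v; rewrite !mem_filter => /andP[_ ys] /andP[_ vs]; exact: s2.
  by rewrite big_const_seq count_predT iter_addn_0 mulnC expnS leq_mul.
have [m am] := pow2_bound (2 * a).
exists (n ^ m)%N => x r s r0 us s1 s2.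
apply: (main m x (r / 2)) => //; first by rewrite divr_gt0.
- move=> y /s1 h; apply: lt_le_trans h _.
  by rewrite mulrA ler_pdivlMr // mulrAC ler_pM2r // mulrC.
- by move=> y z ys zs yz; rewrite mulrC divfK //; exact: s2.
Qed.

End Doubling.

(** * The tree of nodes *)

Section Nodes.
Context (R : realType) (X : metricType R).
Variables (S A : R) (x00 : X).
Hypotheses (S0 : 0 < S) (A1 : 1 <= A) (bS : forall x y : X, mdist x y < S).
Local Notation ch j := (chained (sc S j)).
Local Notation gd := (@good R X S A).

(** A representative that depends on the class only, so that all points of a class use the same
    chart; [x00] is the default required by [xget]. *)
Definition canon j (x : X) := xget x00 [set y | ch j x y].

Lemma canon_chained j x : ch j x (canon j x).
Proof. by apply: (@xgetPex _ x00 [set y | ch j x y]); exists x; exact: chained_refl. Qed.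

Lemma canon_eq j x y : ch j x y -> canon j x = canon j y.
Proof.
move=> xy; congr (xget x00 _); apply/seteqP; split => z /=.
  exact: chained_trans (chained_sym xy).
exact: chained_trans xy.
Qed.

Definition exit_level j x : option nat :=
  if pselect (exists e, (j < e)%N && `[< gd e x >]) is left h
  then Some (ex_minn h) else None.

Definition next_level j x : option nat :=
  if `[< gd j x >] then Some j.+1 else exit_level j x.

Lemma next_good j x : gd j x -> next_level j x = Some j.+1.
Proof. by move=> g; rewrite /next_level asboolT. Qed.

Lemma next_bad j x : ~ gd j x ->
  if next_level j x is Some e
  then [/\ (j < e)%N, gd e x & forall m, (j <= m < e)%N -> ~ gd m x]
  else forall m, (j <= m)%N -> ~ gd m x.
Proof.
move=> b; rewrite /next_level asboolF // /exit_level; case: pselect => [h|n].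
  case: ex_minnP => e /andP[je /asboolP ge] emin; split => // m /andP[jm me] gm.
  move: jm; rewrite leq_eqVlt => /orP[/eqP E|jm]; first by apply: b; rewrite E.
  by have := emin m; rewrite jm (asboolT gm) leqNgt me => /(_ isT).
move=> m; rewrite leq_eqVlt => /orP[/eqP <-//|jm] gm.
by apply: n; exists m; rewrite jm (asboolT gm).
Qed.

Lemma next_bad_eq j x e : ~ gd j x -> (j < e)%N -> gd e x ->
  (forall m, (j <= m < e)%N -> ~ gd m x) -> next_level j x = Some e.
Proof.
move=> b je ge H; have := next_bad b; case: next_level => [e'|]; last first.
  by move=> /(_ e (ltnW je)).
move=> [je' ge' H']; congr Some.
have [ee|ee|//] := ltngtP e' e.
  by case: (H e') => //; rewrite ee ltnW.
by case: (H' e) => //; rewrite ee ltnW.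
Qed.

Lemma next_gt j x e : next_level j x = Some e -> (j < e)%N.
Proof.
have [g|b] := pselect (gd j x); first by rewrite next_good // => -[<-].
by move=> E; have := next_bad b; rewrite E => -[].
Qed.

Lemma next_chained j x y e : next_level j x = Some e -> ch e x y ->
  next_level j y = Some e.
Proof.
move=> E xy; have je := next_gt E.
have tr m : (m <= e)%N -> gd m x -> gd m y by move=> me; exact: good_chained_le xy.
have tr' m : (m <= e)%N -> gd m y -> gd m x.
  by move=> me; apply: good_chained_le (chained_sym xy).
have [g|b] := pselect (gd j x).
  by move: E; rewrite next_good // => -[<-]; rewrite next_good //; apply: tr => //; exact: ltnW.
have := next_bad b; rewrite E => -[_ ge H]; apply: next_bad_eq => //.
- by move=> /(tr' j (ltnW je)).
- exact: tr.
- by move=> m /andP[jm me] /(tr' m (ltnW me)); apply: H; rewrite jm.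
Qed.

Definition next_same j x y := exists2 e, next_level j x = Some e & ch e x y.

Lemma next_same_sym j x y : next_same j x y -> next_same j y x.
Proof. by move=> [e E xy]; exists e; [exact: next_chained xy|exact: chained_sym]. Qed.

Lemma next_same_chained j x y : next_same j x y -> ch j x y.
Proof. by move=> [e /next_gt je]; apply: chained_anti => //; exact: ltnW. Qed.

(* A bad coarse component at level j is a single node until the first level at
   which the point becomes good again; if there is none, x has no node of the
   next generation. *)
Fixpoint node_level i x : option nat :=
  if i is i'.+1 then obind (next_level^~ x) (node_level i' x) else Some 0%N.

Definition same_node i x y := exists2 j, node_level i x = Some j & ch j x y.

Lemma node_level_chained i x y j : node_level i x = Some j -> ch j x y ->
  node_level i y = Some j.
Proof.
elim: i j => [|i IH] j /=; first by move=> [<-].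
case E: (node_level i x) => [j'|] //= n xy.
rewrite (IH j') //=; first exact: next_chained xy.
by apply: chained_anti xy => //; exact: ltnW (next_gt n).
Qed.

Lemma node_level_ge i x j : node_level i x = Some j -> (i <= j)%N.
Proof.
elim: i j => [|i IH] j //=; case E: (node_level i x) => [j'|] //= /next_gt.
exact: leq_ltn_trans (IH _ E).
Qed.

Lemma good0 x : gd 0 x.
Proof.
move=> y z _ _; apply: le_trans (ltW (bS y z)) _.
by rewrite /sc expr0 divr1 ler_peMl // ltW.
Qed.

(** A bad stretch is crossed in a single step, so a node at a bad level always begins right after a
    good one. This is the situation in which charts exist. *)
Definition bad_start j x := ~ gd j x /\ gd j.-1 x.

Lemma node_level_bad i x j : node_level i x = Some j -> ~ gd j x -> bad_start j x.
Proof.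
move=> E b; split => //; case: i E => [[<-]|i /=]; first exact: good0.
case E: (node_level i x) => [j'|] //= E' .
have [g|b'] := pselect (gd j' x); first by move: E'; rewrite next_good // => -[<-].
by have := next_bad b'; rewrite E' => -[].
Qed.

Lemma same_nodeS i x y : same_node i.+1 x y <->
  exists2 j, node_level i x = Some j & next_same j x y.
Proof.
split => [[e /=]|[j E [e E' xy]]].
  by case E: (node_level i x) => [j|] //= E' xy; exists j => //; exists e.
by exists e => //=; rewrite E.
Qed.

Lemma same_node0 x y : same_node 0 x y.
Proof. by exists 0%N => //; apply: chained_step; rewrite /sc expr0 divr1. Qed.

Lemma same_node_sym i x y : same_node i x y -> same_node i y x.
Proof. by move=> [j E xy]; exists j; [exact: node_level_chained xy|exact: chained_sym]. Qed.

Lemma same_node_trans i x y z : same_node i x y -> same_node i y z -> same_node i x z.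
Proof.
move=> [j E xy] [j']; rewrite (node_level_chained E xy) => -[<-] yz.
by exists j => //; exact: chained_trans yz.
Qed.

Lemma same_node_pred i x y : same_node i.+1 x y -> same_node i x y.
Proof. by move=> /same_nodeS[j E /next_same_chained xy]; exists j. Qed.

(** A point that never leaves the bad stretch counts as its own child, of size 0 and represented by
    itself. *)
Definition exit_size j x : R := if next_level j x is Some e then sc S e else 0.
Definition exit_rep j x := if next_level j x is Some e then canon e x else x.

Lemma exit_size_ge0 j x : 0 <= exit_size j x.
Proof. by rewrite /exit_size; case: next_level => // e; rewrite ltW // sc_gt0. Qed.

Lemma exit_size_le j x y : ~ next_same j x y -> exit_size j x <= mdist x y.
Proof.
rewrite /exit_size /next_same; case: next_level => [e|] n; last exact: mdist_ge0.
by apply: not_chained => xy; apply: n; exists e.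
Qed.

(** The representative stays bad until just before the exit, at a scale [2 * exit_size], so the
    chart bounds hold for it with an error of this order. The margin [eps] serves points that never
    exit, whose error can be made arbitrarily small. *)
Lemma exit_repP j x : ~ gd j x -> [/\ ch j x (exit_rep j x),
  mdist x (exit_rep j x) <= A * exit_size j x &
  forall eps, 0 < eps -> exists l, [/\ (j <= l)%N,
    forall m, (j <= m <= l)%N -> ~ gd m (exit_rep j x) &
    sc S l <= 2 * exit_size j x + eps]].
Proof.
move=> b; have := next_bad b; rewrite /exit_rep /exit_size.
case: next_level => [e|] => [[je ge H]|H]; last first.
  split; [exact: chained_refl|by rewrite mdistxx mulr0|].
  move=> eps e0; have [k ke] := sc_small S0 e0; exists (j + k)%N; split.
  - exact: leq_addr.
  - by move=> m /andP[jm _]; exact: H.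
  - rewrite mulr0 add0r; apply: le_trans (ltW ke); apply: sc_le => //; exact: leq_addl.
have xc : ch e x (canon e x) by exact: canon_chained.
split.
- by apply: chained_anti xc => //; exact: ltnW.
- by apply: ge => //; exact: chained_refl.
- move=> eps e0; case: e je ge H xc => // l; rewrite ltnS => jl ge H xc.
  exists l; split => //; last by rewrite scS; have := sc_gt0 l.+1 S0; lra.
  move=> m /andP[jm ml] gm; apply: (H m); first by rewrite jm ltnS.
  by apply: good_chained_le (chained_sym xc) gm => //; exact: leqW.
Qed.

End Nodes.

(** * The distance of a node *)

Section DyadicSum.
Context (R : realType) (T : eqType).

(** The terms are grouped by the dyadic size of [g], and the groups are dominated by a geometric
    series. *)
Lemma dyadic_sum (s : seq T) (g : T -> R) (rho p k N : R) : 0 < rho -> 0 < p ->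
  0 < k < 1 -> 0 <= N -> {in s, forall y, 0 <= g y <= rho} ->
  (forall n, (size [seq y <- s | rho / 2 ^+ n.+1 < g y <= rho / 2 ^+ n])%:R *
     (rho / 2 ^+ n) `^ p <= N * k ^+ n) ->
  \sum_(y <- s) g y `^ p <= N / (1 - k).
Proof.
move=> rho0 p0 /andP[k0 k1] N0 grho H.
pose P n y := rho / 2 ^+ n.+1 < g y <= rho / 2 ^+ n.
have exP y : y \in s -> g y != 0 -> exists n, P n y.
  move=> /grho/andP[g0 gr] gn0.
  have gp : 0 < g y by rewrite lt_neqAle eq_sym gn0.
  have [|m hm] := @exists_geom_lt R 2 rho (g y) _ rho0 gp; first by [].
  have ex : exists n, rho / 2 ^+ n.+1 < g y.
    exists m; apply: le_lt_trans hm; rewrite ler_pM2l // lef_pV2 ?posrE ?exprn_gt0 //.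
    by apply: ler_weXn2l; rewrite ?ler1n.
  case: (ex_minnP ex) => n hn nmin; exists n; rewrite /P hn /=.
  case: n hn nmin => [|n] hn nmin; first by rewrite expr0 divr1.
  by rewrite leNgt; apply/negP => /nmin; rewrite ltnn.
have [M HM] : exists M : nat, {in s, forall y, g y != 0 -> exists2 n : 'I_M, true & P n y}.
  elim: (s) exP => [|a t IH] exP; first by exists 0%N.
  have [|M HM] := IH; first by move=> y yt; apply: exP; rewrite inE yt orbT.
  have [ga|ga] := eqVneq (g a) 0.
    exists M => y; rewrite inE => /orP[/eqP ->|]; first by rewrite ga eqxx.
    exact: HM.
  have [n Pn] := exP a (mem_head _ _) ga.
  exists (M + n.+1)%N => y; rewrite inE => /orP[/eqP -> _|/HM h /h[i _ Pi]].
    have nM : (n < M + n.+1)%N by rewrite addnS ltnS leq_addl.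
    by exists (Ordinal nM).
  by exists (lshift n.+1 i).
have t0 n y : 0 <= (if P n y then (rho / 2 ^+ n) `^ p else 0).
  by case: ifP => // _; exact: powR_ge0.
apply: (@le_trans _ _ (\sum_(y <- s) \sum_(n < M) if P n y then (rho / 2 ^+ n) `^ p else 0)).
  rewrite big_seq [leRHS]big_seq; apply: ler_sum => y ys.
  have [->|gy] := eqVneq (g y) 0.
    by rewrite powR0 ?gt_eqF // sumr_ge0.
  have [n _ Pn] := HM y ys gy; rewrite (bigD1 n) //= Pn.
  apply: ler_wpDr; first exact: sumr_ge0.
  have /andP[g0 _] := grho y ys; move: Pn => /andP[_ gn].
  by apply: ge0_ler_powR; rewrite ?nnegrE ?(ltW p0) // (le_trans g0).
rewrite exchange_big /=.
apply: (@le_trans _ _ (\sum_(n < M) N * k ^+ n)).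
  apply: ler_sum => n _; apply: le_trans (H n).
  rewrite -big_mkcond -big_filter big_const_seq count_predT iter_addr_0.
  by rewrite mulr_natl.
rewrite -mulr_sumr; apply: ler_wpM2l => //.
have E m : (\sum_(n < m) k ^+ n) * (1 - k) = 1 - k ^+ m.
  by elim: m => [|m IH]; rewrite ?big_ord0 ?big_ord_recr /= ?mulrDl ?IH ?expr0 ?exprS; ring.
by rewrite -div1r ler_pdivlMr ?subr_gt0 // E lerBlDr lerDl exprn_ge0 // ltW.
Qed.

End DyadicSum.

Section Exponent.
Context (R : realType).

Lemma pow2_exponent (b : R) : 1 < b -> exists2 a, 0 < a & forall n, b ^+ n = (2 ^+ n) `^ a.
Proof.
move=> b1; have b0 : 0 < b := lt_trans ltr01 b1.
have l2 : 0 < ln (2 : R) by rewrite ln_gt0 // ltr1n.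
have lb : 0 < ln b by exact: ln_gt0.
exists (ln b / ln 2); first exact: divr_gt0.
have bE : b = 2 `^ (ln b / ln 2).
  by rewrite /powR gt_eqF // divfK ?gt_eqF // lnK // posrE.
move=> n; rewrite {1}bE -!powR_mulrn ?powR_ge0 // -!powRrM; congr powR.
exact: mulrC.
Qed.

End Exponent.

Section NodeGeometry.
Context (R : realType) (X : metricType R).
Variables (S A Lam T B kap q : R) (x00 : X).
Variables (psi0 : nat -> X -> X -> X) (th0 : nat -> X -> X -> X -> R)
  (Z0 : nat -> X -> set X).
Hypotheses (S0 : 0 < S) (A1 : 1 <= A) (Lam1 : 1 <= Lam) (T0 : 0 < T) (B1 : 1 <= B)
  (kap01 : 0 < kap < 1) (bS : forall x y : X, mdist x y < S).
Local Notation ch j := (chained (sc S j)).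
Local Notation gd := (@good R X S A).
Local Notation cn := (@canon R X S x00).
Local Notation nx := (@next_level R X S A).
Local Notation ns := (@next_same R X S A).
Local Notation es := (@exit_size R X S A).
Local Notation er := (@exit_rep R X S A x00).
Local Notation bstart := (@bad_start R X S A).
Hypothesis charts : forall j x0, bstart j x0 ->
  [/\ forall x, ch j x0 x -> Z0 j x0 (psi0 j x0 x),
     model (Z0 j x0) (th0 j x0) T q B kap &
     forall x x' l l', ch j x0 x -> ch j x0 x' ->
       (j <= l)%N -> (forall m, (j <= m <= l)%N -> ~ gd m x) ->
       (j <= l')%N -> (forall m, (j <= m <= l')%N -> ~ gd m x') ->
       sc S j * mdist (psi0 j x0 x) (psi0 j x0 x') <=
         Lam * (mdist x x' + sc S l + sc S l') /\
       mdist x x' <=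
         Lam * (sc S j * mdist (psi0 j x0 x) (psi0 j x0 x') + sc S l + sc S l')].

(* point j x stands for the child of x in the chart of the node, and gauge j x is
   the size in the model of the ball having there the radius of that child. *)
Definition point j x := psi0 j (cn j x) (er j x).
Definition point_modulus j x t :=
  modulus (Z0 j (cn j x)) (th0 j (cn j x)) T (point j x) t.
Definition gauge j x : R :=
  if `[< gd j x >] then 3^-1
  else if nx j x is Some e then point_modulus j x (2 ^+ (e - j))^-1 else 0.
(** Adding both gauges separates different children even if their points in the chart coincide; in a
    good node all children are equally far apart. Each of the three terms is at most [3^-1]. On the
    diagonal the value is twice the gauge, not 0. *)
Definition node_dist j x y : R :=
  (if `[< gd j x >] then 0 else th0 j (cn j x) (point j x) (point j y)) +
  gauge j x + gauge j y.

Lemma bad_start_chained j x y : ch j x y -> bstart j x -> bstart j y.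
Proof.
move=> xy [b g]; split; first by move/(good_chained (chained_sym xy)).
by apply: good_chained_le xy g => //; exact: leq_pred.
Qed.

Lemma bad_start_canon j x : bstart j x -> bstart j (cn j x).
Proof. by apply: bad_start_chained; exact: canon_chained. Qed.

Lemma node_model j x : bstart j x -> model (Z0 j (cn j x)) (th0 j (cn j x)) T q B kap.
Proof. by move=> /bad_start_canon/charts[]. Qed.

Lemma canon_exit_rep j x y : bstart j x -> ch j x y -> ch j (cn j x) (er j y).
Proof.
move=> bx xy; have [by_ _] := bad_start_chained xy bx.
have [yr _ _] := exit_repP x00 S0 by_.
have xc : ch j x (cn j x) by exact: canon_chained.
by apply: chained_trans (chained_sym xc) _; exact: chained_trans yr.
Qed.

Lemma point_in j x y : bstart j x -> ch j x y -> Z0 j (cn j x) (point j y).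
Proof.
move=> bx xy; have [H _ _] := charts (bad_start_canon bx).
rewrite /point -(canon_eq x00 xy); apply: H; exact: canon_exit_rep.
Qed.

Lemma point_modulusE j x y t : ch j x y ->
  point_modulus j y t = modulus (Z0 j (cn j x)) (th0 j (cn j x)) T (point j y) t.
Proof. by move=> xy; rewrite /point_modulus -(canon_eq x00 xy). Qed.

Lemma point_bounds j x y : bstart j x -> ch j x y ->
  sc S j * mdist (point j x) (point j y) <=
    Lam * (A + 2) * (mdist x y + es j x + es j y) /\
  mdist x y <=
    Lam * (A + 2) * (sc S j * mdist (point j x) (point j y) + es j x + es j y).
Proof.
move=> bx xy; have by_ := bad_start_chained xy bx.
have [_ _ H] := charts (bad_start_canon bx).
have [xr dx Hx] := exit_repP x00 S0 bx.1; have [yr dy Hy] := exit_repP x00 S0 by_.1.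
have cx : ch j (cn j x) (er j x).
  by apply: canon_exit_rep => //; exact: chained_refl.
have cy := canon_exit_rep bx xy.
have py : point j y = psi0 j (cn j x) (er j y) by rewrite /point -(canon_eq x00 xy).
rewrite py; set D := mdist _ _; pose a := es j x; pose b := es j y.
have a0 : 0 <= a by exact: exit_size_ge0.
have b0 : 0 <= b by exact: exit_size_ge0.
have Lam0 : 0 < Lam := lt_le_trans ltr01 Lam1.
have D0 : 0 <= sc S j * D by rewrite mulr_ge0 ?mdist_ge0 // ltW // sc_gt0.
rewrite -/a in dx Hx *; rewrite -/b in dy Hy *.
have main eps : 0 < eps -> sc S j * D <= Lam * (mdist (er j x) (er j y) + 2 * a + 2 * b + eps) /\
    mdist (er j x) (er j y) <= Lam * (sc S j * D + 2 * a + 2 * b + eps).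
  move=> e0; have e20 : 0 < eps / 2 by rewrite divr_gt0.
  have [l [jl bl sl]] := Hx _ e20; have [l' [jl' bl' sl']] := Hy _ e20.
  have [h1 h2] := H _ _ l l' cx cy jl bl jl' bl'; split.
    by apply: le_trans h1 _; apply: ler_wpM2l; [exact: ltW|lra].
  by apply: le_trans h2 _; apply: ler_wpM2l; [exact: ltW|rewrite -/D; lra].
have t1 : mdist (er j x) (er j y) <= mdist x y + A * a + A * b.
  have := metric_triangle (er j x) x (er j y); have := metric_triangle x y (er j y).
  by rewrite (metric_sym (er j x) x); lra.
have t2 : mdist x y <= mdist (er j x) (er j y) + A * a + A * b.
  have := metric_triangle x (er j x) y; have := metric_triangle (er j x) (er j y) y.
  by rewrite (metric_sym (er j y) y); lra.
have A0 : 0 <= A := le_trans ler01 A1.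
have Aa : 0 <= A * a by exact: mulr_ge0.
have Ab : 0 <= A * b by exact: mulr_ge0.
have dxy := mdist_ge0 x y.
split; apply/ler_addgt0Pr => e e0; have el : 0 < e / Lam by rewrite divr_gt0.
  have [h _] := main _ el; apply: le_trans h _.
  have -> : Lam * (A + 2) * (mdist x y + a + b) + e =
    Lam * ((A + 2) * (mdist x y + a + b) + e / Lam) by field; rewrite gt_eqF.
  apply: ler_wpM2l; first exact: ltW.
  have : 0 <= A * mdist x y by exact: mulr_ge0.
  lra.
have [_ h] := main _ el.
have h' : Lam * (sc S j * D + 2 * a + 2 * b + e / Lam) =
   Lam * (sc S j * D + 2 * a + 2 * b) + e by field; rewrite gt_eqF.
rewrite h' in h.
have : A * a + A * b <= Lam * (A * a + A * b) by rewrite ler_peMl // addr_ge0.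
have : 0 <= Lam * (A * (sc S j * D) + sc S j * D).
  by rewrite mulr_ge0 ?(ltW Lam0) // addr_ge0 // mulr_ge0.
have -> : Lam * (A + 2) * (sc S j * D + a + b) = Lam * (sc S j * D + 2 * a + 2 * b) +
  Lam * (A * a + A * b) + Lam * (A * (sc S j * D) + sc S j * D) by ring.
by lra.
Qed.

Lemma gauge_good j x : gd j x -> gauge j x = 3^-1.
Proof. by move=> g; rewrite /gauge asboolT. Qed.

Lemma gauge_bad j x : bstart j x -> 
  (exists e, [/\ nx j x = Some e, (j < e)%N, gauge j x = point_modulus j x (2 ^+ (e - j))^-1,
     0 < gauge j x & es j x = sc S j * (2 ^+ (e - j))^-1]) \/
  [/\ nx j x = None, gauge j x = 0 & es j x = 0].
Proof.
move=> bx; rewrite /gauge asboolF; last exact: bx.1.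
rewrite /exit_size; case E: (nx j x) => [e|]; [left|by right].
have je := next_gt E; exists e; split => //.
  apply: (modulus_gt0 T0 B1 (node_model bx)); last by rewrite invr_gt0 exprn_gt0.
  exact: point_in.
by rewrite /sc -{1}(subnKC (ltnW je)) exprD invfM mulrA.
Qed.

Lemma gauge_ge0 j x : gd j x \/ bstart j x -> 0 <= gauge j x.
Proof.
move=> [g|b]; first by rewrite gauge_good // invr_ge0.
by have [[e [_ _ _ /ltW]]|[_ -> _]] := gauge_bad b.
Qed.

Lemma gauge_le j x : gd j x \/ bstart j x -> 3 * gauge j x <= 1.
Proof.
move=> [g|b]; first by rewrite gauge_good // mulfV.
have [[e [_ _ -> _ _]]|[_ -> _]] := gauge_bad b; last by rewrite mulr0.
apply: (modulus_le3 T0 (node_model b)); first exact: point_in.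
by rewrite invr_ge0 exprn_ge0.
Qed.

Lemma bad_cluster : doubling X -> exists N : nat, forall j x s u, bstart j x ->
  0 < u -> gauge j x <= u -> u <= 2 * gauge j x ->
  uniq s -> {in s, forall y, ch j x y} -> {in s &, forall y z, y != z -> ~ ns j y z} ->
  {in s, forall y, gauge j y <= u /\ u <= 2 * gauge j y} ->
  {in s, forall y, th0 j (cn j x) (point j x) (point j y) <= 2 * u} ->
  (size s <= N)%N.
Proof.
move=> dX; have [C C1 HC] := @modulus_comparable R X B T kap S T0 B1 kap01 S0.
have C0 : 0 < C := lt_le_trans ltr01 C1.
pose L := Lam * (A + 2).
have L0 : 0 < L.
  apply: mulr_gt0; first exact: lt_le_trans Lam1.
  by have := A1; lra.
have [N HN] := doubling_count (L * (2 * C + 2) * C) dX.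
exists N => j x s u bx u0 gx1 gx2 us sx sn sg st.
have pos y : bstart j y -> u <= 2 * gauge j y -> exists e, [/\ nx j y = Some e,
    gauge j y = point_modulus j y (2 ^+ (e - j))^-1 & es j y = sc S j * (2 ^+ (e - j))^-1].
  move=> b h; have [[e [? _ ? _ ?]]|[_ g _]] := gauge_bad b; first by exists e.
  by exfalso; move: h; rewrite g mulr0 leNgt u0.
have [e [_ ge see]] := pos x bx gx2.
pose t n : R := (2 ^+ n)^-1.
have tp n : 0 < t n by rewrite invr_gt0 exprn_gt0.
rewrite -/(t _) in ge see.
have sj0 := sc_gt0 j S0.
have key y : y \in s -> [/\ mdist (point j x) (point j y) <= C * t (e - j)%N,
    es j y <= C * (sc S j * t (e - j)%N) & sc S j * t (e - j)%N <= C * es j y].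
  move=> ys; have xy := sx y ys; have b := bad_start_chained xy bx.
  have [gy1 gy2] := sg y ys; have [f [_ gf sf]] := pos y b gy2.
  rewrite -/(t _) in gf sf.
  have m := node_model bx.
  have xx : ch j x x by exact: chained_refl.
  have Zx := point_in bx xx; have Zy := point_in bx xy.
  have h := st y ys.
  rewrite (point_modulusE _ xx) in ge.
  rewrite (point_modulusE _ xy) in gf.
  have [h1 h2] : mdist (point j x) (point j y) <= C * t (e - j)%N /\ t (f - j)%N <= C * t (e - j)%N.
    by apply: (HC _ _ _ _ _ _ _ _ m bS Zx Zy h _ _ _ _ u0); rewrite -/(t _) -?ge -?gf.
  have h' : th0 j (cn j x) (point j y) (point j x) <= 2 * u by rewrite (model_sym m).
  have [_ h3] : mdist (point j y) (point j x) <= C * t (f - j)%N /\ t (e - j)%N <= C * t (f - j)%N.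
    by apply: (HC _ _ _ _ _ _ _ _ m bS Zy Zx h' _ _ _ _ u0); rewrite -/(t _) -?ge -?gf.
  by split => //; rewrite sf mulrCA ler_pM2l.
have r0 : 0 < sc S j * t (e - j)%N by rewrite mulr_gt0.
apply: (HN x (sc S j * t (e - j)%N / C)) => //.
- by rewrite divr_gt0.
- move=> y ys; have [h1 h2 h3] := key y ys.
  have [_ h] := point_bounds bx (sx y ys); apply: le_lt_trans h _.
  rewrite -/L.
  have -> : L * (2 * C + 2) * C * (sc S j * t (e - j)%N / C) =
    L * ((2 * C + 2) * (sc S j * t (e - j)%N)) by field; rewrite gt_eqF.
  rewrite ltr_pM2l //.
  have h1' : sc S j * mdist (point j x) (point j y) <= C * (sc S j * t (e - j)%N).
    by rewrite mulrCA ler_pM2l.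
  by rewrite see; lra.
- move=> y z ys zs yz; have [_ _ h3] := key y ys.
  rewrite ler_pdivrMr // (mulrC _ C); apply: le_trans h3 _; rewrite ler_pM2l //.
  by apply: exit_size_le; exact: sn.
Qed.

(** The children with gauge about [u = rho / 2^n] are grouped by [u]-balls of the model. Packing
    with exponent [q] allows a multiple of [2^(n * q)] groups, and [bad_cluster] at most [N]
    children in each. Weighted by [u^p], the counts form a geometric series of ratio [2^(q - p)]. *)
Lemma bad_gauge_sum p : doubling X -> 0 < q -> q < p -> exists2 C : R, 0 <= C &
  forall j x rho s, bstart j x -> 0 < rho -> uniq s -> {in s, forall y, ch j x y} ->
  {in s &, forall y z, y != z -> ~ ns j y z} ->
  {in s, forall y, gauge j y <= rho} ->
  {in s &, forall y z, y != z -> node_dist j y z <= rho} ->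
  \sum_(y <- s) gauge j y `^ p <= C * rho `^ p.
Proof.
move=> dX q0 qp; have [N HN] := bad_cluster dX.
pose k : R := 2 `^ (q - p).
have k0 : 0 < k by rewrite powR_gt0.
have k1 : k < 1.
  have h : (1 : R) `^ (p - q) < 2 `^ (p - q).
    by rewrite gt0_ltr_powR ?subr_gt0 ?nnegrE // ltr1n.
  rewrite powR1 in h.
  by rewrite /k -opprB powRN invf_lt1 // (lt_trans ltr01).
have p0 : 0 < p := lt_trans q0 qp.
pose C := N%:R * B * 2 `^ q.
have C0 : 0 <= C by rewrite !mulr_ge0 ?powR_ge0 // (le_trans ler01).
exists (C / (1 - k)).
  by rewrite divr_ge0 // subr_ge0 ltW.
move=> j x rho s bx rho0 us sx sn sg st.
rewrite mulrAC; apply: (@dyadic_sum R X s (gauge j) rho p k) => //.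
- by rewrite k0 k1.
- by rewrite mulr_ge0 // powR_ge0.
- move=> y ys; apply/andP; split; last exact: sg.
  apply: gauge_ge0; right; exact: bad_start_chained (sx y ys) bx.
move=> n; set F := [seq y <- s | _].
pose u := rho / 2 ^+ n; have u0 : 0 < u by rewrite divr_gt0 // exprn_gt0.
have Fs y : y \in F -> [/\ y \in s, gauge j y <= u & u <= 2 * gauge j y].
  rewrite mem_filter => /andP[/andP[h1 h2] ys]; split => //.
  have E : rho / 2 ^+ n.+1 = u / 2 by rewrite /u exprS invfM; ring.
  by rewrite E in h1; lra.
have uF : uniq F by rewrite filter_uniq.
have m := node_model bx.
pose e y z := th0 j (cn j x) (point j y) (point j z) < u.
have esym : symmetric e by move=> y z; rewrite /e (model_sym m).
have [|G [uG GF Gn Gc]] := greedy_representatives esym _ uF.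
  by move=> y _; rewrite /e (model_xx m).
have sizeF : (size F <= size G * N)%N.
  apply: leq_trans (size_le_cover Gc) _.
  apply: (@leq_trans (\sum_(y <- G) N)%N); last by rewrite big_const_seq count_predT iter_addn_0 mulnC.
  rewrite big_seq [leqRHS]big_seq; apply: leq_sum => y yG.
  have [ys gy1 gy2] := Fs y (GF y yG).
  have b := bad_start_chained (sx y ys) bx.
  apply: (HN j y _ u) => //.
  - by rewrite filter_uniq.
  - move=> z; rewrite mem_filter => /andP[_ /Fs[zs _ _]].
    by apply: chained_trans (sx z zs); apply: chained_sym; exact: sx.
  - move=> z w; rewrite mem_filter => /andP[_ /Fs[zs _ _]].
    by rewrite mem_filter => /andP[_ /Fs[ws _ _]]; exact: sn.
  - by move=> z; rewrite mem_filter => /andP[_ /Fs[_ ? ?]].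
  - move=> z; rewrite mem_filter => /andP[yz _].
    rewrite -(canon_eq x00 (sx y ys)); move: yz; rewrite /e => yz.
    by lra.
have bnd : (size F)%:R <= N%:R * B * (2 ^+ n.+1) `^ q.
  apply: (@le_trans _ _ ((size G)%:R * N%:R)); first by rewrite -natrM ler_nat.
  rewrite mulrC -mulrA; apply: ler_wpM2l => //.
  case EG: G => [|a G']; first by rewrite /= mulr_ge0 ?powR_ge0 // (le_trans ler01).
  rewrite -EG; have aG : a \in G by rewrite EG mem_head.
  have inj : {in G &, injective (point j)}.
    move=> y z yG zG yz; apply/eqP/negPn/negP => ne.
    by have := Gn y z yG zG ne; rewrite /e yz (model_xx m) u0.
  have -> : 2 ^+ n.+1 = 2 * rho / u :> R.
    by rewrite /u exprS; field; rewrite gt_eqF // gt_eqF // exprn_gt0.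
  rewrite -(size_map (point j)); apply: (model_packing m (x := point j a)) => //.
  - apply: (@le_trans _ _ rho); last by lra.
    by rewrite ler_pdivrMr ?exprn_gt0 // ler_peMr ?(ltW rho0) // exprn_ege1 // ler1n.
  - by rewrite map_inj_in_uniq.
  - move=> _ /mapP[y yG ->]; have [<-|ay] := eqVneq a y.
      by rewrite (model_xx m) mulr_gt0.
    have [as_ _ _] := Fs a (GF a aG); have [ys _ _] := Fs y (GF y yG).
    have := st a y as_ ys ay; rewrite /node_dist asboolF; last first.
      exact: (bad_start_chained (sx a as_) bx).1.
    rewrite -(canon_eq x00 (sx a as_)).
    have := gauge_ge0 (or_intror (bad_start_chained (sx a as_) bx)).
    have := gauge_ge0 (or_intror (bad_start_chained (sx y ys) bx)).
    by lra.
  - move=> _ _ /mapP[y yG ->] /mapP[z zG ->] yz; rewrite leNgt.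
    by apply: Gn => //; apply: contraNneq yz => ->.
apply: le_trans (ler_wpM2r (powR_ge0 _ _) bnd) _.
have e2 : 0 < 2 ^+ n :> R by rewrite exprn_gt0.
rewrite /C exprS powRM ?(ltW e2) // -/u.
have -> : (2 ^+ n) `^ q = k ^+ n * (2 ^+ n) `^ p :> R.
  rewrite /k -powR_mulrn ?powR_ge0 // -powR_mulrn // -!powRrM -powRD ?pnatr_eq0 ?implybT //.
  by congr powR; ring.
have -> : rho `^ p = u `^ p * (2 ^+ n) `^ p.
  by rewrite -powRM ?(ltW u0) ?(ltW e2) // /u divfK // gt_eqF.
by rewrite le_eqVlt; apply/orP; left; apply/eqP; ring.
Qed.

Lemma good_count : doubling X -> exists N : nat, forall j x s, gd j x -> uniq s ->
  {in s, forall y, ch j x y} -> {in s &, forall y z, y != z -> ~ ns j y z} ->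
  (size s <= N)%N.
Proof.
move=> dX; have [N HN] := doubling_count (2 * A + 1) dX.
exists N => j x s gx us sx sn; apply: (HN x (sc S j.+1)) => //; first exact: sc_gt0.
  move=> y ys; have xx : ch j x x by exact: chained_refl.
  apply: le_lt_trans (gx x y xx (sx y ys)) _.
  by rewrite (scS S j); have := sc_gt0 j.+1 S0; lra.
move=> y z ys zs yz; have := exit_size_le (sn y z ys zs yz).
by rewrite /exit_size next_good //; exact: good_chained (sx y ys) gx.
Qed.

Lemma gauge_sum p : doubling X -> 0 < q -> q < p -> exists2 C : R, 0 <= C &
  forall j x rho s, gd j x \/ bstart j x -> 0 < rho -> uniq s ->
  {in s, forall y, ch j x y} -> {in s &, forall y z, y != z -> ~ ns j y z} ->
  {in s, forall y, gauge j y <= rho} ->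
  {in s &, forall y z, y != z -> node_dist j y z <= rho} ->
  \sum_(y <- s) gauge j y `^ p <= C * rho `^ p.
Proof.
move=> dX q0 qp; have p0 : 0 < p := lt_trans q0 qp.
have [C C0 HC] := bad_gauge_sum dX q0 qp; have [N HN] := good_count dX.
exists (C + N%:R); first exact: addr_ge0.
move=> j x rho s [gx|bx] rho0 us sx sn sg st; last first.
  apply: le_trans (HC j x rho s bx rho0 us sx sn sg st) _.
  by apply: ler_wpM2r; [exact: powR_ge0|rewrite lerDl].
have gy y : y \in s -> gauge j y = 3^-1.
  by move=> ys; apply: gauge_good; exact: good_chained (sx y ys) gx.
apply: (@le_trans _ _ (\sum_(y <- s) rho `^ p)).
  rewrite big_seq [leRHS]big_seq; apply: ler_sum => y ys.
  by apply: ge0_ler_powR; rewrite ?nnegrE ?(ltW p0) ?(ltW rho0) ?sg // gy // invr_ge0.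
rewrite big_const_seq count_predT iter_addr_0 -[leLHS]mulr_natl.
apply: ler_wpM2r; first exact: powR_ge0.
have h : (size s)%:R <= N%:R :> R by rewrite ler_nat; exact: HN us sx sn.
by apply: le_trans h _; rewrite lerDr.
Qed.

(** Children with gauge below [r / 4] have points in the chart at least [r / 2] apart, and the
    packing bound of the model counts them. Each of the others contributes at least [(r / 4)^p] to
    the sum of gauges. *)
Lemma node_packing p : doubling X -> 0 < q -> q < p -> exists2 C : R, 1 <= C &
  forall j x rho r s, gd j x \/ bstart j x -> 0 < r -> r <= rho -> uniq s ->
  {in s, forall y, ch j x y} -> {in s &, forall y z, y != z -> ~ ns j y z} ->
  {in s &, forall y z, y != z -> r <= node_dist j y z <= rho} ->
  (size s)%:R <= C * (rho / r) `^ p.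
Proof.
move=> dX q0 qp; have p0 : 0 < p := lt_trans q0 qp.
have [C C0 HC] := bad_gauge_sum dX q0 qp; have [N HN] := good_count dX.
have Bq : 0 <= B * 4 `^ q by rewrite mulr_ge0 ?powR_ge0 // (le_trans ler01).
have Cp : 0 <= C * 4 `^ p by rewrite mulr_ge0 // powR_ge0.
exists (B * 4 `^ q + C * 4 `^ p + 1 + N%:R); first by have := ler0n R N; lra.
move=> j x rho r s st r0 rr us sx sn sd.
have rho0 : 0 < rho := lt_le_trans r0 rr.
have rr1 : 1 <= rho / r by rewrite ler_pdivlMr // mul1r.
have W1 : 1 <= (rho / r) `^ p by apply: powR_ge1 => //; exact: ltW.
have W0 : 0 <= (rho / r) `^ p by exact: powR_ge0.
case: st => [gx|bx].
  have h : (size s)%:R <= N%:R :> R by rewrite ler_nat; exact: HN gx us sx sn.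
  apply: le_trans h _; apply: (@le_trans _ _ (N%:R * (rho / r) `^ p)).
    by rewrite ler_peMr.
  by apply: ler_wpM2r => //; have := Bq; lra.
have b y : y \in s -> bstart j y by move=> ys; exact: bad_start_chained (sx y ys) bx.
have g0 y : y \in s -> 0 <= gauge j y by move=> ys; apply: gauge_ge0; right; exact: b.
have m := node_model bx.
have dE y z : y \in s -> node_dist j y z =
    th0 j (cn j x) (point j y) (point j z) + gauge j y + gauge j z.
  by move=> ys; rewrite /node_dist asboolF ?(canon_eq x00 (sx y ys)) //; exact: (b y ys).1.
pose P y := gauge j y < r / 4.
have -> : size s = (size [seq y <- s | P y] + size [seq y <- s | ~~ P y])%N.
  by rewrite !size_filter count_predC.
rewrite natrD.
have h1 : (size [seq y <- s | P y])%:R <= B * 4 `^ q * (rho / r) `^ p.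
  set s1 := [seq y <- s | P y].
  have s1P y : y \in s1 -> y \in s /\ gauge j y < r / 4.
    by rewrite mem_filter => /andP[].
  case E1: s1 => [|a s'] ; first by rewrite /= mulr_ge0.
  rewrite -E1; have as1 : a \in s1 by rewrite E1 mem_head.
  have sep y z : y \in s1 -> z \in s1 -> y != z ->
      r / 2 <= th0 j (cn j x) (point j y) (point j z) <= rho.
    move=> /s1P[ys gy] /s1P[zs gz] yz; have /andP[] := sd y z ys zs yz.
    by rewrite dE //; have := g0 y ys; have := g0 z zs => *; apply/andP; split; lra.
  have inj : {in s1 &, injective (point j)}.
    move=> y z ys zs yz; apply/eqP/negPn/negP => ne.
    have /andP[h _] := sep y z ys zs ne.
    by move: h; rewrite yz (model_xx m) leNgt divr_gt0.
  apply: (@le_trans _ _ (B * (2 * rho / (r / 2)) `^ q)).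
    rewrite -(size_map (point j)); apply: (model_packing m (x := point j a)).
    - by rewrite divr_gt0.
    - by lra.
    - by rewrite map_inj_in_uniq // filter_uniq.
    - move=> _ /mapP[y ys ->]; have [<-|ay] := eqVneq a y.
        by rewrite (model_xx m) mulr_gt0.
      by have /andP[_ h] := sep a y as1 ys ay; lra.
    - move=> _ _ /mapP[y ys ->] /mapP[z zs ->] yz.
      have ne : y != z by apply: contraNneq yz => ->.
      by have /andP[] := sep y z ys zs ne.
  have -> : 2 * rho / (r / 2) = 4 * (rho / r) by field; rewrite gt_eqF.
  rewrite powRM ?(le_trans ler01 rr1) // -mulrA; apply: ler_wpM2l.
    exact: le_trans ler01 B1.
  apply: ler_wpM2l; first exact: powR_ge0.
  by apply: ler_powR => //; exact: ltW.
have h2 : (size [seq y <- s | ~~ P y])%:R <= (C * 4 `^ p + 1) * (rho / r) `^ p.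
  set s2 := [seq y <- s | ~~ P y].
  have s2P y : y \in s2 -> y \in s /\ r / 4 <= gauge j y.
    by rewrite mem_filter -leNgt => /andP[].
  have us2 : uniq s2 by rewrite filter_uniq.
  have [le1|gt1] := leqP (size s2) 1.
    apply: (@le_trans _ _ 1); first by rewrite lern1.
    by rewrite mulrDl mul1r ler_wpDl // mulr_ge0.
  have sg : {in s2, forall y, gauge j y <= rho}.
    move=> y /s2P[ys _].
    have [z zs yz] : exists2 z, z \in s & y != z.
      apply: contrapT => no; move: gt1; rewrite ltnNge => /negP; apply.
      apply: (@uniq_leq_size _ s2 [:: y] us2) => z /s2P[zs _].
      by rewrite inE; apply/eqP; apply: contrapT => /eqP zy; apply: no; exists z; rewrite 1?eq_sym.
    have /andP[_] := sd y z ys zs yz; rewrite dE //.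
    have := model_ge0 m (point j y) (point j z); have := g0 z zs; lra.
  have := HC j x rho s2 bx rho0 us2.
  have r4 : 0 < r / 4 by rewrite divr_gt0.
  have low : (size s2)%:R * (r / 4) `^ p <= \sum_(y <- s2) gauge j y `^ p.
    rewrite mulr_natl -iter_addr_0 -(count_predT s2) -big_const_seq.
    rewrite big_seq [leRHS]big_seq; apply: ler_sum => y /s2P[ys gy].
    by apply: ge0_ler_powR; rewrite ?nnegrE ?(ltW p0) ?(ltW r4) // g0.
  have h y z : y \in s2 -> z \in s2 -> y != z -> ~ ns j y z.
    by move=> /s2P[ys _] /s2P[zs _]; exact: sn.
  have h' y z : y \in s2 -> z \in s2 -> y != z -> node_dist j y z <= rho.
    by move=> /s2P[ys _] /s2P[zs _] yz; have /andP[] := sd y z ys zs yz.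
  have h'' y : y \in s2 -> ch j x y by move=> /s2P[ys _]; exact: sx.
  move=> /(_ h'' h sg h') up.
  apply: (@le_trans _ _ (C * 4 `^ p * (rho / r) `^ p)); last first.
    by apply: ler_wpM2r => //; rewrite lerDl.
  rewrite -mulrA -powRM ?(le_trans ler01 rr1) //.
  have -> : 4 * (rho / r) = rho / (r / 4) by field; rewrite gt_eqF.
  rewrite powRM ?invr_ge0 ?(ltW rho0) ?(ltW r4) //.
  have -> : (r / 4)^-1 `^ p = ((r / 4) `^ p)^-1.
    by rewrite -[(r / 4)^-1]powR_inv1 ?(ltW r4) // -powRrM mulN1r powRN.
  rewrite mulrA ler_pdivlMr ?powR_gt0 //; exact: le_trans low up.
apply: le_trans (lerD h1 h2) _; rewrite -mulrDl; apply: ler_wpM2r => //.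
by have := ler0n R N; lra.
Qed.

Lemma node_status i x j : @node_level R X S A i x = Some j -> gd j x \/ bstart j x.
Proof.
by move=> E; have [g|b] := pselect (gd j x); [left|right; exact: (node_level_bad S0 A1 bS E)].
Qed.

Lemma gauge_next j x y : gd j x \/ bstart j x -> ns j x y ->
  gauge j x = gauge j y /\ point j x = point j y.
Proof.
move=> st xy; have [e E exy] := xy; have cxy := next_same_chained S0 xy.
have ner : er j x = er j y.
  by rewrite /exit_rep E (next_chained S0 E exy) (canon_eq x00 exy).
have pE : point j x = point j y by rewrite /point ner (canon_eq x00 cxy).
split => //; rewrite /gauge E (next_chained S0 E exy).
have -> : `[< gd j x >] = `[< gd j y >].
  by apply/asboolP/asboolP; apply: good_chained => //; exact: chained_sym.
by rewrite (point_modulusE _ cxy) /point_modulus pE.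
Qed.

Lemma gauge_gt0 j x e : gd j x \/ bstart j x -> nx j x = Some e -> 0 < gauge j x.
Proof.
move=> [g _|b E]; first by rewrite gauge_good // invr_gt0.
by have [[? [_ _ _]]|[]] := gauge_bad b; rewrite ?E.
Qed.

Lemma node_dist_bad j x y z : bstart j x -> ch j x y -> node_dist j y z =
  th0 j (cn j x) (point j y) (point j z) + gauge j y + gauge j z.
Proof.
move=> b xy; rewrite /node_dist asboolF ?(canon_eq x00 xy) //.
exact: (bad_start_chained xy b).1.
Qed.

Lemma node_dist_good j x y z : gd j x -> ch j x y ->
  node_dist j y z = gauge j y + gauge j z.
Proof. by move=> g xy; rewrite /node_dist asboolT ?add0r //; exact: good_chained g. Qed.

Lemma status_chained j x y : ch j x y -> gd j x \/ bstart j x -> gd j y \/ bstart j y.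
Proof. by move=> xy [g|b]; [left; exact: good_chained g|right; exact: bad_start_chained b]. Qed.

Lemma node_dist_sym j x y : gd j x \/ bstart j x -> ch j x y ->
  node_dist j x y = node_dist j y x.
Proof.
move=> [g|b] xy; have xx : ch j x x by exact: chained_refl.
  by rewrite !(node_dist_good _ g) // addrC.
by rewrite !(node_dist_bad _ b) // (model_sym (node_model b)) addrAC.
Qed.

Lemma node_dist_tri j x y z : gd j x \/ bstart j x -> ch j x y -> ch j y z ->
  node_dist j x z <= node_dist j x y + node_dist j y z.
Proof.
move=> st xy yz; have xx : ch j x x by exact: chained_refl.
have := gauge_ge0 (status_chained xy st).
case: st => [g|b]; first by rewrite !(node_dist_good _ g) //; lra.
rewrite !(node_dist_bad _ b) //.
by have := model_tri (node_model b) (point j x) (point j y) (point j z); lra.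
Qed.

Lemma node_dist_le1 j x y : gd j x \/ bstart j x -> ch j x y -> node_dist j x y <= 1.
Proof.
move=> st xy; have xx : ch j x x by exact: chained_refl.
have := gauge_le (status_chained xy st); have := gauge_le st.
case: st => [g|b]; first by rewrite !(node_dist_good _ g) //; lra.
rewrite !(node_dist_bad _ b) //.
by have := model_le (node_model b) (point j x) (point j y); lra.
Qed.

Lemma node_dist_ge j x y : gd j x \/ bstart j x -> ch j x y ->
  gauge j x <= node_dist j x y.
Proof.
move=> st xy; have xx : ch j x x by exact: chained_refl.
have := gauge_ge0 (status_chained xy st).
case: st => [g|b]; first by rewrite !(node_dist_good _ g) //; lra.
rewrite !(node_dist_bad _ b) //.
by have := model_ge0 (node_model b) (point j x) (point j y); lra.
Qed.

Lemma node_dist_next j x y z : gd j x \/ bstart j x -> ch j x y -> ns j y z ->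
  node_dist j x y = node_dist j x z.
Proof.
move=> st xy yz; have xx : ch j x x by exact: chained_refl.
have [gE pE] := gauge_next (status_chained xy st) yz.
case: st => [g|b]; first by rewrite !(node_dist_good _ g) // gE.
by rewrite !(node_dist_bad _ b) // gE pE.
Qed.

Lemma node_dist_end j x : gd j x \/ bstart j x -> nx j x = None -> node_dist j x x = 0.
Proof.
move=> [g|b] E; first by move: E; rewrite next_good.
have [[? []]|[_ g _]] := gauge_bad b; first by rewrite E.
have xx : ch j x x by exact: chained_refl.
by rewrite (node_dist_bad _ b) // g (model_xx (node_model b)) !addr0.
Qed.

(** Points sharing all nodes would lie in one good class at arbitrarily fine levels [m], and such a
    class has diameter at most [A * sc S m]. *)
Lemma nodes_separate x y : x <> y -> exists i, ~ @same_node R X S A i x y.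
Proof.
move=> xy; apply: contrapT => H.
have {}H i : @same_node R X S A i x y by apply: contrapT => n; apply: H; exists i.
have A0 : 0 < A := lt_le_trans ltr01 A1.
have h n : exists2 m, (n <= m)%N & gd m x /\ ch m x y.
  have [j E cxy] := H n; have [j' ] := H n.+1; rewrite /= E /= => E' cxy'.
  have jn : (n <= j)%N := node_level_ge E.
  have [g|b] := pselect (gd j x); first by exists j.
  have := next_bad b; rewrite E' => -[jj' g' _].
  by exists j' => //; exact: leq_trans jn (ltnW jj').
have d0 : 0 < mdist x y by rewrite mdist_gt0; exact/eqP.
have dA : 0 < mdist x y / A by rewrite divr_gt0.
have [k ke] := sc_small S0 dA.
have [m km [g cxy]] := h k.
have xx : ch m x x by exact: chained_refl.
have := g x y xx cxy; rewrite leNgt => /negP; apply.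
rewrite mulrC -ltr_pdivlMr //; apply: le_lt_trans ke; exact: sc_le.
Qed.

(* The size, relative to the node at level j, of a ball centred at x whose radius
   is the scale k. *)
Definition profile j k x : R :=
  if `[< gd j x >] then 1 else point_modulus j x (2 ^+ (k - j))^-1.
Definition in_node j k x := (j <= k)%N /\ forall e, nx j x = Some e -> (k < e)%N.

Let kap0 : 0 < kap. Proof. by case/andP: kap01. Qed.
Let B0 : 0 < B. Proof. exact: lt_le_trans B1. Qed.
Let i2_gt0 n : 0 < (2 ^+ n)^-1 :> R. Proof. by rewrite invr_gt0 exprn_gt0. Qed.

Lemma in_node_good j k x : gd j x -> in_node j k x -> k = j.
Proof.
move=> g [jk /(_ j.+1)]; rewrite next_good // => /(_ erefl); rewrite ltnS => kj.
by apply/eqP; rewrite eqn_leq kj.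
Qed.

Lemma profile_good j k x : gd j x -> profile j k x = 1.
Proof. by move=> g; rewrite /profile asboolT. Qed.

Lemma profile_bad j k x : bstart j x -> profile j k x = point_modulus j x (2 ^+ (k - j))^-1.
Proof. by move=> b; rewrite /profile asboolF //; exact: b.1. Qed.

Lemma point_self j x : bstart j x -> Z0 j (cn j x) (point j x).
Proof. by move=> b; apply: point_in => //; exact: chained_refl. Qed.

Lemma profile_gt0 j k x : gd j x \/ bstart j x -> 0 < profile j k x.
Proof.
move=> [g|b]; first by rewrite profile_good.
by rewrite profile_bad //; exact: modulus_gt0 T0 B1 (node_model b) _ _ (point_self b) (i2_gt0 _).
Qed.

Lemma profile_le1 j k x : gd j x \/ bstart j x -> profile j k x <= 1.
Proof.
move=> [g|b]; first by rewrite profile_good.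
rewrite profile_bad //.
have t0 := ltW (i2_gt0 (k - j)).
have h := modulus_le3 T0 (node_model b) (point_self b) t0.
have h0 := modulus_ge0 T0 (node_model b) (point_self b) t0.
by rewrite /point_modulus; lra.
Qed.

Lemma profile_decay j k k' x : gd j x \/ bstart j x -> (j <= k)%N -> (k <= k')%N ->
  in_node j k' x -> profile j k' x <= B * kap ^+ (k' - k) * profile j k x.
Proof.
move=> [g|b] jk kk ik.
  have kj := in_node_good g ik; have -> : k = k' by apply/eqP; rewrite eqn_leq kk kj.
  by rewrite subnn expr0 profile_good // !mulr1.
rewrite !profile_bad // /point_modulus.
have -> : (2 ^+ (k' - j))^-1 = (2 ^+ (k - j))^-1 / 2 ^+ (k' - k) :> R.
  by rewrite -invfM -exprD addnC addnBA // subnK.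
apply: (model_decay (node_model b)) => //; first exact: point_self.
by rewrite invf_le1 ?exprn_gt0 // exprn_ege1 // ler1n.
Qed.

Lemma profile_growth j k k' x : gd j x \/ bstart j x -> (j <= k)%N -> (k <= k')%N ->
  profile j k x <= B ^+ (k' - k) * profile j k' x.
Proof.
move=> [g|b] jk kk; first by rewrite !profile_good // mulr1 exprn_ege1.
rewrite !profile_bad // /point_modulus.
have -> : (2 ^+ (k - j))^-1 = 2 ^+ (k' - k) * (2 ^+ (k' - j))^-1 :> R.
  have -> : (k' - j)%N = (k' - k + (k - j))%N by rewrite addnBA // subnK.
  by rewrite exprD invfM mulrA mulfV ?mul1r // gt_eqF // exprn_gt0.
exact: (modulus_pow B1 (node_model b)) (point_self b) (i2_gt0 _).
Qed.

Lemma profile_start j x : gd j x \/ bstart j x -> 1 <= B * profile j j x.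
Proof.
move=> [g|b]; first by rewrite profile_good // mulr1.
rewrite profile_bad // subnn expr0 invr1.
exact: (model_unit (node_model b) (point_self b)).
Qed.

(** In a bad node this is the decay of the model; [2^-1 <= kap] serves good nodes, whose gauge
    [3^-1] has to be at most [B * kap]. *)
Lemma gauge_decay j k e x : 2^-1 <= kap -> gd j x \/ bstart j x -> nx j x = Some e ->
  in_node j k x -> gauge j x <= B * kap ^+ (e - k) * profile j k x.
Proof.
move=> kap2 [g|b] E ik.
  have kj := in_node_good g ik; move: E; rewrite next_good // => -[<-].
  rewrite kj subSnn expr1 gauge_good // profile_good // mulr1.
  have : kap <= B * kap by rewrite ler_peMl // ltW.
  by lra.
have [[e' [E' je gE _ _]]|[]] := gauge_bad b; last by rewrite E.
move: E'; rewrite E => -[ee]; rewrite -{e'}ee in je gE.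
have [jk /(_ _ E) /ltnW ke] := ik.
rewrite gE profile_bad // /point_modulus.
have -> : (2 ^+ (e - j))^-1 = (2 ^+ (k - j))^-1 / 2 ^+ (e - k) :> R.
  by rewrite -invfM -exprD addnC addnBA // subnK.
apply: (model_decay (node_model b)) => //; first exact: point_self.
by rewrite invf_le1 ?exprn_gt0 // exprn_ege1 // ler1n.
Qed.

Lemma gauge_growth j k e x : gd j x \/ bstart j x -> nx j x = Some e ->
  in_node j k x -> profile j k x <= 3 * B ^+ (e - k) * gauge j x.
Proof.
move=> [g|b] E ik.
  rewrite profile_good // gauge_good // mulrAC mulfV // mul1r exprn_ege1 //.
have [[e' [E' je gE _ _]]|[]] := gauge_bad b; last by rewrite E.
move: E'; rewrite E => -[ee]; rewrite -{e'}ee in je gE.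
have [jk /(_ _ E) /ltnW ke] := ik.
have h := profile_growth (or_intror b) jk ke.
have Eg : profile j e x = gauge j x by rewrite gE profile_bad.
rewrite Eg in h; apply: le_trans h _.
rewrite -mulrA ler_peMl ?ler1n // mulr_ge0 ?exprn_ge0 ?(ltW B0) //.
by apply: gauge_ge0; right.
Qed.

(** [k] is the dyadic scale of [mdist x y]. The upper bound estimates the three terms of the node
    distance. For the lower bound, either one of the two children has size comparable to that scale,
    and its gauge is large, or both are much smaller, and then the points in the chart are far
    apart. *)
Lemma node_dist_profile : exists2 C : R, 1 <= C & forall j x y,
  gd j x \/ bstart j x -> ch j x y -> ~ ns j x y -> x <> y ->
  exists k, [/\ in_node j k x, sc S k.+1 <= mdist x y, mdist x y <= 2 * A * sc S k,
    node_dist j x y <= C * profile j k x & profile j k x <= C * node_dist j x y].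
Proof.
have A0 : 0 < A := lt_le_trans ltr01 A1.
pose L := Lam * (A + 2).
have L0 : 0 < L by apply: mulr_gt0; [exact: lt_le_trans Lam1|have := A1; lra].
have A2 : 0 < 2 * A by exact: mulr_gt0.
pose a1 := 6 * A * L; have a10 : 0 < a1 by rewrite /a1 mulr_gt0 // mulr_gt0.
(* If both exit sizes are below [a0 * sc S k], the errors in the chart bound take at most half of
   [mdist x y >= sc S k / 2]; what remains gives [a2]. *)
pose a0 := (8 * L)^-1; have a00 : 0 < a0 by rewrite invr_gt0 mulr_gt0.
have ai : 0 < a0^-1 by rewrite invr_gt0.
pose a2 := (4 * L)^-1; have a20 : 0 < a2 by rewrite invr_gt0 mulr_gt0.
have [C1 C11 near] := @modulus_near R X B T a1 T0 B1 a10.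
have [C2 C21 scale] := @modulus_scale R X B T (2 * A) T0 B1 A2.
have [C3 C31 move_] := @modulus_move R X B T a1 T0 B1 a10.
have [C4 C41 scale'] := @modulus_scale R X B T a0^-1 T0 B1 ai.
have [C5 C51 far] := @modulus_far R X B T a2 T0 B1 a20.
have C23 : 1 <= C2 * C3 by exact: mulr_ege1.
have C34 : 1 <= C3 * C4 by exact: mulr_ege1.
exists (C1 + C2 + C2 * C3 + C4 + C3 * C4 + C5); first by lra.
set C := _ + C5; move=> j x y st xy nxy ne.
have nyx : ~ ns j y x by move/(next_same_sym S0).
have ex' : es j x <= mdist x y by exact: exit_size_le.
have ey' : es j y <= mdist x y by rewrite metric_sym; exact: exit_size_le.
have d0 : 0 < mdist x y by rewrite mdist_gt0; exact/eqP.
have xx : ch j x x by exact: chained_refl.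
have dA : mdist x y <= 2 * A * sc S j.
  case: st => [g|[_ g]].
    apply: le_trans (g x y xx xy) _; rewrite -mulrA ler_peMl ?ler1n //.
    by rewrite mulr_ge0 ?(ltW A0) // ltW // sc_gt0.
  have cxy : ch j.-1 x y by apply: chained_anti xy => //; exact: leq_pred.
  have cxx : ch j.-1 x x by exact: chained_refl.
  apply: le_trans (g x y cxx cxy) _.
  have : sc S j.-1 <= 2 * sc S j.
    case: (j) => [|j'] /=; last by rewrite -scS.
    by have := sc_gt0 0 S0; lra.
  by move=> h; rewrite -mulrA (mulrCA 2) ler_pM2l.
have exk : exists k, (j <= k)%N && (sc S k.+1 <= mdist x y).
  have [k ke] := sc_small S0 d0; exists (j + k)%N; rewrite leq_addr /=.
  by apply: le_trans (ltW ke); apply: sc_le => //; apply: leqW; exact: leq_addl.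
case: (ex_minnP exk) => k /andP[jk kd] kmin {exk}.
have dk : mdist x y <= 2 * A * sc S k.
  move: jk; rewrite leq_eqVlt => /orP[/eqP <-//|jk].
  case: k jk kd kmin => // k jk kd kmin.
  have [h|/ltW h] := leP (sc S k.+1) (mdist x y).
    by have := kmin k; rewrite -ltnS jk h => /(_ isT); rewrite ltnn.
  by apply: le_trans h _; rewrite ler_peMl ?(ltW (sc_gt0 _ S0)) //; have := A1; lra.
have ik : in_node j k x.
  split => // e E; rewrite ltnNge; apply/negP => ek.
  have je := next_gt E.
  case: e E je ek => // e E je ek; have := kmin e; rewrite -ltnS je /=.
  by move: ex'; rewrite /exit_size E => -> /(_ isT); rewrite leqNgt ek.
suff [h1 h2] : node_dist j x y <= C * profile j k x /\ profile j k x <= C * node_dist j x y.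
  by exists k.
case: st => [g|b].
  rewrite (node_dist_good _ g) // profile_good // !gauge_good //; last exact: good_chained g.
  by rewrite /C; split; lra.
have m := node_model b; have Zx := point_in b xx; have Zy := point_in b xy.
have by_ := bad_start_chained xy b.
rewrite profile_bad // (node_dist_bad _ b) // /point_modulus.
pose U z t := modulus (Z0 j (cn j x)) (th0 j (cn j x)) T z t.
pose t : R := (2 ^+ (k - j))^-1; have t0 : 0 < t := i2_gt0 _.
rewrite -/t -/(U _ _); set tau := th0 _ _ _ _.
have tau0 : 0 <= tau by exact: (model_ge0 m).
have sk : sc S k = sc S j * t by rewrite /sc /t -{1}(subnKC jk) exprD invfM mulrA.
have sj0 := sc_gt0 j S0.
have Ux0 : 0 <= U (point j x) t by exact: (modulus_ge0 T0 m Zx (ltW t0)).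
have gx0 : 0 <= gauge j x by apply: gauge_ge0; right.
have gy0 : 0 <= gauge j y by apply: gauge_ge0; right.
have gup w : ch j x w -> es j w <= mdist x y -> gauge j w <= U (point j w) (2 * A * t).
  move=> xw ew; have Zw := point_in b xw; have t20 : 0 < 2 * A * t by rewrite mulr_gt0.
  have [[e [_ _ -> _ se]]|[_ -> _]] := gauge_bad (bad_start_chained xw b); last first.
    exact: (modulus_ge0 T0 m Zw (ltW t20)).
  rewrite (point_modulusE _ xw); apply: (modulus_mono T0 m Zw (ltW (i2_gt0 _))).
  move: (le_trans ew dk); rewrite se sk => h.
  by rewrite -(ler_pM2l sj0); apply: le_trans h _; rewrite mulrCA.
have glo w : ch j x w -> a0 * sc S k <= es j w -> U (point j w) t <= C4 * gauge j w.
  move=> xw ew; have Zw := point_in b xw; have t20 : 0 < a0 * t by rewrite mulr_gt0.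
  have [[e [_ _ -> _ se]]|[_ _ e0]] := gauge_bad (bad_start_chained xw b); last first.
    by move: ew; rewrite e0 leNgt mulr_gt0 // sc_gt0.
  rewrite (point_modulusE _ xw).
  have := scale' _ _ _ _ _ _ m Zw t20; rewrite mulrA mulVf ?mul1r ?gt_eqF // => h.
  apply: le_trans h _; apply: ler_wpM2l; first exact: le_trans C41.
  apply: (modulus_mono T0 m Zw (ltW t20)).
  by move: ew; rewrite se sk mulrCA ler_pM2l.
have [nb1 nb2] := point_bounds b xy.
have dpt : mdist (point j x) (point j y) <= a1 * t.
  rewrite -(ler_pM2l sj0); apply: le_trans nb1 _; rewrite -/L.
  have -> : sc S j * (a1 * t) = L * (3 * (2 * A * sc S k)) by rewrite sk /a1; ring.
  by rewrite ler_pM2l //; lra.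
have dpt' : mdist (point j y) (point j x) <= a1 * t by rewrite metric_sym.
have Uyx : U (point j y) t <= C3 * U (point j x) t := move_ _ _ _ _ _ _ _ m Zx Zy t0 dpt.
have Uxy : U (point j x) t <= C3 * U (point j y) t := move_ _ _ _ _ _ _ _ m Zy Zx t0 dpt'.
have cC c v : 0 <= v -> 0 <= C - c -> c * v <= C * v.
  by move=> v0 c0; apply: ler_wpM2r => //; lra.
split.
  have h1 : tau <= C1 * U (point j x) t := near _ _ _ _ _ _ _ m Zx Zy t0 dpt.
  have h2 : gauge j x <= C2 * U (point j x) t.
    exact: le_trans (gup x xx ex') (scale _ _ _ _ _ _ m Zx t0).
  have h3 : gauge j y <= C2 * C3 * U (point j x) t.
    apply: le_trans (gup y xy ey') _; apply: le_trans (scale _ _ _ _ _ _ m Zy t0) _.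
    by rewrite -mulrA; apply: ler_wpM2l Uyx; exact: le_trans C21.
  apply: (@le_trans _ _ ((C1 + C2 + C2 * C3) * U (point j x) t)).
    by rewrite (mulrDl _ (C2 * C3)) (mulrDl C1); lra.
  by apply: cC => //; rewrite /C; lra.
have [hx|hx] := leP (a0 * sc S k) (es j x).
  apply: le_trans (glo x xx hx) _.
  apply: (@le_trans _ _ (C * gauge j x)); first by apply: cC => //; rewrite /C; lra.
  by apply: ler_wpM2l; [rewrite /C; lra|lra].
have [hy|hy] := leP (a0 * sc S k) (es j y).
  apply: (@le_trans _ _ (C3 * C4 * gauge j y)).
    apply: le_trans Uxy _; rewrite -mulrA; apply: ler_wpM2l; first exact: le_trans C31.
    exact: glo.
  apply: (@le_trans _ _ (C * gauge j y)); first by apply: cC => //; rewrite /C; lra.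
  by apply: ler_wpM2l; [rewrite /C; lra|lra].
have fard : a2 * t <= mdist (point j x) (point j y).
  rewrite -(ler_pM2l sj0) -(ler_pM2l L0).
  have -> : L * (sc S j * (a2 * t)) = sc S k / 4 by rewrite sk /a2; field; rewrite gt_eqF.
  have : L * (a0 * sc S k) = sc S k / 8 by rewrite /a0; field; rewrite gt_eqF.
  have h1 : L * es j x <= L * (a0 * sc S k) by rewrite ler_pM2l // ltW.
  have h2 : L * es j y <= L * (a0 * sc S k) by rewrite ler_pM2l // ltW.
  move: nb2; rewrite -/L (mulrDr L) (mulrDr L) => nb2.
  have := scS S k; lra.
apply: le_trans (far _ _ _ _ _ _ _ m Zx Zy t0 fard) _; rewrite -/tau.
apply: (@le_trans _ _ (C * tau)); first by apply: cC => //; rewrite /C; lra.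
by apply: ler_wpM2l; [rewrite /C; lra|lra].
Qed.

Local Notation nl := (@node_level R X S A).
Definition level_gauge i x := gauge (odflt 0%N (nl i x)) x.
Definition level_dist i x y := node_dist (odflt 0%N (nl i x)) x y.

Lemma exists_last_node x y : x <> y -> exists i j, [/\ nl i x = Some j, ch j x y & ~ ns j x y].
Proof.
move=> /nodes_separate[n nn].
have ex : exists i, ~~ `[< @same_node R X S A i x y >] by exists n; apply/asboolPn.
case: (ex_minnP ex) => -[|i] /asboolPn ni imin; first by case: ni; exact: same_node0.
have [j E xy] : @same_node R X S A i x y.
  apply: contrapT => h; have hb : ~~ `[< @same_node R X S A i x y >] by apply/asboolPn.
  by have := imin i hb; rewrite ltnn.
exists i, j; split => // nxy; apply: ni; apply/same_nodeS; by exists j.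
Qed.

Lemma node_level_pred i x j : nl i.+1 x = Some j ->
  exists2 j', nl i x = Some j' & nx j' x = Some j.
Proof. by rewrite /=; case: (nl i x) => // j'; exists j'. Qed.

Section Sizes.
Variables (eta : R).
Hypotheses (kap2 : 2^-1 <= kap) (eta0 : 0 < eta) (eta1 : eta <= 1) (etaB : eta * B <= 1).
Local Notation sig := (glue_size level_gauge eta).

Lemma level_size_gt0 i x j : nl i x = Some j -> 0 < sig i x.
Proof.
elim: i j => [|i IH] j //=; case E: (nl i x) => [j'|] //= E'.
rewrite !mulr_gt0 ?(IH j') //; rewrite /level_gauge E /=; exact: gauge_gt0 (node_status E) E'.
Qed.

(** The constants [3], [B] and [eta^-1] of one transition between generations are charged to the
    scales it consumes, of which there is at least one. So they enter the base of a power and do not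
    accumulate. *)
Let b := 3 * B * B / eta.

Let Bb : B <= b.
Proof.
rewrite /b ler_pdivlMr //; have -> : 3 * B * B = B * (3 * B) by ring.
apply: ler_wpM2l; first exact: ltW.
by have := B1; have := eta1; lra.
Qed.

Let b0 : 0 <= b. Proof. exact: le_trans (ltW B0) Bb. Qed.

Let BXb n : B ^+ n <= b ^+ n.
Proof. by apply: lerXn2r => //; rewrite nnegrE ltW. Qed.

Let growth_step n : (0 < n)%N -> 3 * B ^+ n / eta * B <= b ^+ n.
Proof.
case: n => // n _.
have -> : 3 * B ^+ n.+1 / eta * B = b * B ^+ n by rewrite /b exprS; ring.
by rewrite exprS; apply: ler_wpM2l.
Qed.

(** From above, each generation contributes a factor [eta * B] besides the power of [kap], and
    [eta * B <= 1] removes it. From below, the constants are hidden in [b]. *)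
Lemma size_between i n x j k j' : nl i x = Some j -> nl (i + n).+1 x = Some j' ->
  in_node j k x -> [/\ (k < j')%N,
    sig (i + n).+1 x <= kap ^+ (j' - k) * (sig i x * profile j k x) &
    sig i x * profile j k x <= b ^+ (j' - k) * sig (i + n).+1 x].
Proof.
move=> E; have st := node_status E; have s0 := level_size_gt0 E.
have p0 m l y : gd m y \/ bstart m y -> 0 <= profile m l y by move=> h; rewrite ltW // profile_gt0.
have gs i' j1 j2 : nl i' x = Some j1 -> nx j1 x = Some j2 -> forall k', in_node j1 k' x ->
    (k' < j2)%N /\ sig i'.+1 x <= kap ^+ (j2 - k') * (sig i' x * profile j1 k' x) /\
    B * (sig i' x * profile j1 k' x) <= b ^+ (j2 - k') * sig i'.+1 x.
  move=> E1 E2 k' ik; have st1 := node_status E1; have si0 := level_size_gt0 E1.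
  have kj := ik.2 _ E2; split => //.
  have gE : level_gauge i' x = gauge j1 x by rewrite /level_gauge E1.
  have hd := gauge_decay kap2 st1 E2 ik; have hg := gauge_growth st1 E2 ik.
  have g0 := gauge_gt0 st1 E2; rewrite /= gE; split.
    apply: (@le_trans _ _ (eta * sig i' x * (B * kap ^+ (j2 - k') * profile j1 k' x))).
      by apply: ler_wpM2l => //; rewrite mulr_ge0 // ltW.
    have -> : eta * sig i' x * (B * kap ^+ (j2 - k') * profile j1 k' x) =
      eta * B * (kap ^+ (j2 - k') * (sig i' x * profile j1 k' x)) by ring.
    rewrite ler_piMl // mulr_ge0 ?exprn_ge0 ?(ltW kap0) // mulr_ge0 ?(ltW si0) //; exact: p0.
  apply: (@le_trans _ _ (B * (sig i' x * (3 * B ^+ (j2 - k') * gauge j1 x)))).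
    by apply: ler_wpM2l; [exact: ltW|apply: ler_wpM2l => //; exact: ltW].
  have -> : B * (sig i' x * (3 * B ^+ (j2 - k') * gauge j1 x)) =
     3 * B ^+ (j2 - k') / eta * B * (eta * sig i' x * gauge j1 x).
    by field; rewrite gt_eqF.
  apply: ler_wpM2r; last by apply: growth_step; rewrite subn_gt0.
  by rewrite !mulr_ge0 // ltW.
elim: n j' => [|n IH] j' E' ik.
  rewrite addn0 in E' *; move: E'; rewrite /= E /= => E'.
  have [h1 [h2 h3]] := gs _ _ _ E E' _ ik; split => //.
  by apply: le_trans h3; rewrite ler_peMl // mulr_ge0 ?(ltW s0) // p0.
rewrite addnS in E' *; have [j1 E1 E2] := node_level_pred E'.
have [h1 h2 h3] := IH _ E1 ik.
have st1 := node_status E1; have s1 := level_size_gt0 E1.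
have ij : in_node j1 j1 x by split => // e; rewrite E2 => -[<-]; exact: next_gt E2.
have [h4 [h5 h6]] := gs _ _ _ E1 E2 _ ij.
have pj := profile_le1 j1 st1; have ps := profile_start st1.
have e1 : (j' - k = (j' - j1) + (j1 - k))%N by rewrite addnBA ?subnK // ltnW.
rewrite e1 !exprD; split; first exact: ltn_trans h1 h4.
  apply: le_trans h5 _; rewrite -mulrA; apply: ler_wpM2l; first exact: exprn_ge0 (ltW kap0).
  by apply: le_trans h2; rewrite ler_piMr // ltW.
apply: le_trans h3 _; rewrite (mulrC (b ^+ (j' - j1))) -mulrA; apply: ler_wpM2l.
  exact: exprn_ge0.
apply: le_trans h6; rewrite mulrCA ler_peMr //; exact: ltW.
Qed.

(** [sig i x * profile j k x] is the absolute size of the ball about [x] of scale [k]. Between two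
    scales it changes by a factor between two powers, no matter how many generations lie in
    between. *)
Lemma size_compare x i j k i' j' k' : nl i x = Some j -> nl i' x = Some j' ->
  in_node j k x -> in_node j' k' x -> (k <= k')%N ->
  sig i' x * profile j' k' x <= B * kap ^+ (k' - k) * (sig i x * profile j k x) /\
  sig i x * profile j k x <= B * b ^+ (k' - k) * (sig i' x * profile j' k' x).
Proof.
move=> E E' ik ik' kk; have st := node_status E; have st' := node_status E'.
have s0 := level_size_gt0 E; have s0' := level_size_gt0 E'.
have jk' := ik'.1; have jk := ik.1.
have p0 := profile_gt0 k st; have p0' := profile_gt0 k' st'.
have [ii|ii|ii] := ltngtP i i'.
- have E1 : nl (i + (i' - i.+1)).+1 x = Some j' by rewrite -addSn subnKC.
  have [h1 h2 h3] := size_between E E1 ik; rewrite -addSn (subnKC ii) in h2 h3.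
  have e1 : (k' - k = (k' - j') + (j' - k))%N by rewrite addnBA ?subnK // ltnW.
  have dk := profile_decay st' (leqnn j') jk' ik'.
  have gk := profile_growth st' (leqnn j') jk'.
  have pj := profile_le1 j' st'; have ps := profile_start st'.
  have kp n : 0 <= kap ^+ n by rewrite exprn_ge0 // ltW.
  rewrite e1 !exprD; split.
    apply: (@le_trans _ _ (sig i' x * (B * kap ^+ (k' - j')))).
      apply: ler_wpM2l; first exact: ltW.
      apply: le_trans dk _; rewrite ler_piMr // mulr_ge0 // ltW //.
    have -> : B * (kap ^+ (k' - j') * kap ^+ (j' - k)) * (sig i x * profile j k x) =
      B * kap ^+ (k' - j') * (kap ^+ (j' - k) * (sig i x * profile j k x)) by ring.
    rewrite [leLHS]mulrC; apply: ler_wpM2l => //.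
    exact: mulr_ge0 (ltW B0) (kp _).
  apply: le_trans h3 _.
  have -> : B * (b ^+ (k' - j') * b ^+ (j' - k)) * (sig i' x * profile j' k' x) =
    b ^+ (j' - k) * (sig i' x * (B * (b ^+ (k' - j') * profile j' k' x))) by ring.
  apply: ler_wpM2l; first exact: exprn_ge0.
  rewrite ler_peMr ?(ltW s0') //; apply: le_trans ps _; apply: ler_wpM2l; first exact: ltW.
  by apply: le_trans gk _; apply: ler_wpM2r; [exact: ltW|exact: BXb].
- have E1 : nl (i' + (i - i'.+1)).+1 x = Some j by rewrite -addSn subnKC.
  have [h1 _ _] := size_between E' E1 ik'.
  by exfalso; move: (leq_trans h1 (leq_trans jk kk)); rewrite ltnn.
- move: E' st' ik' p0' jk' s0'; rewrite -ii E => -[<-] _ ik' p0' _ _.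
  split.
    by rewrite mulrCA; apply: ler_wpM2l; [exact: ltW|exact: profile_decay].
  have -> : B * b ^+ (k' - k) * (sig i x * profile j k' x) =
    sig i x * (B * (b ^+ (k' - k) * profile j k' x)) by ring.
  apply: ler_wpM2l; first exact: ltW.
  apply: le_trans (profile_growth st jk kk) _.
  apply: (@le_trans _ _ (b ^+ (k' - k) * profile j k' x)).
    by apply: ler_wpM2r; [exact: ltW|exact: BXb].
  by rewrite ler_peMl // mulr_ge0 ?(ltW p0') // exprn_ge0.
Qed.

(** [theta x y] is comparable to the size of the ball about [x] of the scale of [mdist x y]. Both
    distances in the quotient start at [x], so [size_compare] applies, with [kap] when [z] has the
    finer scale and with [b] otherwise. *)
Lemma glued_distance_distortion (theta : distance R X) :
  (forall i x y, @same_node R X S A i x y -> ~ @same_node R X S A i.+1 x y ->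
     theta x y = sig i x * level_dist i x y) ->
  exists K a a', [/\ 0 < K, 0 < a, 0 < a' & forall x y z : X, x != y ->
    theta x z / theta x y <=
    K * ((mdist x z / mdist x y) `^ a + (mdist x z / mdist x y) `^ a')].
Proof.
move=> last; have [C C1 HC] := node_dist_profile.
have C0 : 0 < C := lt_le_trans ltr01 C1; have A0 : 0 < A := lt_le_trans ltr01 A1.
have b1 : 1 < b.
  rewrite /b ltr_pdivlMr // mul1r; apply: le_lt_trans eta1 _.
  apply: (@lt_le_trans _ _ 3); first by rewrite ltr1n.
  by rewrite -mulrA ler_peMr // mulr_ege1.
have k1 : 1 < kap^-1 by rewrite invf_gt1 //; case/andP: kap01.
have [a a0 Ha] := pow2_exponent k1; have [a' a'0 Ha'] := pow2_exponent b1.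
have key x y : x <> y -> exists i j k, [/\ nl i x = Some j, in_node j k x,
    sc S k.+1 <= mdist x y /\ mdist x y <= 2 * A * sc S k,
    theta x y <= C * (sig i x * profile j k x) &
    sig i x * profile j k x <= C * theta x y].
  move=> xy; have [i [j [E cxy nxy]]] := exists_last_node xy.
  have s0 := level_size_gt0 E; have st := node_status E.
  have [k [ik d1 d2 h1 h2]] := HC j x y st cxy nxy xy.
  have tE : theta x y = sig i x * node_dist j x y.
    rewrite (last i x y); [by rewrite /level_dist E|by exists j|].
    by move=> /same_nodeS[j']; rewrite E => -[<-].
  exists i, j, k; split => //; rewrite tE mulrCA; apply: ler_wpM2l => //; exact: ltW.
pose c := 4 * A; have c0 : 0 < c by rewrite mulr_gt0.
pose K := C * C * B * (c `^ a + c `^ a').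
have K0 : 0 < K by rewrite !mulr_gt0 // addr_gt0 // powR_gt0.
exists K, a, a'; split => // x y z /eqP xy.
have dxy : 0 < mdist x y by rewrite mdist_gt0; exact/eqP.
set tau := mdist x z / mdist x y.
have tau0 : 0 <= tau by rewrite divr_ge0 ?mdist_ge0 // ltW.
have pa0 : 0 <= tau `^ a + tau `^ a' by rewrite addr_ge0 // powR_ge0.
have [->|/eqP xz] := eqVneq z x.
  by rewrite distxx mul0r mulr_ge0 // ltW.
have [i [j [k [E ik [d1 d2] t1 t2]]]] := key x y xy.
have [i' [j' [k' [E' ik' [d1' d2'] t1' t2']]]] := key x z (fun e => xz (esym e)).
have p0 : 0 < sig i x * profile j k x.
  by rewrite mulr_gt0 ?(level_size_gt0 E) // profile_gt0 //; exact: node_status E.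
have t0 : 0 < theta x y by move: (lt_le_trans p0 t2); rewrite pmulr_rgt0.
rewrite ler_pdivrMr //.
have ratio : sc S k' / sc S k <= c * tau.
  have s2 : sc S k' <= 2 * mdist x z by rewrite scS ler_pM2l.
  rewrite ler_pdivrMr ?sc_gt0 //.
  have -> : c * tau * sc S k = c * mdist x z * sc S k / mdist x y by rewrite /tau; ring.
  rewrite ler_pdivlMr //.
  apply: le_trans (ler_pM (ltW (sc_gt0 k' S0)) (ltW dxy) s2 d2) _.
  by rewrite /c le_eqVlt; apply/orP; left; apply/eqP; ring.
have finish w al : 0 < al -> w <= (c * tau) `^ al -> 
    tau `^ al <= tau `^ a + tau `^ a' -> c `^ al <= c `^ a + c `^ a' ->
    sig i' x * profile j' k' x <= B * w * (sig i x * profile j k x) ->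
    theta x z <= K * (tau `^ a + tau `^ a') * theta x y.
  move=> al0 hw ht hc hM.
  have cw : w <= (c `^ a + c `^ a') * (tau `^ a + tau `^ a').
    apply: le_trans hw _; rewrite powRM ?(ltW c0) //.
    by apply: ler_pM => //; exact: powR_ge0.
  apply: le_trans t1' _; apply: (@le_trans _ _ (C * (B * w * (sig i x * profile j k x)))).
    by apply: ler_wpM2l hM; exact: ltW.
  apply: (@le_trans _ _ (C * (B * ((c `^ a + c `^ a') * (tau `^ a + tau `^ a')) *
      (C * theta x y)))).
    apply: ler_wpM2l; first exact: ltW.
    apply: (@le_trans _ _ (B * ((c `^ a + c `^ a') * (tau `^ a + tau `^ a')) *
      (sig i x * profile j k x))).
      apply: ler_wpM2r; first exact: ltW.
      by apply: ler_wpM2l => //; exact: ltW.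
    apply: ler_wpM2l t2; rewrite mulr_ge0 ?(ltW B0) // mulr_ge0 //.
    by rewrite addr_ge0 // powR_ge0.
  by rewrite /K le_eqVlt; apply/orP; left; apply/eqP; ring.
have sk k1' n : sc S k1' / sc S (k1' + n)%N = 2 ^+ n.
  by rewrite /sc exprD; field; rewrite !gt_eqF ?exprn_gt0.
have [kk|/ltnW kk] := leqP k k'.
  have [h _] := size_compare E E' ik ik' kk.
  apply: (finish (kap ^+ (k' - k)) a) => //.
  - have -> : kap ^+ (k' - k) = (sc S k' / sc S k) `^ a.
      rewrite -[kap]invrK exprVn Ha -{2}(subnKC kk) -{1}(invrK (sc S (k + _)%N / _)).
      rewrite invfM invrK (mulrC _^-1) sk -[(2 ^+ _)^-1]powR_inv1 ?exprn_ge0 //.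
      by rewrite -powRrM mulN1r powRN.
    apply: ge0_ler_powR ratio; rewrite ?nnegrE ?(ltW a0) //.
      by rewrite divr_ge0 // ltW // sc_gt0.
    by rewrite mulr_ge0 // ltW.
  - by rewrite lerDl powR_ge0.
  - by rewrite lerDl powR_ge0.
have [_ h] := size_compare E' E ik' ik kk.
apply: (finish (b ^+ (k - k')) a') => //.
- have -> : b ^+ (k - k') = (sc S k' / sc S k) `^ a' by rewrite Ha' -{2}(subnKC kk) sk.
  apply: ge0_ler_powR ratio; rewrite ?nnegrE ?(ltW a'0) //.
    by rewrite divr_ge0 // ltW // sc_gt0.
  by rewrite mulr_ge0 // ltW.
- by rewrite lerDr powR_ge0.
- by rewrite lerDr powR_ge0.
Qed.

End Sizes.

Lemma exists_node_distance p : doubling X -> 2^-1 <= kap -> 0 < q -> q < p ->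
  exists (theta : distance R X) (C : R),
    [/\ 1 <= C, packing theta p C & quasisymmetric (idfun : X -> remetric theta)].
Proof.
move=> dX kap2 q0 qp; have p0 : 0 < p := lt_trans q0 qp.
have [Ca Ca1 HA] := node_packing dX q0 qp; have [Cb Cb0 HB] := gauge_sum dX q0 qp.
have [c c0 cC] : exists2 c : R, 0 < c & forall e, 0 < e -> e <= c -> e `^ p * Cb <= 2^-1.
  have C0 : 0 < Cb + 1 by rewrite ltr_wpDl.
  have [D D0 DC] : exists2 D, 0 < D & D * (Cb + 1) = 2^-1.
    by exists (2 * (Cb + 1))^-1; [rewrite invr_gt0 mulr_gt0|field; rewrite gt_eqF].
  have DE : D = (D `^ p^-1) `^ p by rewrite -powRrM mulVf ?gt_eqF // powRr1 // ltW.
  exists (D `^ p^-1); first exact: powR_gt0.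
  move=> e e0 ec; rewrite -DC; apply: ler_pM; rewrite ?powR_ge0 ?lerDl //.
  by rewrite DE; apply: ge0_ler_powR ec; rewrite ?nnegrE ?powR_ge0 // ltW.
(* The three bounds serve the existence of the glued distance, the distortion estimate and the
   packing recursion. *)
pose eta := Num.min 2^-1 (Num.min B^-1 c).
have eta0 : 0 < eta by rewrite !lt_min invr_gt0 c0 invr_gt0 B0 ltr0n.
have eta2 : eta <= 2^-1 by rewrite ge_min lexx.
have etaB : eta * B <= 1.
  by rewrite -ler_pdivlMr // div1r /eta !ge_min lexx orbT.
have etac : eta <= c by rewrite /eta !ge_min lexx !orbT.
have eta01 : 0 < eta <= 2^-1 by rewrite eta0.
have eta1 : eta <= 1 by apply: le_trans eta2 _; rewrite invf_le1 // ler1n.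
pose E := @same_node R X S A.
have E0 x y : E 0%N x y by exact: same_node0.
have Esym i x y : E i x y -> E i y x by exact: same_node_sym.
have Etrans i x y z : E i x y -> E i y z -> E i x z by exact: same_node_trans.
have ES i x y : E i.+1 x y -> E i x y by exact: same_node_pred.
have lev i x y j : nl i x = Some j -> ch j x y -> nl i y = Some j.
  by move=> h1 h2; exact: node_level_chained h1 h2.
have next i x y : E i.+1 x y -> exists j, [/\ nl i x = Some j, ns j x y, ch j x y & nl i y = Some j].
  move=> /same_nodeS[j Ej nxy]; exists j; have cxy := next_same_chained S0 nxy.
  by split => //; exact: lev Ej cxy.
have tau_sym i x y : E i x y -> level_dist i x y = level_dist i y x.
  move=> [j Ej cxy]; rewrite /level_dist Ej (lev _ _ _ _ Ej cxy) /=.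
  exact: node_dist_sym (node_status Ej) cxy.
have tau_tri i x y z : E i x y -> E i y z ->
    level_dist i x z <= level_dist i x y + level_dist i y z.
  move=> [j Ej cxy] [j']; rewrite (lev _ _ _ _ Ej cxy) => -[<-] cyz.
  rewrite /level_dist Ej (lev _ _ _ _ Ej cxy) /=.
  exact: node_dist_tri (node_status Ej) cxy cyz.
have tau_le1 i x y : E i x y -> level_dist i x y <= 1.
  by move=> [j Ej cxy]; rewrite /level_dist Ej /=; exact: node_dist_le1 (node_status Ej) cxy.
have tau_const i x y z : E i x y -> E i.+1 y z -> level_dist i x y = level_dist i x z.
  move=> [j Ej cxy] /next[j' []]; rewrite (lev _ _ _ _ Ej cxy) => -[<-] nyz _ _.
  by rewrite /level_dist Ej /=; exact: node_dist_next (node_status Ej) cxy nyz.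
have g_const i x y : E i.+1 x y -> level_gauge i x = level_gauge i y.
  move=> /next[j [Ej nxy _ Ey]]; rewrite /level_gauge Ej Ey /=.
  by have [] := gauge_next (node_status Ej) nxy.
have g_ge0 i x : 0 <= level_gauge i x.
  rewrite /level_gauge; case Ej: (nl i x) => [j|] /=; apply: gauge_ge0.
    exact: node_status Ej.
  by left; exact: good0.
have g_gt0 i x : E i.+1 x x -> 0 < level_gauge i x.
  move=> /next[j [Ej [e Ee _] _ _]]; rewrite /level_gauge Ej /=.
  exact: gauge_gt0 (node_status Ej) Ee.
have g_le i x y : E i x y -> level_gauge i x <= level_dist i x y.
  move=> [j Ej cxy]; rewrite /level_gauge /level_dist Ej /=.
  exact: node_dist_ge (node_status Ej) cxy.
have tau_end i x : E i x x -> ~ E i.+1 x x -> level_dist i x x = 0.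
  move=> [j Ej _] n; rewrite /level_dist Ej /=; apply: node_dist_end (node_status Ej) _.
  case Ee: (nx j x) => [e|//]; exfalso; apply: n; apply/same_nodeS; exists j => //.
  by exists e => //; exact: chained_refl.
have separate x y : x <> y -> exists i, [/\ E i x y, ~ E i.+1 x y & 0 < level_dist i x y].
  move=> xy; have [i [j [Ej cxy nxy]]] := exists_last_node xy; exists i; split.
  - by exists j.
  - by move=> /next[j' [+ h _ _]]; rewrite Ej => -[jj]; apply: nxy; rewrite jj.
  have [C C1 HC] := node_dist_profile; have st := node_status Ej.
  have [k [_ _ _ _ h]] := HC j x y st cxy nxy xy.
  rewrite /level_dist Ej /=; have := lt_le_trans (profile_gt0 k st) h.
  by rewrite pmulr_rgt0 // (lt_le_trans ltr01).
have [theta [last th_le]] := exists_glued_distance E0 Esym Etrans ES tau_sym tau_tri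
  tau_le1 tau_const g_const g_ge0 g_gt0 g_le eta01 tau_end separate.
have node i (s : seq X) a : a \in s -> {in s &, forall x y, E i x y} ->
    {in s &, forall x y, x != y -> ~ E i.+1 x y} -> exists j, [/\ nl i a = Some j,
      gd j a \/ bstart j a, {in s, forall y, nl i y = Some j},
      {in s, forall y, ch j a y} & {in s &, forall y z, y != z -> ~ ns j y z}].
  move=> as_ sE sn; have [j Ej _] := sE a a as_ as_; exists j.
  have cs : {in s, forall y, ch j a y}.
    by move=> y ys; have [j'] := sE a y as_ ys; rewrite Ej => -[<-].
  have ls : {in s, forall y, nl i y = Some j} by move=> y ys; exact: lev Ej (cs y ys).
  split => //; first exact: node_status Ej.
  move=> y z ys zs yz h; apply: (sn y z ys zs yz); apply/same_nodeS; exists j => //.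
  exact: ls.
have packA i rho r s : 0 < r -> r <= rho -> uniq s ->
     {in s &, forall x y, E i x y} -> {in s &, forall x y, x != y -> ~ E i.+1 x y} ->
     {in s &, forall x y, x != y -> r <= level_dist i x y <= rho} ->
     (size s)%:R <= Ca * (rho / r) `^ p.
  move=> r0 rr us sE sn sd; case Es: s => [|a s'].
    by rewrite /= mulr_ge0 ?powR_ge0 // (le_trans ler01).
  rewrite -Es; have as_ : a \in s by rewrite Es mem_head.
  have [j [Ej st ls cs ns']] := node i s a as_ sE sn.
  apply: (HA j a) => // y z ys zs yz; have := sd y z ys zs yz.
  by rewrite /level_dist ls.
have packB i rho s : 0 < rho -> uniq s ->
     {in s &, forall x y, E i x y} -> {in s &, forall x y, x != y -> ~ E i.+1 x y} ->
     {in s, forall x, level_gauge i x <= rho} ->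
     {in s &, forall x y, x != y -> level_dist i x y <= rho} ->
     \sum_(x <- s) level_gauge i x `^ p <= Cb * rho `^ p.
  move=> rho0 us sE sn sg sd; case Es: s => [|a s'].
    by rewrite big_nil mulr_ge0 // powR_ge0.
  rewrite -Es; have as_ : a \in s by rewrite Es mem_head.
  have [j [Ej st ls cs ns']] := node i s a as_ sE sn.
  have -> : \sum_(x <- s) level_gauge i x `^ p = \sum_(x <- s) gauge j x `^ p.
    by rewrite big_seq [RHS]big_seq; apply: eq_bigr => y ys; rewrite /level_gauge ls.
  apply: (HB j a) => //.
    by move=> y ys; have := sg y ys; rewrite /level_gauge ls.
  by move=> y z ys zs yz; have := sd y z ys zs yz; rewrite /level_dist ls.
have pk := glued_packing E0 Esym Etrans ES tau_le1 g_const g_ge0 g_gt0 g_le eta01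
  separate p0 Ca1 (cC eta eta0 etac) packA packB last th_le.
have [K [a [a' [K0 a0 a'0 H]]]] := glued_distance_distortion kap2 eta0 eta1 etaB last.
exists theta, (2 * Ca * 2 `^ p); split => //.
  have p2 : 1 <= 2 `^ p :> R by apply: powR_ge1; [rewrite ler1n|exact: ltW].
  by apply: mulr_ege1 => //; have := Ca1; lra.
exact: qs_of_ineq (distortion_powR K0 a0 a'0) H.
Qed.

End NodeGeometry.

Lemma dim_AR_le_components (R : realType) (X : metricType R) (Kl Ks p q : R) :
  compact [set: X] -> (exists x y : X, x != y) -> doubling X ->
  uniformly_perfect X -> approximately_self_similar X -> 1 <= Kl ->
  (forall Y : set X, components X Y -> linearly_connected Kl (set_type Y)) ->
  1 <= Ks ->
  (forall r : R, 0 < r -> (r%:E <= diam [set: X])%E ->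
     exists W_ : set (set X), \bigcup_(W in W_) W = [set: X] /\
       forall W : set X, W_ W ->
         [/\ clopen W,
             ((r / Ks)%:E <= set_dist W (~` W))%E &
             exists2 Y : set X, components X Y &
               Y `<=` W /\ W `<=` neighborhood r Y]) ->
  (forall delta : R, 0 < delta ->
     finite_set [set Y : set X | components X Y /\ (delta%:E <= diam Y)%E]) ->
  0 < p -> p < q ->
  (forall Y : set X, components X Y -> (dim_AR (set_type Y) < p%:E)%E) ->
  (dim_AR X <= q%:E)%E.
Proof.
move=> cX two dX upX ass Kl1 lin Ks1 cov fin p0 pq dY; have [x0 [y0 xy0]] := two.
have [D0 _ dD] := fin_diam cX.
have bD (x y : X) : mdist x y <= D0.
  by rewrite -lee_fin -dD; exact: mdist_le_diam.
have D00 : 0 < D0 by apply: lt_le_trans (bD x0 y0); rewrite mdist_gt0.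
have [S [A [Lam [delta [bS [S0 A1 Lam1 d0] H]]]]] :=
  bad_class_charts cX D00 bD Kl1 Ks1 dD ass lin fin cov.
have cY Y : components X Y -> connected [set: set_type Y] by move=> /lin[].
have [c [c0 c2 cp M]] := exists_uniform_models cX p0 d0 cY (fin delta d0) dY.
pose P (u : nat * X) (v : (X -> X) * (X -> X -> R) * set X) :=
  bad_start S A u.1 u.2 -> [/\ forall x, chained (sc S u.1) u.2 x -> v.2 (v.1.1 x),
     model v.2 v.1.2 (delta / 2) (p - c) c^-1 (1 - c) &
     forall x x' l l', chained (sc S u.1) u.2 x -> chained (sc S u.1) u.2 x' ->
       (u.1 <= l)%N -> (forall m, (u.1 <= m <= l)%N -> ~ good S A m x) ->
       (u.1 <= l')%N -> (forall m, (u.1 <= m <= l')%N -> ~ good S A m x') ->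
       sc S u.1 * mdist (v.1.1 x) (v.1.1 x') <= Lam * (mdist x x' + sc S l + sc S l') /\
       mdist x x' <= Lam * (sc S u.1 * mdist (v.1.1 x) (v.1.1 x') + sc S l + sc S l')].
(* Only bad starts carry a chart and a model; elsewhere [P] is vacuous and any data will do. *)
have exP u : exists v, P u v.
  have [b|nb] := pselect (bad_start S A u.1 u.2); last first.
    by exists (idfun, fun _ _ => 0, setT).
  have [psi [h1 [x [x' [cx cx' dxx]]] h2]] := H u.1 u.2 b.1 b.2.
  have uu : chained (sc S u.1) u.2 u.2 by exact: chained_refl.
  have [th m] := M (psi u.2) (psi x) (psi x') (h1 _ _ uu cx) (h1 _ _ uu cx') dxx.
  exists (psi, th, connected_component [set: X] (psi u.2)) => _; split => //.
  by move=> z uz; exact: h1.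
have [f fP] := choice exP.
have c1 : 1 <= c^-1 by rewrite invf_ge1 // (le_trans c2) // invf_le1 // ler1n.
have k01 : 0 < 1 - c < 1 by apply/andP; split; lra.
have k2 : 2^-1 <= 1 - c by lra.
have T0 : 0 < delta / 2 by exact: divr_gt0.
have q0 : 0 < p - c by rewrite subr_gt0.
have qp : p - c < p by rewrite ltrBlDr ltrDl.
have [theta [C [C1 pk qs]]] := @exists_node_distance R X S A Lam (delta / 2) c^-1 (1 - c)
  (p - c) x0 (fun j x => (f (j, x)).1.1) (fun j x => (f (j, x)).1.2) (fun j x => (f (j, x)).2)
  S0 A1 Lam1 T0 c1 k01 bS (fun j x => fP (j, x)) p dX k2 q0 qp.
exact: dim_AR_le cX two upX qs (ltW p0) pq C1 pk.
Qed.

Theorem corollary3p15 (R : realType) (X : metricType R)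
  (X_nonempty : [set: X] !=set0)
  (X_compact : compact [set: X])
  (X_doubling : doubling X)
  (X_uniformly_perfect : uniformly_perfect X)
  (X_self_similar : approximately_self_similar X)
  (components_linearly_connected : exists2 Kl : R, 1 <= Kl &
     forall Y : set X, components X Y -> linearly_connected Kl (set_type Y))
  (components_separated : exists2 Ks : R, 1 <= Ks &
     forall r : R, 0 < r -> (r%:E <= diam [set: X])%E ->
       exists W_ : set (set X), \bigcup_(W in W_) W = [set: X] /\
         forall W : set X, W_ W ->
           [/\ clopen W,
               ((r / Ks)%:E <= set_dist W (~` W))%E &
               exists2 Y : set X, components X Y &
                 Y `<=` W /\ W `<=` neighborhood r Y])
  (components_diam_to_0 : forall delta : R, 0 < delta ->
     finite_set [set Y : set X | components X Y /\ (delta%:E <= diam Y)%E]) :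
  dim_AR X = ereal_sup [set dim_AR (set_type Y) | Y in components X].
Proof.
have [Kl Kl1 lin] := components_linearly_connected.
have [Ks Ks1 cov] := components_separated.
have [x0 _] := X_nonempty.
set s := ereal_sup _.
have sY Y : components X Y -> (dim_AR (set_type Y) <= s)%E.
  by move=> cY; apply: ereal_sup_ubound; exists Y.
have cx0 : components X (connected_component [set: X] x0) by exists x0.
have s0 : (0 <= s)%E by apply: le_trans (sY _ cx0); exact: dim_AR_ge0.
apply/eqP; rewrite eq_le; apply/andP; split; last first.
  apply: ge_ereal_sup => _ [Y cY <-]; have [x _ Yx] := cY.
  apply: dim_AR_subset => //.
  - by exists x; rewrite -Yx; exact: same_refl.
  - by rewrite -Yx; exact: closed_component.
  - by have [] := lin Y cY.
have [two|one] := pselect (exists x y : X, x != y); last first.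
  suff -> : dim_AR X = 0%E by [].
  rewrite /dim_AR ifT //; apply/asboolP; exists x0; apply/seteqP; split => // y _ /=.
  by apply/eqP/negPn/negP => yx; apply: one; exists y, x0.
apply/lee_addgt0Pr => e e0; case E: s s0 => [t| |] s0 //; last exact: leey.
rewrite lee_fin in s0.
(* The exponent [t + e / 2] lies strictly above the dimensions of all components, as the choice of
   models requires, and strictly below [t + e], as the final passage to a regular distance
   requires. *)
apply: (@dim_AR_le_components R X Kl Ks (t + e / 2)) => //.
- by rewrite ltr_wpDl // divr_gt0.
- by lra.
- move=> Y /sY; rewrite E => /le_lt_trans; apply.
  by rewrite lte_fin ltrDl divr_gt0.
Qed.
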